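(* Let $(C[[\hbar]],1_C,\cdot,\mathbf K)$ be an anomaly-free binary QFT algebra over $\Bbbk$ with classical cohomology $H$, and let $\underline{\grave{\boldsymbol\pi}}=\grave{\boldsymbol\pi}_1,\grave{\boldsymbol\pi}_2,\dots$ be its canonical family of maps constructed (from a classical off-to-on-shell retract) in the context. Then there is a family $\underline{\grave m}=\grave m_2,\grave m_3,\dots$ which determines $\grave{\boldsymbol\pi}_2,\grave{\boldsymbol\pi}_3,\dots$ by the recursive formula, for all $n\ge2$ and homogeneous $v_1,\dots,v_n\in H$, $$\grave{\boldsymbol\pi}_n(v_1,\dots,v_n)=\sum_{\substack{\mathfrak p\in P(n)\\ |B_{|\mathfrak p|}|=n-|\mathfrak p|+1\\ n-1\sim_{\mathfrak p}n}}(-\hbar)^{n-|\mathfrak p|-1}\varepsilon(\mathfrak p)\;\grave{\boldsymbol\pi}_{|\mathfrak p|}\big(v_{B_1},\dots,v_{B_{|\mathfrak p|-1}},\grave m(v_{B_{|\mathfrak p|}})\big).$$ Moreover $\underline{\grave m}$ has the following properties: (symmetry) $\grave m_n$ is a $\Bbbk$-linear map $S^nH\to H$ of degree $0$ for all $n\ge2$; (unity) $\grave m_2(1_H,v_1)=v_1$, and $\grave m_n(1_H,v_1,\dots,v_{n-1})=0$ for all $n\ge3$; (generalized associativity) for all $n\ge0$ and homogeneous $v_1,\dots,v_n,w_1,w_2,w_3\in H$, $$\sum_{\varsigma\subset[n]}\varepsilon(\varsigma\sqcup\varsigma^c)\,\grave m\big(v_\varsigma\otimes\grave m(v_{\varsigma^c}\otimes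 w_1\otimes w_2)\otimes w_3\big)=\sum_{\varsigma\subset[n]}\varepsilon(\varsigma\sqcup\varsigma^c)(-1)^{|v_{\varsigma^c}||w_1|}\,\grave m\big(v_\varsigma\otimes w_1\otimes\grave m(v_{\varsigma^c}\otimes w_2\otimes w_3)\big).$$
   Context: Conventions. $\Bbbk$ is a field of characteristic zero, $\hbar$ a formal parameter of degree $0$. Spaces are $\mathbb Z$-graded, $|x|$ is the degree, $Jx=(-1)^{|x|}x$. $\mathrm{Hom}(V,W)^j$ is the space of $\Bbbk$-linear maps of degree $j$; $V[[\hbar]]=\bigoplus_jV^j[[\hbar]]$. A series $\mathbf b=b^{(0)}+\hbar b^{(1)}+\cdots\in\mathrm{Hom}(V,W)^j[[\hbar]]$ is identified with the $\Bbbk[[\hbar]]$-linear map $V[[\hbar]]\to W[[\hbar]]$ it determines; $b^{(0)}$ is its classical limit. $S^nV$ is the $n$-th graded-symmetric power. Partitions. $P(n)$ is the set of partitions $\mathfrak p=B_1\sqcup\cdots\sqcup B_{|\mathfrak p|}$ of $[n]=\{1,\dots,n\}$ into nonempty blocks, ordered by increasing maximal elements, each block in increasing order; $k\sim_{\mathfrak p}l$ means $k,l$ lie in the same block. For $B=\{j_1<\dots<j_r\}$, $v_B=v_{j_1}\otimes\cdots\otimes v_{j_r}$, $Jv_B$ means $J$ applied to every entry, $\beta(v_B)=\beta_r(v_{j_1},\dots,v_{j_r})$. The Koszul sign $\varepsilon(\mathfrak p)$ is defined by $v_1\odot\cdots\odot v_n=\varepsilon(\mathfrak p)v_{B_1}\odot\cdots\odot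 v_{B_{|\mathfrak p|}}$. A sum over ''$\mathfrak p\in P(n)$, $|B_i|=n-|\mathfrak p|+1$'' runs over pairs $(\mathfrak p,i)$. For $\varsigma\subset[n]$ with complement $\varsigma^c$, $v_\varsigma=v_{j_1}\otimes\cdots\otimes v_{j_r}$ if $\varsigma=\{j_1<\dots<j_r\}$, $|v_\varsigma|$ is its total degree, $\varepsilon(\varsigma\sqcup\varsigma^c)$ is the Koszul sign of the permutation taking $v_1\otimes\cdots\otimes v_n$ to $v_\varsigma\otimes v_{\varsigma^c}$, and $\grave m(v_1\otimes\cdots\otimes v_n)=\grave m_n(v_1,\dots,v_n)$. Binary QFT algebra. A tuple $(C[[\hbar]],1_C,\cdot,\mathbf K)$ where $(C,1_C,\cdot)$ is a unital graded-commutative associative $\Bbbk$-algebra (product extended to $C[[\hbar]]$), $\mathbf K=K^{(0)}+\hbar K^{(1)}+\cdots\in\mathrm{Hom}(C,C)^1[[\hbar]]$, $\mathbf K1_C=0$, $\mathbf K\circ\mathbf K=0$, $1_C\neq K^{(0)}x$ for all $x\in C$, such that the family $\boldsymbol\ell_1,\boldsymbol\ell_2,\dots$ determined recursively by $\mathbf K(x_1\cdots x_n)=\sum_{\mathfrak p\in P(n),|B_i|=n-|\mathfrak p|+1}(-\hbar)^{n-|\mathfrak p|}\varepsilon(\mathfrak p)Jx_{B_1}\cdots Jx_{B_{i-1}}\cdot\boldsymbol\ell(x_{B_i})\cdot x_{B_{i+1}}\cdots x_{B_{|\mathfrak p|}}$ satisfies $\boldsymbol\ell_n\in\mathrm{Hom}(S^nC,C)^1[[\hbar]]$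 for all $n\ge 1$. Anomaly-free. Let $K=K^{(0)}$, $H$ the cohomology of $(C,K)$ (classical cohomology), $1_H$ the class of $1_C$. Fix a classical off-to-on-shell retract $(f,h,s)$: $f\in\mathrm{Hom}(H,C)^0$, $h\in\mathrm{Hom}(C,H)^0$, $s\in\mathrm{Hom}(C,C)^{-1}$ with $f(1_H)=1_C$, $Kf=0$, $f$ inducing the identity on cohomology, $h(1_C)=1_H$, $hK=0$, $hf=\mathrm{id}_H$, $fh=\mathrm{id}_C-Ks-sK$, $K=KsK$, $s(1_C)=0$, $ss=sf=hs=0$. Put $f^{(0)}=f$ and, for $n\ge1$, $g^{(n)}=\sum_{j=0}^{n-1}K^{(n-j)}f^{(j)}-\sum_{j=1}^{n-1}f^{(n-j)}\kappa^{(j)}$, $\kappa^{(n)}=hg^{(n)}$, $f^{(n)}=-sg^{(n)}$; $\boldsymbol\kappa=\sum_{n\ge1}\hbar^n\kappa^{(n)}$, $\mathbf f=\sum_{n\ge0}\hbar^nf^{(n)}$. The algebra is anomaly-free if $\boldsymbol\kappa=0$ (independent of the choice of retract); then $\mathbf K\circ\mathbf f=0$. Canonical families. For $\boldsymbol\Omega\in\mathrm{Hom}(S^nH,C)^0[[\hbar]]$ with classical limit $\Omega$, define $\nabla\boldsymbol\Omega$ by $(-\hbar)\nabla\boldsymbol\Omega=\boldsymbol\Omega-\mathbf f\circ h\circ\Omega-\mathbf K\circ s\circ\Omega-s\circ K\circ\Omega$ (the right side is divisible by $\hbar$). Set $\boldsymbol\phi_1=\mathbf f$, $\grave{\boldsymbol\pi}_1=\mathrm{id}_H$,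 and recursively for $n\ge2$: $\boldsymbol\Omega_n(v_1,\dots,v_n)=\sum_{\mathfrak p\in P(n),|\mathfrak p|\ne1}(-\hbar)^{n-|\mathfrak p|}\varepsilon(\mathfrak p)\boldsymbol\phi(v_{B_1})\cdots\boldsymbol\phi(v_{B_{|\mathfrak p|}})$, $\boldsymbol\Omega_n^{[i]}=\nabla^i\boldsymbol\Omega_n$ with classical limit $\Omega_n^{[i]}$, and $\boldsymbol\phi_n=-\boldsymbol\Omega_n^{[n-1]}$, $\grave{\boldsymbol\pi}_n=\sum_{i=0}^{n-2}(-\hbar)^i\,h\circ\Omega_n^{[i]}$. *)

(* Defs.v *)
From HB Require Import structures.
From mathcomp Require Import all_boot all_order all_algebra.
From mathcomp Require Import boolp functions.
Set Implicit Arguments.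
Unset Strict Implicit.
Unset Printing Implicit Defensive.
Import GRing.Theory.
Local Open Scope ring_scope.

(* A Z-graded k-module is given internally, by the projections hcomp i onto the
   summands V^i of V; hsupp x lists the (finitely many) degrees in which x has
   a nonzero component. *)
HB.mixin Record isGraded (k : pzRingType) V of GRing.Lmodule k V := {
  hcomp : int -> V -> V;
  hsupp : V -> seq int;
  hcomp_linear : forall i, linear (hcomp i);
  hcomp_comp : forall i j x, hcomp i (hcomp j x) = if i == j then hcomp i x else 0;
  hsupp_uniq : forall x, uniq (hsupp x);
  mem_hsupp : forall i x, (i \in hsupp x) = (hcomp i x != 0);
  hcomp_sum : forall x, x = \sum_(i <- hsupp x) hcomp i x
}.

#[short(type="gradModType")]
HB.structure Definition GradedModule (k : pzRingType) :=
  {V of isGraded k V & GRing.Lmodule k V}.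

Definition homog (k : pzRingType) (V : gradModType k) (i : int) (x : V) : bool :=
  hcomp i x == x.

HB.mixin Record isGradedCommutative (k : pzRingType) A
    of GRing.Algebra k A & isGraded k A := {
  homog_1 : homog 0 (1 : A);
  homog_mul : forall i j (x y : A), homog i x -> homog j y -> homog (i + j) (x * y);
  homog_mulC : forall i j (x y : A), homog i x -> homog j y ->
    x * y = (-1) ^+ absz (i * j) * (y * x)
}.

#[short(type="gradComAlgType")]
HB.structure Definition GradedComAlgebra (k : pzRingType) :=
  {A of isGradedCommutative k A & GRing.Algebra k A & isGraded k A}.

Definition Jop (k : pzRingType) (V : gradModType k) (x : V) : V :=
  \sum_(i <- hsupp x) (-1) ^+ absz i *: hcomp i x.

Definition of_degree (k : pzRingType) (V W : gradModType k) (j : int) (b : V -> W) :=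
  forall i x, homog i x -> homog (i + j) (b x).

(* F : seq V -> W stands for a family of operations, the one of arity n being
   the restriction of F to sequences of size n.  Elements of Hom(S^n V, W)^j are
   graded-symmetric n-linear maps of degree j. *)
Record sym_hom (k : pzRingType) (V W : gradModType k) (n : nat) (j : int)
    (F : seq V -> W) : Prop := SymHom {
  sym_hom_linear : forall (s1 s2 : seq V) a x y, (size s1 + size s2).+1 = n ->
    F (s1 ++ (a *: x + y) :: s2) = a *: F (s1 ++ x :: s2) + F (s1 ++ y :: s2);
  sym_hom_sym : forall (s1 s2 : seq V) i1 i2 x y, (size s1 + size s2).+2 = n ->
    homog i1 x -> homog i2 y ->
    F (s1 ++ x :: y :: s2) = (-1) ^+ absz (i1 * i2) *: F (s1 ++ y :: x :: s2);
  sym_hom_degree : forall (d : 'I_n -> int) (v : n.-tuple V),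
    (forall i, homog (d i) (tnth v i)) -> homog (\sum_i d i + j) (F v)
}.

(* w : series V stands for the formal series w 0 + hbar w 1 + hbar^2 w 2 + ...
   Addition and scaling are pointwise; the ring structure of series is smul, not
   the pointwise one. *)
Definition series (V : Type) := nat -> V.

Section Series.
Variable k : pzRingType.

Definition sconst (V : lmodType k) (x : V) : series V :=
  fun r => if r == 0%N then x else 0.

(* multiplication by (- hbar)^m *)
Definition nhbar (V : lmodType k) (m : nat) (w : series V) : series V :=
  fun r => if (m <= r)%N then (-1) ^+ m *: w (r - m)%N else 0.

(* division by - hbar of a series with zero constant term *)
Definition div_nhbar (V : lmodType k) (w : series V) : series V :=
  fun r => - w r.+1.

Definition smul (A : algType k) (a b : series A) : series A :=
  fun r => \sum_(i < r.+1) a i * b (r - i)%N.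

(* the k[[hbar]]-linear extension of a series of maps *)
Definition sapp (V W : lmodType k) (b : nat -> V -> W) (w : series V) : series W :=
  fun r => \sum_(i < r.+1) b i (w (r - i)%N).

End Series.

(* v_B, where B lists positions in v; positions are numbered from 0, so that [n]
   is 'I_n. *)
Definition entries (k : pzRingType) (V : lmodType k) n (v : seq V) (B : seq 'I_n) : seq V :=
  [seq nth 0 v i | i : 'I_n <- B].

Definition blocks n (P : {set {set 'I_n}}) : seq (seq 'I_n) :=
  [seq enum (mem (B : {set 'I_n})) |
    B <- sort (fun A B : {set 'I_n} => (\max_(i in A) i <= \max_(i in B) i)%N) (enum P)].

(* The Koszul sign of v_1 ... v_n -> v_(s_1) ... v_(s_n), with v_i of degree d i,
   is (-1) to this exponent: one factor per inversion of s. *)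
Fixpoint koszul n (d : 'I_n -> int) (s : seq 'I_n) : nat :=
  if s is x :: s' then
    (\sum_(y <- s' | (y < x)%N) absz (d x * d y)%R + koszul d s')%N
  else 0%N.

(* The multilinear extension of an operation F known on homogeneous entries,
   F ds vs being its value at entries vs of degrees ds. *)
Fixpoint degs (k : pzRingType) (V : gradModType k) (vs : seq V) : seq (seq int) :=
  if vs is v :: vs' then [seq i :: ds | i <- hsupp v, ds <- degs vs'] else [:: [::]].

Definition mlext (k : pzRingType) (V : gradModType k) (W : nmodType)
    (F : seq int -> seq V -> W) (vs : seq V) : W :=
  \sum_(ds <- degs vs) F ds [seq hcomp p.1 p.2 | p <- zip ds vs].

Section BinaryQFT.
Variables (k : fieldType) (C : gradComAlgType k) (K : nat -> {linear C -> C}).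

(* For |B_i| = n - |P| + 1, all other blocks of P are singletons, so that
   x_(B_j), j != i, is a single element of C. *)
Definition descendant_eq (l : seq C -> series C) n (d : 'I_n -> int) (x : seq C) :=
  (fun r => K r (\prod_(y <- x) y)) =
  \sum_(P : {set {set 'I_n}} | partition P [set: 'I_n])
    \sum_(i < #|P| | size (nth [::] (blocks P) i) == (n - #|P| + 1)%N)
      nhbar (n - #|P|) ((-1) ^+ koszul d (flatten (blocks P)) *:
        smul (smul (sconst (\prod_(y <- entries x (flatten (take i (blocks P)))) Jop y))
                   (l (entries x (nth [::] (blocks P) i))))
             (sconst (\prod_(y <- entries x (flatten (drop i.+1 (blocks P)))) y))).

(* The family l is unique, hbar being a non-zero-divisor: it occurs in arity n
   as (- hbar)^(n-1) l_n. *)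
Record binary_qft : Prop := BinaryQFT {
  bqft_degree : forall r, of_degree 1 (K r);
  bqft_unit : forall r, K r 1 = 0;
  bqft_square : forall x, sapp K (fun r => K r x) = 0;
  bqft_unit_not_exact : forall x, 1 <> K 0%N x;
  bqft_descendants : exists l : seq C -> series C,
    forall n, (0 < n)%N ->
      (forall r, sym_hom n 1 (fun x => l x r)) /\
      (forall (d : 'I_n -> int) (x : n.-tuple C),
         (forall i, homog (d i) (tnth x i)) -> descendant_eq l d x)
}.

(* H is the cohomology of (C, K 0), the class map cl being meaningful on cocycles
   only. *)
Record is_cohomology (H : gradModType k) (cl : C -> H) : Prop := IsCohomology {
  coh_linear : forall a x y, K 0%N x = 0 -> K 0%N y = 0 ->
    cl (a *: x + y) = a *: cl x + cl y;
  coh_degree : forall i x, K 0%N x = 0 -> homog i x -> homog i (cl x);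
  coh_surj : forall v, exists2 x, K 0%N x = 0 & cl x = v;
  coh_eq0 : forall x, K 0%N x = 0 -> (cl x = 0 <-> exists y, x = K 0%N y)
}.

Variables (H : gradModType k) (cl : C -> H).
Variables (f : {linear H -> C}) (h : {linear C -> H}) (s : {linear C -> C}).

Record is_retract : Prop := IsRetract {
  ret_f_degree : of_degree 0 f;
  ret_h_degree : of_degree 0 h;
  ret_s_degree : of_degree (-1) s;
  ret_f1 : f (cl 1) = 1;
  ret_Kf : forall v, K 0%N (f v) = 0;
  ret_clf : forall v, cl (f v) = v;
  ret_h1 : h 1 = cl 1;
  ret_hK : forall x, h (K 0%N x) = 0;
  ret_hf : forall v, h (f v) = v;
  ret_fh : forall x, f (h x) = x - K 0%N (s x) - s (K 0%N x);
  ret_KsK : forall x, K 0%N x = K 0%N (s (K 0%N x));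
  ret_s1 : s 1 = 0;
  ret_ss : forall x, s (s x) = 0;
  ret_sf : forall v, s (f v) = 0;
  ret_hs : forall x, h (s x) = 0
}.

(* g^(n) in terms of f^(j), kappa^(j), j < n *)
Definition gterm (fk : nat -> (H -> C) * (H -> H)) (n : nat) (v : H) : C :=
  \sum_(0 <= j < n) K (n - j)%N ((fk j).1 v)
  - \sum_(1 <= j < n) (fk (n - j)%N).1 ((fk j).2 v).

(* (f^(j), kappa^(j)) for j <= n; kappa has no term of order 0 *)
Fixpoint fkappa_upto (n : nat) : nat -> (H -> C) * (H -> H) :=
  if n is n'.+1 then
    fun j => if (j <= n')%N then fkappa_upto n' j
      else (fun v => - s (gterm (fkappa_upto n') n v),
            fun v => h (gterm (fkappa_upto n') n v))
  else fun=> (f : H -> C, fun=> 0).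

Definition fkappa (n : nat) := fkappa_upto n n.
Definition fbar (n : nat) : H -> C := (fkappa n).1.
Definition kappa (n : nat) : H -> H := (fkappa n).2.

Lemma fkappa_uptoE n j : (j <= n)%N -> fkappa_upto n j = fkappa j.
Proof.
elim: n => [|n IHn] /=; first by rewrite leqn0 => /eqP->.
case: (leqP j n) => [le_jn _|lt_nj le_jn]; first by rewrite IHn.
by have -> : j = n.+1 by [apply/eqP; rewrite eqn_leq le_jn]; rewrite /fkappa /= ltnn.
Qed.

Lemma gtermE n v : gterm fkappa n v =
  \sum_(0 <= j < n) K (n - j)%N (fbar j v)
  - \sum_(1 <= j < n) fbar (n - j) (kappa j v).
Proof. by []. Qed.

Lemma gterm_upto n v : gterm (fkappa_upto n) n.+1 v = gterm fkappa n.+1 v.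
Proof.
rewrite /gterm; congr (_ - _); apply: eq_big_nat => j /andP[j_gt0 lt_jn].
  by rewrite fkappa_uptoE.
by rewrite !fkappa_uptoE // leq_subLR -addn1 addnC leq_add2r.
Qed.

Lemma fbar0 : fbar 0 = f. Proof. by []. Qed.

Lemma fbarS n v : fbar n.+1 v = - s (gterm fkappa n.+1 v).
Proof. by rewrite -gterm_upto /fbar /fkappa /= ltnn. Qed.

Lemma kappaS n v : kappa n.+1 v = h (gterm fkappa n.+1 v).
Proof. by rewrite -gterm_upto /kappa /fkappa /= ltnn. Qed.

Definition anomaly_free : Prop := forall n v, (0 < n)%N -> kappa n v = 0.

(* nabla Omega evaluated at v depends only on the series w = Omega(v). *)
Definition nabla (w : series C) : series C :=
  div_nhbar (w - (fun r => fbar r (h (w 0%N))) - (fun r => K r (s (w 0%N)))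
             - sconst (s (K 0%N (w 0%N)))).

Lemma nablaE (w : series C) : is_retract -> nhbar 1 (nabla w) =
  w - (fun r => fbar r (h (w 0%N))) - (fun r => K r (s (w 0%N)))
    - sconst (s (K 0%N (w 0%N))).
Proof.
move=> ret; apply/funext => -[|r]; rewrite /nhbar /nabla /div_nhbar /=.
  rewrite !fctE /sconst /= fbar0 (ret_fh ret).
  move: (K 0%N (s _)) (s (K 0%N _)) => a b.
  by rewrite !opprD !opprK !addrA subrr add0r (addrAC a) subrr add0r subrr.
by rewrite subn1 /= expr1 scaleN1r opprK.
Qed.

Definition Omega_of (phi : seq H -> series C) (vs : seq H) : series C :=
  mlext (fun ds us =>
    let n := size us in
    let d (i : 'I_n) := nth 0 ds i in
    \sum_(P : {set {set 'I_n}} | partition P [set: 'I_n] && (#|P| != 1%N))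
      nhbar (n - #|P|) ((-1) ^+ koszul d (flatten (blocks P)) *:
        \big[@smul k C/sconst 1]_(B <- blocks P) phi (entries us B))) vs.

(* phi on sequences of size at most m; the value on the empty sequence is
   irrelevant *)
Fixpoint phi_upto (m : nat) (vs : seq H) : series C :=
  if m is m'.+1 then
    match vs with
    | [::] => 0
    | [:: v] => fun r => fbar r v
    | _ => - iter (size vs).-1 nabla (Omega_of (phi_upto m') vs)
    end
  else 0.

Definition phi (vs : seq H) : series C := phi_upto (size vs) vs.

Definition Omega (vs : seq H) : series C := Omega_of phi vs.

Lemma size_block n (P : {set {set 'I_n}}) (B : seq 'I_n) :
  partition P [set: 'I_n] -> #|P| != 1%N -> B \in blocks P -> (size B < n)%N.
Proof.
move=> partP P_neq1 /mapP[A]; rewrite mem_sort mem_enum => PA ->; rewrite -cardE.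
rewrite -[n in (_ < n)%N]card_ord ltn_neqAle max_card andbT.
apply: contra P_neq1 => /eqP cardA.
have {}cardA : A = [set: 'I_n].
  by apply/eqP; rewrite eqEcard subsetT cardsT cardA leqnn.
apply/cards1P; exists A; apply/eqP; rewrite eqEsubset sub1set PA andbT.
apply/subsetP=> A' PA'; rewrite inE.
have [_ trivP /negP P0] := and3P partP.
apply: contraT => neqA.
have := trivIsetP trivP _ _ PA' PA neqA.
by rewrite cardA -setI_eq0 setIT => /eqP A'0; case: P0; rewrite -A'0.
Qed.

Lemma eq_Omega_of (phi1 phi2 : seq H -> series C) vs :
  (forall us, (size us < size vs)%N -> phi1 us = phi2 us) ->
  Omega_of phi1 vs = Omega_of phi2 vs.
Proof.
move=> eq_phi; rewrite /Omega_of /mlext; apply: eq_bigr => ds _.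
apply: eq_bigr => P /andP[partP P_neq1]; congr (nhbar _ (_ *: _)).
apply: eq_big_seq => B PB; apply: eq_phi; rewrite [size (entries _ _)]size_map.
apply: leq_trans (size_block partP P_neq1 PB) _.
by rewrite size_map size_zip geq_minr.
Qed.

Lemma phi_uptoE m vs : (size vs <= m)%N -> phi_upto m vs = phi vs.
Proof.
rewrite /phi; elim: {vs}m {-2}m vs (leqnn m) => [|b IHb] m vs.
  by rewrite leqn0 => /eqP-> /= ; case: vs.
case: m => [|m] le_mb; first by case: vs.
case: vs => [//|v [//|u vs]] /= le_vs; congr (- nabla (iter _ _ _)).
apply: (@eq_Omega_of _ (phi_upto (size vs).+1)) => us lt_us; rewrite !IHb //.
- exact: leq_trans le_vs le_mb.
- exact: leq_trans lt_us le_vs.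
Qed.

Lemma phi1 v : phi [:: v] = fun r => fbar r v. Proof. by []. Qed.

Lemma phiE vs : (1 < size vs)%N ->
  phi vs = - iter (size vs).-1 nabla (Omega vs).
Proof.
case: vs => [//|v [//|u vs]] _; rewrite {1}/phi /=; congr (- nabla (iter _ _ _)).
by apply: (@eq_Omega_of (phi_upto (size vs).+1)) => us lt_us; exact: phi_uptoE.
Qed.

Definition canonical_pi (vs : seq H) : series H :=
  match vs with
  | [::] => 0
  | [:: v] => sconst v
  | _ => \sum_(0 <= i < (size vs).-1)
           nhbar i (sconst (h (iter i nabla (Omega vs) 0%N)))
  end.

End BinaryQFT.

(* Main.v *)
(* Let Z_n = Omega_n + (- hbar)^(n-1) phi_n be the sum over all partitions, so
   that Z is the exponential of the family (- hbar)^(n-1) phi_n.  By induction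
   on n, K Z = 0: as K Z_j = 0 for j < n, binarity makes K Omega_n divisible by
   hbar^(n-1), and every application of nabla removes one factor - hbar, so that
   K phi_n cancels the rest.  The same expansion gives Z = f pi + K x.

   Binarity also says that K conjugated by Z preserves the families divisible by
   hbar^n in arity n.  With m_n = h Omega_n^[n-2], one constructs by induction on
   the arity a family Lambda such that
     Z(v, a, b) - sum (- hbar)^(..) Z(v', m(v'', a, b)) = K (Lambda Z)(v).
   In arity n the obstruction has the form hbar^n e = f alpha + K beta, where alpha is the
   difference of the two sides of the recursive formula; it has degree < n in hbar, while
   H[[hbar]] embeds in C[[hbar]] / im K with torsion-free cokernel, so alpha = 0 and e is exact.

   Applying the recursive formula twice to pi(v, w1, w2, w3) and to
   pi(v, w3, w1, w2) and comparing yields associativity, by induction on the number of v's.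

   All families are functions on lists of homogeneous letters, where Koszul
   signs are produced by the recursion defining [sh]. *)
Require Import Defs.
From HB Require Import structures.
From mathcomp Require Import all_boot all_order all_algebra.
From mathcomp Require Import boolp functions.
From mathcomp Require Import zify.
Import GRing.Theory.
Local Open Scope ring_scope.
Set Implicit Arguments.
Unset Strict Implicit.
Unset Printing Implicit Defensive.

(** The obstacle is that Z itself is in general divisible by no power of hbar, because of the
    partition into singletons. The difference Z(v, a, b) - sum (- hbar)^(..) Z(v', m(v'', a, b)) is
    not either, but it factors for the convolution defined by splittings of lists: the blocks
    containing neither a nor b make up Z, and the other factor, the gap, is divisible by hbar^n when
    v has n entries. This is why the primitive is sought in the form Lambda Z: since K Z = 0, also K
    (Lambda Z) is a multiple of Z, and the cofactors can be compared arity by arity. As Z of the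
    empty list is 1, the product of the first nonzero error with Z is that error itself.

    The operations of a binary QFT algebra are given on entries in C, whereas the proof inserts
    series such as phi. They are replaced by the Koszul brackets of K, which accept series and are
    obtained by inverting multiplication in the same convolution. Binarity then says that the
    bracket of n entries is divisible by hbar^(n-1). *)

Definition sg (V : zmodType) (b : bool) (x : V) : V := if b then - x else x.

Section Sg.
Variable V : zmodType.
Implicit Types x y : V.

Lemma sgD b x y : sg b (x + y) = sg b x + sg b y.
Proof. by case: b => //=; rewrite opprD. Qed.
Lemma sg0 b : sg b (0 : V) = 0.
Proof. by case: b; rewrite //= oppr0. Qed.
Lemma sgN b x : sg b (- x) = - sg b x.
Proof. by case: b. Qed.
Lemma sgsg b c x : sg b (sg c x) = sg (b (+) c) x.
Proof. by case: b; case: c => //=; rewrite opprK. Qed.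
(** Additivity is a bare hypothesis because the maps concerned, such as multiplication by a series
    or evaluation at an exponent, are not bundled as additive morphisms. *)
Lemma morph_sg (W : zmodType) (c : V -> W) b x :
  (forall y z, c (y + z) = c y + c z) -> c (sg b x) = sg b (c x).
Proof.
move=> cD; case: b => //=; apply/eqP; rewrite -addr_eq0 -cD addNr.
by have := cD 0 0; rewrite addr0 => /(congr1 (fun z => z - c 0)); rewrite addrK subrr => ->.
Qed.
Lemma morph_0 (W : zmodType) (c : V -> W) :
  (forall y z, c (y + z) = c y + c z) -> c 0 = 0.
Proof. by move=> cD; apply: (addrI (c 0)); rewrite -cD !addr0. Qed.
End Sg.

Lemma sgZ (R : pzRingType) (V : lmodType R) n (x : V) : (-1) ^+ n *: x = sg (odd n) x.
Proof. by rewrite -signr_odd; case: (odd n); rewrite ?expr0 ?expr1 ?scale1r ?scaleN1r. Qed.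

(** A sign is carried as its exponent in [bool], so an identity of Koszul signs is a boolean
    identity between parities, checked by cases once the parities have been generalized to
    variables. *)
Ltac sgb := rewrite ?sgsg; congr (sg _ _);
  repeat match goal with |- context [?b] =>
    match type of b with bool => is_var b; case: b => //= end end.

(** * Signed sums over the splittings of a list *)

Section Shuffle.
Variables (T : Type) (p : T -> bool).
Implicit Types (s A B : seq T).

Definition par s : bool := foldr (fun x b => p x (+) b) false s.

Lemma par_cat A B : par (A ++ B) = par A (+) par B.
Proof. by elim: A => //= x A ->; rewrite addbA. Qed.
Lemma par_rcons s x : par (rcons s x) = par s (+) p x.
Proof. by rewrite -cats1 par_cat /= addbF. Qed.

(* sum over the splittings of s into two subsequences A and B, with the Koszul
   sign of s -> A ++ B; p is the parity of a letter *)
Fixpoint sh (V : zmodType) s (G : seq T -> seq T -> V) : V :=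
  if s is x :: s' then
    sh s' (fun A B => G (x :: A) B)
    + sh s' (fun A B => sg (p x && par A) (G A (x :: B)))
  else G [::] [::].

Lemma eq_sh (V : zmodType) s (G1 G2 : seq T -> seq T -> V) :
  (forall A B, size A + size B = size s -> par A (+) par B = par s -> G1 A B = G2 A B)%N ->
  sh s G1 = sh s G2.
Proof.
elim: s G1 G2 => [|x s IHs] G1 G2 eqG /=; first exact: eqG.
congr (_ + _); apply: IHs => A B szAB pAB.
  by apply: eqG; rewrite /= ?addSn ?szAB // -addbA pAB.
by congr (sg _ _); apply: eqG; rewrite /= ?addnS ?szAB // addbCA pAB.
Qed.

Lemma sh_ext (V : zmodType) s (G1 G2 : seq T -> seq T -> V) : (forall A B, G1 A B = G2 A B) -> sh s G1 = sh s G2.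
Proof. by move=> eqG; apply: eq_sh => *; exact: eqG. Qed.

Variable V : zmodType.
Implicit Types G : seq T -> seq T -> V.

Lemma shD s G1 G2 : sh s (fun A B => G1 A B + G2 A B) = sh s G1 + sh s G2.
Proof.
elim: s G1 G2 => //= x s IHs G1 G2; rewrite IHs.
by under [X in _ + X = _]sh_ext do rewrite sgD; rewrite IHs addrACA.
Qed.

Lemma sh_morph (W : zmodType) (c : V -> W) s G :
  (forall y z, c (y + z) = c y + c z) -> c (sh s G) = sh s (fun A B => c (G A B)).
Proof.
move=> cD; elim: s G => //= x s IHs G; rewrite cD !IHs; congr (_ + _).
by apply: sh_ext => A B; rewrite morph_sg.
Qed.

Lemma sh_sg s b G : sh s (fun A B => sg b (G A B)) = sg b (sh s G).
Proof. by rewrite -(sh_morph (c := sg b)) //; exact: sgD. Qed.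

Lemma shB s G1 G2 : sh s (fun A B => G1 A B - G2 A B) = sh s G1 - sh s G2.
Proof. by rewrite shD (sh_sg s true). Qed.

Lemma sh0 s : sh s (fun _ _ => 0 : V) = 0.
Proof. by rewrite -(sh_morph (c := fun=> 0) s (fun _ _ => 0)) // => *; rewrite addr0. Qed.

Lemma sh_eq0 s G : (forall A B, (size A + size B = size s)%N -> G A B = 0) -> sh s G = 0.
Proof. by move=> G0; rewrite -[RHS](sh0 s); apply: eq_sh => A B /G0. Qed.

Lemma sh_rcons s x G : sh (rcons s x) G =
  sh s (fun A B => G A (rcons B x)) + sh s (fun A B => sg (p x && par B) (G (rcons A x) B)).
Proof.
elim: s G => [|y s IHs] G /=; first by rewrite addrC !andbF.
rewrite !IHs addrACA; congr (_ + _); congr (_ + _); apply: sh_ext => A B.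
rewrite par_rcons; move: (p x) (p y) (par A) (par B) => a b c e; sgb.
Qed.

(** Graded cocommutativity of the coproduct that splits a list into two subsequences. *)
Lemma sh_comm s G : sh s G = sh s (fun A B => sg (par A && par B) (G B A)).
Proof.
elim: s G => //= x s IHs G; rewrite addrC; congr (_ + _); rewrite IHs; apply: sh_ext => A B.
  by move: (p x) (par A) (par B) => a b c; sgb.
by move: (p x) (par A) (par B) => a b c; sgb.
Qed.

(** Coassociativity: both sides are the signed sum over splittings into three subsequences. The
    convolution products defined by [sh] are therefore associative. *)
Lemma sh_assoc s (G : seq T -> seq T -> seq T -> V) :
  sh s (fun A B => sh A (fun A1 A2 => G A1 A2 B)) =
  sh s (fun A B => sh B (fun B1 B2 => G A B1 B2)).
Proof.
elim: s G => //= x s IHs G; rewrite shD -addrA; congr (_ + _); first exact: IHs.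
under [X in _ = X]sh_ext do rewrite sgD -!sh_sg.
rewrite shD; congr (_ + _); rewrite -IHs.
  apply: sh_ext => A B; apply: eq_sh => A1 A2 _ _; done.
apply: sh_ext => A B; rewrite -sh_sg; apply: eq_sh => A1 A2 _ <-.
by move: (p x) (par A1) (par A2) => a b c; sgb.
Qed.

(** Splittings with x and y in the same part are handled by the hypotheses; those separating x and y
    are matched with each other. *)
Lemma sh_swap s1 s2 x y G :
  (forall A1 A2 B, G (A1 ++ x :: y :: A2) B = sg (p x && p y) (G (A1 ++ y :: x :: A2) B)) ->
  (forall A1 A2 B, G B (A1 ++ x :: y :: A2) = sg (p x && p y) (G B (A1 ++ y :: x :: A2))) ->
  sh (s1 ++ x :: y :: s2) G = sg (p x && p y) (sh (s1 ++ y :: x :: s2) G).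
Proof.
elim: s1 G => [|z s1 IHs] G sw1 sw2 /=.
  rewrite !sgD -!sh_sg -!addrA; congr (_ + _); first by apply: sh_ext => A B; exact: (sw1 [::]).
  rewrite addrCA; congr (_ + _); last congr (_ + _); apply: sh_ext => A B.
  - by move: (p x) (p y) (par A) => a b c; sgb.
  - by move: (p x) (p y) (par A) => a b c; sgb.
  - by rewrite (sw2 [::]); move: (p x) (p y) (par A) => a b c; sgb.
rewrite sgD; congr (_ + _); first by apply: IHs => A1 A2 B; [exact: (sw1 (z :: A1)) | exact: sw2].
apply: IHs => A1 A2 B; first by rewrite sw1 !par_cat /=;
  move: (p x) (p y) (p z) (par A1) (par A2) => a b c e g; sgb.
by rewrite (sw2 (z :: A1)) !sgsg addbC.
Qed.

(** The map c stands for a scaling or for multiplication by - hbar, so that one lemma serves both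
    for linearity in an entry and for the passage from constant entries to series. *)
Lemma sh_slot s1 s2 x y z (c : V -> V) G : p x = p z -> p y = p z ->
  (forall u v, c (u + v) = c u + c v) ->
  (forall A1 A2 B, G (A1 ++ z :: A2) B = G (A1 ++ x :: A2) B + c (G (A1 ++ y :: A2) B)) ->
  (forall A1 A2 B, G B (A1 ++ z :: A2) = G B (A1 ++ x :: A2) + c (G B (A1 ++ y :: A2))) ->
  sh (s1 ++ z :: s2) G = sh (s1 ++ x :: s2) G + c (sh (s1 ++ y :: s2) G).
Proof.
move=> px py cD; elim: s1 G => [|t s1 IHs] G sl1 sl2 /=.
  rewrite cD addrACA; congr (_ + _); rewrite (sh_morph _ _ cD) -shD; apply: sh_ext => A B.
    exact: (sl1 [::]).
  by rewrite (sl2 [::]) px py sgD -(morph_sg _ _ cD).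
rewrite cD addrACA; congr (_ + _).
  by apply: IHs => A1 A2 B; [exact: (sl1 (t :: A1)) | exact: sl2].
apply: IHs => A1 A2 B; rewrite (morph_sg _ _ cD).
  by rewrite sl1 sgD !par_cat /= px py.
by rewrite (sl2 (t :: A1)) sgD.
Qed.

Lemma sh_leftE s G : (forall A B, (size A + size B = size s)%N -> size B != 0%N -> G A B = 0) ->
  sh s G = G s [::].
Proof.
elim: s G => //= x s IHs G G0; rewrite IHs => [|A B szAB Bn0].
  rewrite [X in _ + X]sh_eq0 ?addr0 // => A B szAB; rewrite G0 ?sg0 //=.
  by rewrite addnS szAB.
by apply: G0; rewrite //= addSn szAB.
Qed.

Lemma sh_rightE s G : (forall A B, (size A + size B = size s)%N -> size A != 0%N -> G A B = 0) ->
  sh s G = G [::] s.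
Proof.
move=> G0; rewrite sh_comm sh_leftE /= ?andbF // => A B szAB Bn0.
by rewrite G0 ?sg0 // addnC.
Qed.

End Shuffle.

Lemma par_map (T U : Type) (p : U -> bool) (i : T -> U) s :
  par p (map i s) = par (p \o i) s.
Proof. by elim: s => //= x s ->. Qed.

Lemma sh_map (T U : Type) (p : U -> bool) (i : T -> U) (V : zmodType) s
    (G : seq U -> seq U -> V) :
  sh p (map i s) G = sh (p \o i) s (fun A B => G (map i A) (map i B)).
Proof.
elim: s G => //= x s IHs G; rewrite !IHs; congr (_ + _).
by apply: sh_ext => A B; rewrite par_map.
Qed.

(** * Signed sums over the partitions of a list *)

Section PartitionSums.
Variables (T : Type) (p : T -> bool).
Implicit Types (s A B : seq T) (bl : seq (seq T)).

(** The block of the last letter is split off, as it comes last in the order of blocks. The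
    remaining letters A are not a subterm of s, whence the fuel. *)
Fixpoint ps_fuel (V : zmodType) n s (G : seq (seq T) -> V) : V :=
  if n is n'.+1 then
    if s is x :: s' then
      sh p (belast x s') (fun A B =>
        ps_fuel n' A (fun bl => G (rcons bl (rcons B (last x s')))))
    else G [::]
  else G [::].

(* sum over the partitions of s into nonempty blocks, ordered by their last
   element, with the Koszul sign of s -> flatten bl *)
Definition ps (V : zmodType) s (G : seq (seq T) -> V) : V := ps_fuel (size s) s G.

Lemma ps_fuelE (V : zmodType) n s (G : seq (seq T) -> V) :
  (size s <= n)%N -> ps_fuel n s G = ps s G.
Proof.
rewrite /ps; elim: n {-2}n (leqnn n) s G => [|N IHN] n; first by rewrite leqn0 => /eqP-> [].
case: n => [|n] le_nN [|x s] G //= le_sn; apply: eq_sh => A B szAB _.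
have leA : (size A <= size s)%N by rewrite -(size_belast x s) -szAB leq_addr.
by rewrite !IHN //; [exact: leq_trans le_sn le_nN | exact: leq_trans leA le_sn].
Qed.

Lemma ps_rcons (V : zmodType) s x (G : seq (seq T) -> V) :
  ps (rcons s x) G = sh p s (fun A B => ps A (fun bl => G (rcons bl (rcons B x)))).
Proof.
rewrite /ps size_rcons; case: s => [//|y s].
rewrite -[LHS]/(sh p (belast y (rcons s x)) (fun A B =>
  ps_fuel (size (y :: s)) A (fun bl => G (rcons bl (rcons B (last y (rcons s x))))))).
rewrite belast_rcons last_rcons; apply: eq_sh => A B szAB _.
by rewrite ps_fuelE // -szAB leq_addr.
Qed.

Lemma seq_rcons_ind (P : seq T -> Prop) :
  P [::] -> (forall s x, (forall A, (size A <= size s)%N -> P A) -> P (rcons s x)) ->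
  forall s, P s.
Proof.
move=> P0 PS s; elim: {s}(size s) {-2}s (leqnn (size s)) => [|n IHn] s.
  by case: s.
case/lastP: s => [//|s x]; rewrite size_rcons ltnS => le_sn; apply: PS => A le_As.
exact: IHn (leq_trans le_As le_sn).
Qed.

Lemma eq_ps (V : zmodType) s (G1 G2 : seq (seq T) -> V) :
  (forall bl, size (flatten bl) = size s -> par p (flatten bl) = par p s ->
     all (fun b => size b != 0)%N bl -> G1 bl = G2 bl) ->
  ps s G1 = ps s G2.
Proof.
elim/seq_rcons_ind: s G1 G2 => [|s x IHs] G1 G2 eqG; first exact: eqG.
rewrite !ps_rcons; apply: eq_sh => A B szAB pAB; apply: IHs => [|bl szbl pbl bl0].
  by rewrite -szAB leq_addr.
apply: eqG; rewrite -?cats1 ?flatten_cat /= ?cats0 ?size_cat ?szbl ?addnA ?szAB //.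
  by rewrite !par_cat pbl addbA pAB.
by rewrite all_cat bl0 /= andbT size_cat addn1.
Qed.

Lemma ps_ext (V : zmodType) s (G1 G2 : seq (seq T) -> V) :
  (forall bl, G1 bl = G2 bl) -> ps s G1 = ps s G2.
Proof. by move=> eqG; apply: eq_ps => *; exact: eqG. Qed.

Lemma psD (V : zmodType) s (G1 G2 : seq (seq T) -> V) :
  ps s (fun bl => G1 bl + G2 bl) = ps s G1 + ps s G2.
Proof.
elim/seq_rcons_ind: s G1 G2 => [//|s x IHs] G1 G2; rewrite !ps_rcons -shD.
by apply: eq_sh => A B szAB _; rewrite IHs // -szAB leq_addr.
Qed.

Lemma ps_morph (V W : zmodType) (c : V -> W) s (G : seq (seq T) -> V) :
  (forall y z, c (y + z) = c y + c z) -> c (ps s G) = ps s (fun bl => c (G bl)).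
Proof.
move=> cD; elim/seq_rcons_ind: s G => [//|s x IHs] G; rewrite !ps_rcons (sh_morph _ _ _ cD).
by apply: eq_sh => A B szAB _; rewrite IHs // -szAB leq_addr.
Qed.

Lemma ps_sg (V : zmodType) s b (G : seq (seq T) -> V) :
  ps s (fun bl => sg b (G bl)) = sg b (ps s G).
Proof. by rewrite -(ps_morph (c := sg b)) //; exact: sgD. Qed.

Lemma ps_sh (V : zmodType) s t (G : seq (seq T) -> seq T -> seq T -> V) :
  ps s (fun bl => sh p t (G bl)) = sh p t (fun A B => ps s (fun bl => G bl A B)).
Proof.
elim: t G => //= x t IHt G; rewrite psD !IHt; congr (_ + _).
by apply: sh_ext => A B; rewrite ps_sg.
Qed.

Lemma ps_eq0 (V : zmodType) s (G : seq (seq T) -> V) :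
  (forall bl, size (flatten bl) = size s -> par p (flatten bl) = par p s ->
     all (fun b => size b != 0)%N bl -> G bl = 0) -> ps s G = 0.
Proof.
move=> G0; rewrite (eq_ps (G2 := fun=> 0)) //; symmetry.
by apply: (@ps_morph V V (fun=> 0) s (fun=> 0)) => *; rewrite addr0.
Qed.

Lemma par_flatten bl : par (par p) bl = par p (flatten bl).
Proof. by elim: bl => //= b bl ->; rewrite par_cat. Qed.

(* Taking partitions is a morphism of shuffle coalgebras. *)
Lemma ps_blocks (V : zmodType) s (G : seq (seq T) -> seq (seq T) -> V) :
  ps s (fun bl => sh (par p) bl G) = sh p s (fun A B => ps A (fun q => ps B (G q))).
Proof.
elim/seq_rcons_ind: s G => [//|s x IHs] G.
rewrite ps_rcons sh_rcons.
(* The last block [rcons B x] goes either to the second factor or to the first; in the latter case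
   it passes the blocks made of A2, whence the sign. *)
transitivity (sh p s (fun A B => sh p A (fun A1 A2 =>
    ps A1 (fun q => ps A2 (fun r => G q (rcons r (rcons B x))))
    + sg ((par p B (+) p x) && par p A2)
       (ps A1 (fun q => ps A2 (fun r => G (rcons q (rcons B x)) r)))))).
  apply: eq_sh => A B szAB _; have leA : (size A <= size s)%N by rewrite -szAB leq_addr.
  under ps_ext do rewrite sh_rcons.
  rewrite psD !IHs // -shD; apply: sh_ext => A1 A2; congr (_ + _).
  rewrite -ps_sg; apply: ps_ext => q; rewrite -ps_sg; apply: eq_ps => r _ <- _.
  by rewrite par_flatten par_rcons.
under sh_ext do rewrite shD.
rewrite shD; congr (_ + _).
  rewrite sh_assoc; apply: sh_ext => A B; rewrite -ps_sh; apply: ps_ext => q.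
  by rewrite ps_rcons.
rewrite sh_assoc.
under [RHS]sh_ext do rewrite ps_rcons -sh_sg.
rewrite [RHS]sh_assoc; apply: sh_ext => A B; rewrite [LHS]sh_comm; apply: sh_ext => B1 B2.
by move: (p x) (par p B1) (par p B2) => a b c; sgb.
Qed.

Lemma size_flatten_leq bl : all (fun b => size b != 0)%N bl -> (size bl <= size (flatten bl))%N.
Proof.
elim: bl => //= b bl IHbl /andP[b0 /IHbl le_bl]; rewrite size_cat -add1n.
by rewrite leq_add // lt0n.
Qed.

(** The other blocks are nonempty. Equality, which is the condition |B_i| = n - |P| + 1, means that
    they are all singletons. *)
Lemma size_nth_flatten bl i : (i < size bl)%N -> all (fun b => size b != 0)%N bl ->
  (size (nth [::] bl i) + size bl <= (size (flatten bl)).+1)%N.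
Proof.
elim: bl i => //= b bl IHbl [|i] lt_i /andP[b0 bl0]; rewrite size_cat.
  by rewrite addnS ltnS leq_add2l size_flatten_leq.
by have := IHbl i lt_i bl0; move: b0; rewrite /=; lia.
Qed.

Lemma ps_singletons (V : zmodType) s (G : seq (seq T) -> V) :
  ps s (fun bl => if size bl == size s then G bl else 0) = G [seq [:: x] | x <- s].
Proof.
elim/seq_rcons_ind: s G => [//|s x IHs] G; rewrite ps_rcons sh_leftE => [|A B szAB B0].
  rewrite -[RHS]/(_ (map _ _)) map_rcons -(IHs s (leqnn _) (fun bl => G (rcons bl [:: x]))).
  by apply: ps_ext => bl; rewrite !size_rcons eqSS.
apply: ps_eq0 => bl szbl _ bl0; rewrite !size_rcons eqSS ifN //.
rewrite ltn_eqF // (leq_ltn_trans (size_flatten_leq bl0)) // szbl -szAB.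
by rewrite -[ltnLHS]addn0 ltn_add2l lt0n.
Qed.

End PartitionSums.

Lemma ps_map (T U : Type) (p : U -> bool) (i : T -> U) (V : zmodType) s
    (G : seq (seq U) -> V) :
  ps p (map i s) G = ps (p \o i) s (fun bl => G (map (map i) bl)).
Proof.
elim/seq_rcons_ind: s G => [//|s x IHs] G; rewrite map_rcons !ps_rcons sh_map.
apply: eq_sh => A B szAB _; rewrite IHs; last by rewrite -szAB leq_addr.
by apply: ps_ext => bl; rewrite !map_rcons.
Qed.

(** * Graded modules and formal power series *)

Section GradedModules.
Variables (k : pzRingType) (V : gradModType k).
Implicit Types (x y : V) (i j : int).

Lemma hcompP i a x y : hcomp i (a *: x + y) = a *: hcomp i x + hcomp i y.
Proof. exact: hcomp_linear. Qed.
Lemma hcompD i x y : hcomp i (x + y) = hcomp i x + hcomp i y.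
Proof. by rewrite -[x in LHS]scale1r hcompP scale1r. Qed.
Lemma hcomp0 i : hcomp i (0 : V) = 0.
Proof. exact: morph_0 (hcompD i). Qed.
Lemma hcompZ i a x : hcomp i (a *: x) = a *: hcomp i x.
Proof. by rewrite -[a *: x]addr0 hcompP hcomp0 addr0. Qed.

Lemma homog0 i : homog i (0 : V).
Proof. by rewrite /homog hcomp0. Qed.
Lemma homogD i x y : homog i x -> homog i y -> homog i (x + y).
Proof. by rewrite /homog hcompD => /eqP-> /eqP->. Qed.
Lemma homogZ i a x : homog i x -> homog i (a *: x).
Proof. by rewrite /homog hcompZ => /eqP->. Qed.
Lemma homogN i x : homog i x -> homog i (- x).
Proof. by rewrite -scaleN1r; exact: homogZ. Qed.
Lemma homog_sum i (I : Type) (r : seq I) (P : pred I) (F : I -> V) :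
  (forall l, P l -> homog i (F l)) -> homog i (\sum_(l <- r | P l) F l).
Proof. by move=> hF; apply: (big_ind (fun x => homog i x)) => //; [exact: homog0 | exact: homogD]. Qed.
Lemma homog_hcomp i x : homog i (hcomp i x).
Proof. by rewrite /homog hcomp_comp eqxx. Qed.
Lemma hcomp_homog i j x : homog i x -> hcomp j x = if j == i then x else 0.
Proof. by move/eqP=> hx; rewrite -[in LHS]hx hcomp_comp; case: eqP => // ->. Qed.

Lemma sum_hcomp (W : nmodType) (r : seq int) x (F : int -> W) :
  uniq r -> {subset hsupp x <= r} -> (forall i, hcomp i x = 0 -> F i = 0) ->
  \sum_(i <- hsupp x) F i = \sum_(i <- r) F i.
Proof.
move=> ur sr F0; rewrite [RHS](bigID (mem (hsupp x))) /= [X in _ = _ + X]big1 ?addr0.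
  rewrite -[RHS]big_filter; apply: perm_big; apply: uniq_perm; rewrite ?hsupp_uniq ?filter_uniq //.
  by move=> i; rewrite mem_filter; case ix: (i \in hsupp x); rewrite ?(sr _ ix).
by move=> i; rewrite mem_hsupp negbK => /eqP/F0.
Qed.

Lemma sum_hcomp_homog (W : nmodType) j x (F : int -> W) : homog j x ->
  (forall i, hcomp i x = 0 -> F i = 0) -> \sum_(i <- hsupp x) F i = F j.
Proof.
move=> hx F0; rewrite (sum_hcomp (r := [:: j])) ?big_seq1 // => i; rewrite mem_hsupp inE.
by rewrite (hcomp_homog _ hx); case: (i == j); rewrite ?eqxx.
Qed.

Lemma Jop_homog i x : homog i x -> Jop x = sg (odd (absz i)) x.
Proof.
move=> hx; rewrite /Jop (sum_hcomp_homog hx) => [|j ->]; last by rewrite scaler0.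
by rewrite sgZ (eqP hx).
Qed.

End GradedModules.

Lemma of_degree_hcomp (k : pzRingType) (V W : gradModType k) j (b : V -> W) :
  (forall x y, b (x + y) = b x + b y) -> of_degree j b ->
  forall i x, b (hcomp i x) = hcomp (i + j) (b x).
Proof.
move=> bD bj i x; rewrite [in RHS](hcomp_sum x).
have -> : b (\sum_(l <- hsupp x) hcomp l x) = \sum_(l <- hsupp x) b (hcomp l x).
  by apply: (big_morph b) => //; exact: morph_0.
rewrite (big_morph _ (hcompD (i + j)) (hcomp0 _ _)).
have E l : hcomp (i + j) (b (hcomp l x)) = if i == l then b (hcomp l x) else 0.
  rewrite (hcomp_homog _ (bj l _ (homog_hcomp l x))).
  by rewrite (inj_eq (addIr j)).
under eq_bigr do rewrite E.
have [ix|] := boolP (i \in hsupp x); last first.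
  move=> nix; rewrite big_seq big1 => [|l lx].
    by move: nix; rewrite mem_hsupp negbK => /eqP->; exact: morph_0.
  by case: eqP nix => // ->; rewrite lx.
rewrite (bigD1_seq i) ?hsupp_uniq //= eqxx big1 ?addr0 // => l.
by rewrite eq_sym => /negPf->.
Qed.

Section SeriesModule.
Variables (k : pzRingType) (V : lmodType k).
Implicit Types w : series V.

Lemma sconstD (x y : V) : sconst (x + y) = sconst x + sconst y :> series V.
Proof. by apply/funext => -[|r]; rewrite /sconst !fctE //= addr0. Qed.
Lemma sconst0 : sconst (0 : V) = 0 :> series V.
Proof. exact: morph_0 sconstD. Qed.

Lemma nhbarD m w1 w2 : nhbar m (w1 + w2) = nhbar m w1 + nhbar m w2.
Proof. by apply/funext => r; rewrite /nhbar !fctE; case: leqP; rewrite ?addr0 // scalerDr. Qed.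
Lemma nhbar_0 m : nhbar m (0 : series V) = 0.
Proof. exact: morph_0 (nhbarD m). Qed.
Lemma nhbar_sg m b w : nhbar m (sg b w) = sg b (nhbar m w).
Proof. by rewrite (morph_sg _ _ (nhbarD m)). Qed.
Lemma nhbarN m w : nhbar m (- w) = - nhbar m w.
Proof. exact: nhbar_sg true _. Qed.
Lemma nhbarB m w1 w2 : nhbar m (w1 - w2) = nhbar m w1 - nhbar m w2.
Proof. by rewrite nhbarD nhbarN. Qed.

Lemma nhbar0 w : nhbar 0 w = w.
Proof. by apply/funext => r; rewrite /nhbar subn0 expr0 scale1r. Qed.

Lemma nhbarM m n w : nhbar m (nhbar n w) = nhbar (m + n) w.
Proof.
apply/funext => r; rewrite /nhbar; case: (leqP m r) => [le_mr|lt_rm].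
  rewrite leq_subRL // subnDA; case: leqP => _; last by rewrite scaler0.
  by rewrite scalerA exprD.
by rewrite ifN // -ltnNge (leq_trans lt_rm) // leq_addr.
Qed.

Lemma nhbarZ m c w : nhbar m (c *: w) = c *: nhbar m w.
Proof.
apply/funext => r; rewrite /nhbar !fctE; case: leqP; rewrite ?scaler0 //.
by move=> _; rewrite !sgZ (morph_sg _ _ (scalerDr c)).
Qed.

Lemma nhbar_inj m : injective (@nhbar k V m).
Proof.
move=> w1 w2 eqw; apply/funext => r; have := congr1 (fun w => w (m + r)%N) eqw.
by rewrite /nhbar leq_addr addKn !sgZ; case: (odd m) => //= /oppr_inj.
Qed.

Lemma nhbar1S w r : nhbar 1 w r.+1 = - w r.
Proof. by rewrite /nhbar /= expr1 scaleN1r subn1. Qed.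
Lemma nhbar10 w : nhbar 1 w 0%N = 0.
Proof. by []. Qed.

Definition hdvd m w := forall r, (r < m)%N -> w r = 0.

(** The quotient of w by (- hbar)^m, meaningful when [hdvd m w]. *)
Definition hdown m w : series V := fun r => (-1) ^+ m *: w (m + r)%N.

Lemma nhbar_hdown m w : hdvd m w -> nhbar m (hdown m w) = w.
Proof.
move=> m_w; apply/funext => r; rewrite /nhbar /hdown.
case: leqP => [le_mr|/m_w-> //].
by rewrite scalerA -exprD addnn -signr_odd odd_double expr0 scale1r subnKC.
Qed.

Lemma hdvdP m w : hdvd m w <-> exists w', w = nhbar m w'.
Proof.
split=> [m_w|[w' ->] r lt_rm]; last by rewrite /nhbar leqNgt lt_rm.
by exists (hdown m w); rewrite nhbar_hdown.
Qed.

Lemma hdvd_nhbar m w : hdvd m (nhbar m w).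
Proof. by apply/hdvdP; exists w. Qed.
Lemma hdvd_0 m : hdvd m (0 : series V). Proof. by []. Qed.
Lemma hdvdD m w1 w2 : hdvd m w1 -> hdvd m w2 -> hdvd m (w1 + w2).
Proof. by move=> h1 h2 r lt_rm; rewrite fctE h1 // h2 // addr0. Qed.
Lemma hdvd_sg m b w : hdvd m w -> hdvd m (sg b w).
Proof. by case: b => // hw r lt_rm; rewrite /sg fctE hw // oppr0. Qed.
Lemma hdvdB m w1 w2 : hdvd m w1 -> hdvd m w2 -> hdvd m (w1 - w2).
Proof. by move=> h1 h2; apply: hdvdD => //; exact: (hdvd_sg true). Qed.
Lemma hdvdW m n w : (n <= m)%N -> hdvd m w -> hdvd n w.
Proof. by move=> le_nm hw r lt_rn; apply: hw; exact: leq_trans le_nm. Qed.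

Lemma hdvd_sh (T : Type) (p : T -> bool) m s (G : seq T -> seq T -> series V) :
  (forall A B, (size A + size B = size s)%N -> hdvd m (G A B)) -> hdvd m (sh p s G).
Proof.
elim: s G => [|x s IHs] G hG; first exact: hG.
apply: hdvdD; apply: IHs => A B szAB; last apply: hdvd_sg; apply: hG => /=.
  by rewrite addSn szAB.
by rewrite addnS szAB.
Qed.

Lemma hdvd_ps (T : Type) (p : T -> bool) m s (G : seq (seq T) -> series V) :
  (forall bl, size (flatten bl) = size s ->
     all (fun b => size b != 0)%N bl -> hdvd m (G bl)) -> hdvd m (ps p s G).
Proof.
elim/seq_rcons_ind: s G => [|s x IHs] G hG; first exact: hG.
rewrite ps_rcons; apply: hdvd_sh => A B szAB; apply: IHs => [|bl szbl bl0].
  by rewrite -szAB leq_addr.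
apply: hG; rewrite -cats1 ?flatten_cat ?all_cat ?bl0 /= ?cats0 ?size_cat ?size_rcons //.
by rewrite szbl addnS szAB.
Qed.

End SeriesModule.

Section SeriesMaps.
Variables (k : pzRingType) (V W : lmodType k) (b : nat -> V -> W).
Hypothesis bD : forall i x y, b i (x + y) = b i x + b i y.

Lemma sappD w1 w2 : sapp b (w1 + w2) = sapp b w1 + sapp b w2.
Proof.
apply/funext => r; rewrite /sapp !fctE -big_split; apply: eq_bigr => i _; exact: bD.
Qed.

Lemma sapp_sg c w : sapp b (sg c w) = sg c (sapp b w).
Proof. by rewrite (morph_sg _ _ sappD). Qed.

Lemma sapp_sconst x : sapp b (sconst x) = fun r => b r x.
Proof.
apply/funext => r; rewrite /sapp big_ord_recr /= subnn big1 ?add0r // => i _.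
by rewrite /sconst subn_eq0 leqNgt ltn_ord /= (morph_0 (bD i)).
Qed.

Lemma sapp_nhbar m w : sapp b (nhbar m w) = nhbar m (sapp b w).
Proof.
elim: m w => [|m IHm] w; first by rewrite !nhbar0.
rewrite -addn1 -!nhbarM IHm; congr (nhbar m _); apply/funext => -[|r].
  by rewrite /sapp big_ord1 !nhbar10 (morph_0 (bD _)).
rewrite nhbar1S /sapp big_ord_recr /= subnn nhbar10 (morph_0 (bD _)) addr0 -sumrN.
apply: eq_bigr => i _; rewrite subSn; last by rewrite -ltnS.
by rewrite nhbar1S (morph_sg true _ (bD i)).
Qed.

Lemma hdvd_sapp m w : hdvd m w -> hdvd m (sapp b w).
Proof. by move/hdvdP=> [w' ->]; rewrite sapp_nhbar; exact: hdvd_nhbar. Qed.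

End SeriesMaps.

Section SeriesAlgebra.
Variables (k : pzRingType) (A : algType k).
Implicit Types a b c : series A.

Lemma smulDl a b c : smul (a + b) c = smul a c + smul b c.
Proof.
apply/funext => r; rewrite /smul !fctE -big_split; apply: eq_bigr => i _; exact: mulrDl.
Qed.
Lemma smulDr a b c : smul a (b + c) = smul a b + smul a c.
Proof.
apply/funext => r; rewrite /smul !fctE -big_split; apply: eq_bigr => i _; exact: mulrDr.
Qed.
Lemma smul_sgl e a b : smul (sg e a) b = sg e (smul a b).
Proof. by rewrite (@morph_sg _ _ (fun u : series A => smul u b)) // => *; exact: smulDl. Qed.
Lemma smul_sgr e a b : smul a (sg e b) = sg e (smul a b).
Proof. by rewrite (@morph_sg _ _ (fun u : series A => smul a u)) // => *; exact: smulDr. Qed.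
Lemma smul0l a : smul 0 a = 0.
Proof. by apply: (@morph_0 _ _ (fun u : series A => smul u a)) => *; exact: smulDl. Qed.
Lemma smul0r a : smul a 0 = 0.
Proof. by apply: (@morph_0 _ _ (fun u : series A => smul a u)) => *; exact: smulDr. Qed.
Lemma smulZl z a b : smul (z *: a) b = z *: smul a b.
Proof.
apply/funext => r; rewrite /smul !fctE scaler_sumr; apply: eq_bigr => i _.
by rewrite -scalerAl.
Qed.
Lemma smulZr z a b : smul a (z *: b) = z *: smul a b.
Proof.
apply/funext => r; rewrite /smul !fctE scaler_sumr; apply: eq_bigr => i _.
by rewrite -scalerAr.
Qed.

(** Below order N a product of series is the product of their truncations, so that associativity is
    inherited from polynomials. *)
Lemma smulE N r a b : (r < N)%N ->
  smul a b r = ((\poly_(i < N) a i) * (\poly_(i < N) b i))`_r.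
Proof.
move=> lt_rN; rewrite coefM; apply: eq_bigr => i _; rewrite !coef_poly.
by rewrite (leq_ltn_trans _ lt_rN) ?leq_ord // (leq_ltn_trans _ lt_rN) // leq_subr.
Qed.

Lemma smulA a b c : smul a (smul b c) = smul (smul a b) c.
Proof.
apply/funext => r; pose N := r.+1; pose P (e : series A) := \poly_(i < N) e i.
transitivity (((P a * P b) * P c)`_r).
  rewrite -mulrA coefM; apply: eq_bigr => i _; rewrite coef_poly ltn_ord.
  by rewrite (@smulE N) // ltnS leq_subr.
rewrite coefM; apply: eq_bigr => i _; rewrite [(P c)`__]coef_poly ltnS leq_subr.
by rewrite (@smulE N).
Qed.

Lemma smul_sconstr a x : smul a (sconst x) = fun r => a r * x.
Proof.
apply/funext => r; rewrite /smul big_ord_recr /= subnn big1 ?add0r // => i _.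
by rewrite /sconst subn_eq0 leqNgt ltn_ord /= mulr0.
Qed.
Lemma smul_sconstl a x : smul (sconst x) a = fun r => x * a r.
Proof.
apply/funext => r; rewrite /smul big_ord_recl /= subn0 big1 ?addr0 // => i _.
by rewrite /sconst mul0r.
Qed.
Lemma smul1l a : smul (sconst 1) a = a.
Proof. by rewrite smul_sconstl; apply/funext => r; rewrite mul1r. Qed.
Lemma smul1r a : smul a (sconst 1) = a.
Proof. by rewrite smul_sconstr; apply/funext => r; rewrite mulr1. Qed.

Lemma smul_nhbarl m a b : smul (nhbar m a) b = nhbar m (smul a b).
Proof.
elim: m a => [|m IHm] a; first by rewrite !nhbar0.
rewrite -addn1 -!nhbarM IHm; congr (nhbar m _); apply/funext => -[|r].
  by rewrite /smul big_ord1 !nhbar10 mul0r.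
rewrite nhbar1S /smul big_ord_recl nhbar10 mul0r add0r -sumrN.
by apply: eq_bigr => i _; rewrite nhbar1S mulNr.
Qed.

Lemma smul_nhbarr m a b : smul a (nhbar m b) = nhbar m (smul a b).
Proof. by apply: (@sapp_nhbar _ _ _ (fun i => *%R (a i))) => *; exact: mulrDr. Qed.

Lemma hdvd_smul m n a b : hdvd m a -> hdvd n b -> hdvd (m + n) (smul a b).
Proof.
move=> /hdvdP[a' ->] /hdvdP[b' ->]; rewrite smul_nhbarl smul_nhbarr nhbarM.
exact: hdvd_nhbar.
Qed.

End SeriesAlgebra.

HB.instance Definition _ (k : pzRingType) (A : algType k) :=
  Monoid.isLaw.Build (series A) (sconst 1) (@smul k A)
    (@smulA k A) (@smul1l k A) (@smul1r k A).

Section SeriesGraded.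
Variables (k : pzRingType).

Definition shomog (V : gradModType k) i (w : series V) := forall r, homog i (w r).

Section Module.
Variable V : gradModType k.
Implicit Types w : series V.

Lemma shomog0 i : shomog i (0 : series V).
Proof. by move=> r; exact: homog0. Qed.
Lemma shomogD i w1 w2 : shomog i w1 -> shomog i w2 -> shomog i (w1 + w2).
Proof. by move=> h1 h2 r; rewrite fctE; exact: homogD. Qed.
Lemma shomog_sg i b w : shomog i w -> shomog i (sg b w).
Proof. by case: b => // hw r; rewrite /sg fctE; exact: homogN. Qed.
Lemma shomogB i w1 w2 : shomog i w1 -> shomog i w2 -> shomog i (w1 - w2).
Proof. by move=> h1 h2; apply: shomogD => //; exact: (shomog_sg true). Qed.
Lemma shomog_nhbar i m w : shomog i w -> shomog i (nhbar m w).
Proof.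
by move=> hw r; rewrite /nhbar; case: leqP => _; [exact: homogZ | exact: homog0].
Qed.
Lemma shomog_sconst i (x : V) : homog i x -> shomog i (sconst x).
Proof. by move=> hx [|r]; rewrite /sconst //=; exact: homog0. Qed.
End Module.

Lemma shomog_sapp (V W : gradModType k) (b : nat -> V -> W) i j (w : series V) :
  (forall r, of_degree j (b r)) -> shomog i w -> shomog (i + j) (sapp b w).
Proof. by move=> hb hw r; apply: homog_sum => l _; exact: hb. Qed.

Variable C : gradComAlgType k.

Lemma shomog_smul i j (a b : series C) : shomog i a -> shomog j b -> shomog (i + j) (smul a b).
Proof. by move=> ha hb r; apply: homog_sum => l _; exact: homog_mul. Qed.

Lemma smulC i j (a b : series C) : shomog i a -> shomog j b ->
  smul a b = sg (odd (absz i) && odd (absz j)) (smul b a).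
Proof.
move=> ha hb; apply/funext => r.
have -> : smul a b r = sg (odd `|i|%N && odd `|j|%N) (smul b a r).
  rewrite /smul (big_morph _ (sgD _) (sg0 _ _)) (reindex_inj rev_ord_inj); apply: eq_bigr => l _.
  rewrite /= subSS subKn ?leq_ord // (homog_mulC i j _ _ (ha _) (hb _)) abszM -signr_odd oddM.
  by case: (_ && _); rewrite ?expr0 ?expr1 ?mul1r ?mulN1r.
by case: (_ && _).
Qed.

End SeriesGraded.

(** * Koszul brackets and exponentials *)

Definition oddz (i : int) : bool := odd (absz i).

Lemma oddzD i j : oddz (i + j) = oddz i (+) oddz j.
Proof.
rewrite /oddz; have H (m n : nat) : odd (absz (m%:Z - n%:Z)) = odd m (+) odd n.
  case: (leqP m n) => [le_mn|/ltnW le_nm].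
    by rewrite -opprB abszN (subzn le_mn) absz_nat oddB // addbC.
  by rewrite (subzn le_nm) absz_nat oddB.
case: i j => [m|m] [n|n]; rewrite ?NegzE ?abszN.
- by rewrite -PoszD !absz_nat oddD.
- by rewrite H !absz_nat.
- by rewrite addrC H !absz_nat addbC.
- by rewrite -opprD abszN -PoszD !absz_nat oddD.
Qed.

Section Degrees.
Variables (T : Type) (deg : T -> int).

Definition degl (s : seq T) : int := \sum_(x <- s) deg x.

Lemma degl_nil : degl [::] = 0. Proof. exact: big_nil. Qed.
Lemma degl_cons x s : degl (x :: s) = deg x + degl s. Proof. exact: big_cons. Qed.
Lemma degl_cat s t : degl (s ++ t) = degl s + degl t. Proof. exact: big_cat. Qed.
Lemma degl_rcons s x : degl (rcons s x) = degl s + deg x.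
Proof. by rewrite -cats1 degl_cat degl_cons degl_nil addr0. Qed.
Lemma degl_flatten (ss : seq (seq T)) : \sum_(s <- ss) degl s = degl (flatten ss).
Proof. by rewrite /degl big_flatten. Qed.
Lemma oddz_degl s : oddz (degl s) = par (oddz \o deg) s.
Proof. by elim: s => [|x s IHs] /=; rewrite ?degl_nil // degl_cons oddzD IHs. Qed.

Variables (k : pzRingType) (V : gradModType k).

Lemma shomog_sh i s (G : seq T -> seq T -> series V) :
  (forall A B, degl A + degl B = degl s -> shomog i (G A B)) ->
  shomog i (sh (oddz \o deg) s G).
Proof.
elim: s G => [|x s IHs] G hG; first by apply: hG; rewrite degl_nil addr0.
apply: shomogD; apply: IHs => A B dAB; last apply: shomog_sg; apply: hG.
  by rewrite !degl_cons -addrA dAB.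
by rewrite !degl_cons addrCA dAB.
Qed.

Lemma shomog_ps i s (G : seq (seq T) -> series V) :
  (forall bl, degl (flatten bl) = degl s -> shomog i (G bl)) ->
  shomog i (ps (oddz \o deg) s G).
Proof.
elim/seq_rcons_ind: s G => [|s x IHs] G hG; first exact: hG.
rewrite ps_rcons.
suff H N (D : int) (F : seq T -> seq T -> series V) : (N <= size s)%N ->
   (forall A B, (size A <= N)%N -> degl A + degl B = D -> shomog i (F A B)) ->
   forall t, size t = N -> degl t = D -> shomog i (sh (oddz \o deg) t F).
  apply: (H (size s) (degl s)) => // A B szA dAB; apply: IHs => // bl dbl; apply: hG.
  by rewrite -cats1 flatten_cat /= cats0 degl_cat dbl !degl_rcons addrA dAB.
move=> le_N hF t; elim: t N D F le_N hF => [|y t IHt] N D F le_N hF.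
  by move=> szt dt; apply: hF => //; rewrite -dt degl_nil addr0.
move=> szt dt; have le_tN : (size t <= N)%N by rewrite -szt.
apply: shomogD; apply: (IHt (size t) (degl t)) => //; try exact: leq_trans le_tN le_N.
  move=> A B szA dAB; apply: hF; first by rewrite -szt.
  by rewrite degl_cons -addrA dAB -dt degl_cons.
move=> A B szA dAB; apply: shomog_sg; apply: hF; first exact: leq_trans szA le_tN.
by rewrite degl_cons addrCA dAB -dt degl_cons.
Qed.

End Degrees.

(** The degree is part of the data because 0 is homogeneous of every degree: a sign can be read off
    a letter, but not off a vector. *)
Record letter (k : pzRingType) (V : gradModType k) := Letter {
  ldeg : int; lvec : V; letterP : homog ldeg lvec }.

Record sletter (k : pzRingType) (V : gradModType k) := SLetter {
  sdeg : int; svec : series V; sletterP : shomog sdeg svec }.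

Definition cletter (k : pzRingType) (V : gradModType k) (x : letter V) : sletter V :=
  SLetter (shomog_sconst (letterP x)).

Section Products.
Variables (k : pzRingType) (C : gradComAlgType k) (T : Type) (deg : T -> int).
Variable val : T -> series C.
Hypothesis val_homog : forall x, shomog (deg x) (val x).
Local Notation p := (oddz \o deg).

Definition sprod (s : seq T) : series C := \big[@smul k C/sconst 1]_(x <- s) val x.

Lemma sprod_nil : sprod [::] = sconst 1. Proof. exact: big_nil. Qed.
Lemma sprod_cons x s : sprod (x :: s) = smul (val x) (sprod s).
Proof. exact: big_cons. Qed.
Lemma sprod_cat s t : sprod (s ++ t) = smul (sprod s) (sprod t).
Proof. exact: big_cat. Qed.
Lemma sprod_rcons s x : sprod (rcons s x) = smul (sprod s) (val x).
Proof. by rewrite -cats1 sprod_cat sprod_cons sprod_nil smul1r. Qed.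

Lemma sprod_homog s : shomog (degl deg s) (sprod s).
Proof.
elim: s => [|x s IHs]; first by rewrite degl_nil sprod_nil; apply/shomog_sconst/homog_1.
by rewrite degl_cons sprod_cons; exact: shomog_smul.
Qed.

Lemma sprodC s x : smul (sprod s) (val x) = sg (p x && par p s) (smul (val x) (sprod s)).
Proof.
rewrite (smulC (sprod_homog s) (val_homog x)) -!/(oddz _) oddz_degl /=.
by rewrite andbC.
Qed.

(** The product with sign (-1)^(size) is the convolution inverse of the product: moving the first
    letter from one part to the other cancels the terms in pairs. *)
Lemma sprod_inv s :
  sh p s (fun A B => sg (odd (size B)) (smul (sprod A) (sprod B))) =
  if s is [::] then sconst 1 else 0.
Proof.
case: s => [|x s] /=; first by rewrite sprod_nil smul1l.
rewrite -shD; apply: sh_eq0 => A B _; rewrite !sprod_cons smulA sprodC !smul_sgl.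
by rewrite !sgsg -smulA; case: (p x && _); case: (odd _); rewrite /= ?addrN ?addNr.
Qed.

Lemma sprod_inv' s :
  sh p s (fun A B => sg (odd (size A)) (smul (sprod A) (sprod B))) =
  if s is [::] then sconst 1 else 0.
Proof.
case: s => [|x s] /=; first by rewrite sprod_nil smul1l.
rewrite -shD; apply: sh_eq0 => A B _; rewrite !sprod_cons (smulA (sprod A)) sprodC !smul_sgl.
by rewrite !sgsg -smulA; case: (p x && _); case: (odd _); rewrite /= ?addrN ?addNr.
Qed.

Variable K : nat -> {linear C -> C}.
Hypothesis K_degree : forall r, of_degree 1 (K r).
Let KD r x y : K r (x + y) = K r x + K r y. Proof. exact: linearD. Qed.
Local Notation KK := (sapp (fun r => K r : C -> C)).

(* the Koszul bracket of K, i.e. its n-fold graded commutator with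
   multiplications, applied to 1; for a binary QFT algebra it is (- hbar)^(n-1) l_n *)
Definition kbr (s : seq T) : series C :=
  sh p s (fun A B => sg (odd (size B)) (smul (KK (sprod A)) (sprod B))).

(** The bracket is K applied to products, convolved with the inverse of the product; convolving with
    the product undoes this. *)
Lemma kbr_sprod s : KK (sprod s) = sh p s (fun A B => smul (kbr A) (sprod B)).
Proof.
transitivity (sh p s (fun A B => sh p A (fun A1 A2 =>
    smul (KK (sprod A1)) (sg (odd (size A2)) (smul (sprod A2) (sprod B)))))).
  rewrite sh_assoc sh_leftE /= => [|A B _]; first by rewrite sprod_nil !smul1r.
  rewrite -(@sh_morph _ _ _ _ (fun u => smul (KK (sprod A)) u)) => [|*]; last exact: smulDr.
  by rewrite sprod_inv'; case: B => // ? ? _; rewrite smul0r.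
apply: sh_ext => A B; rewrite /kbr (@sh_morph _ _ _ _ (fun u => smul u (sprod B))).
  by apply: sh_ext => A1 A2; rewrite smul_sgr smul_sgl smulA.
by move=> *; exact: smulDl.
Qed.

(** Convolution with the product is invertible, so the expansion of K on products determines the
    bracket. *)
Lemma kbr_uniq (L : seq T -> series C) :
  (forall s, KK (sprod s) = sh p s (fun A B => smul (L A) (sprod B))) -> forall s, kbr s = L s.
Proof.
move=> KL s; rewrite /kbr.
transitivity (sh p s (fun A B => sh p A (fun A1 A2 =>
    smul (L A1) (sg (odd (size B)) (smul (sprod A2) (sprod B)))))).
  apply: sh_ext => A B; rewrite KL (@sh_morph _ _ _ _ (fun u => smul u (sprod B))); last first.
    by move=> *; exact: smulDl.
  by rewrite -sh_sg; apply: sh_ext => A1 A2; rewrite smul_sgr smulA.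
rewrite sh_assoc sh_leftE /= => [|A B _]; first by rewrite sprod_nil !smul1r.
rewrite -(@sh_morph _ _ _ _ (fun u => smul (L A) u)) => [|*]; last exact: smulDr.
by rewrite sprod_inv; case: B => // ? ? _; rewrite smul0r.
Qed.

Lemma kbr_homog s : shomog (degl deg s + 1) (kbr s).
Proof.
apply: shomog_sh => A B <-; apply: shomog_sg; rewrite addrAC.
apply: shomog_smul; last exact: sprod_homog.
exact: shomog_sapp (sprod_homog _).
Qed.

Lemma sprod_slot s1 s2 x y z (c : series C -> series C) :
  (forall u v, c (smul u v) = smul (c u) v) -> (forall u v, c (smul u v) = smul u (c v)) ->
  val z = val x + c (val y) ->
  sprod (s1 ++ z :: s2) = sprod (s1 ++ x :: s2) + c (sprod (s1 ++ y :: s2)).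
Proof.
move=> cl cr zE; rewrite !sprod_cat !sprod_cons zE smulDl smulDr; congr (_ + _).
by rewrite cr cl.
Qed.

Lemma kbr_slot s1 s2 x y z (c : series C -> series C) : deg x = deg z -> deg y = deg z ->
  (forall u v, c (u + v) = c u + c v) ->
  (forall u v, c (smul u v) = smul (c u) v) -> (forall u v, c (smul u v) = smul u (c v)) ->
  (forall u, KK (c u) = c (KK u)) ->
  val z = val x + c (val y) ->
  kbr (s1 ++ z :: s2) = kbr (s1 ++ x :: s2) + c (kbr (s1 ++ y :: s2)).
Proof.
move=> dx dy cD cl cr cK zE; apply: sh_slot; rewrite /= ?dx ?dy // => A1 A2 B.
  rewrite (sprod_slot _ _ cl cr zE) sappD // cK smulDl sgD (morph_sg _ _ cD).
  by rewrite cl.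
rewrite (sprod_slot _ _ cl cr zE) smulDr sgD (morph_sg _ _ cD).
by rewrite cr !size_cat.
Qed.

End Products.

Lemma sprod_map (k : pzRingType) (C : gradComAlgType k) (T U : Type) (i : T -> U) val s :
  @sprod k C U val (map i s) = sprod (val \o i) s.
Proof. exact: big_map. Qed.

Lemma kbr_map (k : pzRingType) (C : gradComAlgType k) (T U : Type) (i : T -> U) deg val K s :
  @kbr k C U deg val K (map i s) = kbr (deg \o i) (val \o i) K s.
Proof.
rewrite /kbr sh_map; apply: sh_ext => A B.
by rewrite !sprod_map size_map.
Qed.

(** * Powers of hbar in the brackets of series *)

Section Binary.
Variables (k : pzRingType) (C : gradComAlgType k) (K : nat -> {linear C -> C}).
Hypothesis K_degree : forall r, of_degree 1 (K r).
Local Notation KK := (sapp (fun r => K r : C -> C)).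
Local Notation br := (kbr (@sdeg k C) (@svec k C) K).

Hypothesis br_const : forall s : seq (letter C),
  hdvd (size s).-1 (br (map (@cletter k C) s)).

Fact sletter_head_subproof (x : sletter C) : homog (sdeg x) (svec x 0%N).
Proof. exact: sletterP. Qed.
Fact sletter_tail_subproof (x : sletter C) : shomog (sdeg x) (div_nhbar (svec x)).
Proof. by move=> r; apply/homogN/sletterP. Qed.

(** Induction over the entries, those of t being already constant. An entry x is its constant term
    plus - hbar times a series z of the same degree. The constant term falls under the induction
    over the entries; for the rest, the factor - hbar raises by one the divisibility already known
    for z, whence the inner induction on m. *)
Lemma kbr_hdvd s : hdvd (size s).-1 (br s).
Proof.
suff H (t : seq (letter C)) : hdvd (size t + size s).-1 (br (map (@cletter k C) t ++ s)).
  exact: (H [::]).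
elim: s t => [|x s IHs] t; first by rewrite addn0 cats0.
rewrite -[size (x :: s)]/(size s).+1; set n := (_.-1); suff H m : hdvd (minn m n) (br (map (@cletter k C) t ++ x :: s)).
  by have := H n; rewrite minnn.
elim: m x => [|m IHm] x; first by rewrite min0n.
pose y := cletter (Letter (sletter_head_subproof x)).
pose z := SLetter (sletter_tail_subproof x).
rewrite (@kbr_slot _ _ _ _ _ _ _ _ y z x (nhbar 1)) //.
- apply: hdvdD; last first.
    apply: (@hdvdW _ _ (1 + minn m n)); first by rewrite add1n -minnSS leq_min !geq_min !leqnn leqnSn !orbT.
    have /hdvdP[w ->] := IHm z; rewrite nhbarM; exact: hdvd_nhbar.
  have := IHs (rcons t (Letter (sletter_head_subproof x))).
  rewrite map_rcons cat_rcons size_rcons addSnnS; apply: hdvdW; exact: geq_minr.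
- exact: nhbarD.
- by move=> u v; rewrite smul_nhbarl.
- by move=> u v; rewrite smul_nhbarr.
- by move=> u; rewrite sapp_nhbar // => *; rewrite linearD.
apply/funext => -[|r]; rewrite !fctE ?nhbar10 ?nhbar1S /sconst /= ?addr0 //.
by rewrite add0r opprK.
Qed.

End Binary.

(** An additive weight f is distributed over the two parts; it will be an exponent of hbar or a
    number of occurrences. *)
Lemma eq_sh_sum (T : Type) (M : nmodType) (f : T -> M) p (V : zmodType) s
    (G1 G2 : seq T -> seq T -> V) :
  (forall A B, \sum_(x <- A) f x + \sum_(x <- B) f x = \sum_(x <- s) f x -> G1 A B = G2 A B) ->
  sh p s G1 = sh p s G2.
Proof.
elim: s G1 G2 => [|x s IHs] G1 G2 eqG /=; first by apply: eqG; rewrite big_nil addr0.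
congr (_ + _); apply: IHs => A B dAB; last congr (sg _ _); apply: eqG.
  by rewrite !big_cons -addrA dAB.
by rewrite !big_cons addrCA dAB.
Qed.

Lemma shomog_hdown (k : pzRingType) (V : gradModType k) i m (w : series V) :
  shomog i w -> shomog i (hdown m w).
Proof. by move=> hw r; exact: homogZ. Qed.

Section KoszulShift.
Variables (k : pzRingType) (C : gradComAlgType k) (K : nat -> {linear C -> C}).
Variables (T : Type) (e : T -> nat) (deg : T -> int) (val : T -> series C).

Lemma sprod_nhbar s :
  sprod (fun x => nhbar (e x) (val x)) s = nhbar (\sum_(x <- s) e x)%N (sprod val s).
Proof.
elim: s => [|x s IHs]; first by rewrite big_nil !sprod_nil nhbar0.
by rewrite big_cons !sprod_cons IHs smul_nhbarl smul_nhbarr nhbarM.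
Qed.

Lemma kbr_nhbar s :
  kbr deg (fun x => nhbar (e x) (val x)) K s = nhbar (\sum_(x <- s) e x)%N (kbr deg val K s).
Proof.
rewrite /kbr (sh_morph _ _ _ (nhbarD _)); apply: (eq_sh_sum (f := e)) => A B eAB.
rewrite !sprod_nhbar sapp_nhbar => [|*]; last exact: linearD.
by rewrite smul_nhbarl smul_nhbarr nhbarM nhbar_sg; congr (sg _ (nhbar _ _)).
Qed.

End KoszulShift.

Section BinaryShift.
Variables (k : pzRingType) (C : gradComAlgType k) (K : nat -> {linear C -> C}).
Local Notation br := (kbr (@sdeg k C) (@svec k C) K).
Hypothesis br_hdvd : forall s, hdvd (size s).-1 (br s).

(** The powers of hbar in the entries are pulled out of the bracket, which contributes its own power
    on the quotients. *)
Lemma kbr_hdvd_shift (T : Type) (e : T -> nat) (x : T -> sletter C) s :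
  (forall t, hdvd (e t) (svec (x t))) ->
  hdvd (\sum_(t <- s) e t + (size s).-1)%N (br (map x s)).
Proof.
move=> ex; pose y t := SLetter (shomog_hdown (e t) (sletterP (x t))).
have -> : br (map x s) = nhbar (\sum_(t <- s) e t)%N (br (map y s)).
  rewrite !kbr_map -kbr_nhbar; congr (kbr _ _ _ _); apply/funext => t /=.
  by rewrite nhbar_hdown.
have /hdvdP[w ->] := @br_hdvd (map y s).
by rewrite size_map nhbarM; exact: hdvd_nhbar.
Qed.

End BinaryShift.

Lemma cats2 (T : Type) (s : seq T) x y : s ++ [:: x; y] = rcons (rcons s x) y.
Proof. by rewrite -cat_rcons cats1. Qed.

(** * Exponentials of families, and K twisted by them *)

Section Exponential.
Variables (k : pzRingType) (C : gradComAlgType k) (T : Type) (deg : T -> int).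
Variable th : seq T -> series C.
Local Notation p := (oddz \o deg).

(** The exponential of th for the convolution given by [sh]; listing each set partition once
    accounts for the factor 1/r! of r blocks. *)
Definition pexp s : series C := ps p s (sprod th).

Lemma pexp_nil : pexp [::] = sconst 1. Proof. exact: sprod_nil. Qed.

Lemma pexp_rcons s x :
  pexp (rcons s x) = sh p s (fun A B => smul (pexp A) (th (rcons B x))).
Proof.
rewrite /pexp ps_rcons; apply: sh_ext => A B.
rewrite (@ps_morph _ _ _ _ (fun u => smul u (th (rcons B x)))) => [|*]; last exact: smulDl.
by apply: ps_ext => bl; rewrite sprod_rcons.
Qed.

Lemma pexp_slot s1 s2 x y z (c : series C -> series C) : deg x = deg z -> deg y = deg z ->
  (forall u v, c (u + v) = c u + c v) ->
  (forall u v, c (smul u v) = smul (c u) v) -> (forall u v, c (smul u v) = smul u (c v)) ->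
  (forall A1 A2, th (A1 ++ z :: A2) = th (A1 ++ x :: A2) + c (th (A1 ++ y :: A2))) ->
  pexp (s1 ++ z :: s2) = pexp (s1 ++ x :: s2) + c (pexp (s1 ++ y :: s2)).
Proof.
move=> dx dy cD cl cr slz.
elim: {s1 s2}_.+1 {-2}s1 {-2}s2 (ltnSn (size s1 + size s2)%N) => // n IHn s1 s2.
case/lastP: s2 => [|s2 w] lt_n.
  rewrite !cats1 !pexp_rcons (sh_morph _ _ _ cD) -shD; apply: sh_ext => A B.
  by have := slz B [::]; rewrite !cats1 => ->; rewrite smulDr cr.
rewrite size_rcons addnS ltnS in lt_n.
rewrite -!rcons_cons -!rcons_cat !pexp_rcons.
(* [sh_slot] requires the rule on lists A of every length, while the induction hypothesis covers
   short ones only; truncation makes the other cases trivial. *)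
have cons_sh t : sh p (s1 ++ t :: s2) (fun A B => smul (pexp A) (th (rcons B w)))
  = sh p (s1 ++ t :: s2) (fun A B => smul
      (if (size A <= size s1 + size s2 + 1)%N then pexp A else 0) (th (rcons B w))).
  apply: eq_sh => A B szAB _; rewrite ifT // addn1 -addnS.
  by move: szAB; rewrite size_cat /= => <-; exact: leq_addr.
rewrite !cons_sh; apply: sh_slot; rewrite /= ?dx ?dy // => A1 A2 B; rewrite ?size_cat /=.
  case: ifP => [le_A|_]; last by rewrite !smul0l (morph_0 cD) addr0.
  rewrite IHn ?smulDl ?cl //; apply: leq_trans lt_n.
  by move: le_A; rewrite addnS addn1 ltnS.
by rewrite !rcons_cat !rcons_cons slz smulDr cr.
Qed.

(** The contribution of the blocks containing x or y when no other block is present: one common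
    block, or one block for each. *)
Definition pexp2 x y s : series C := th (s ++ [:: x; y]) +
  sh p s (fun A B => sg (p x && par p B) (smul (th (rcons A x)) (th (rcons B y)))).

Lemma pexp_cats2 s x y :
  pexp (s ++ [:: x; y]) = sh p s (fun A B => smul (pexp A) (pexp2 x y B)).
Proof.
rewrite cats2 pexp_rcons sh_rcons.
under [RHS]sh_ext do rewrite /pexp2 smulDr.
rewrite shD; congr (_ + _); first by apply: sh_ext => A B; rewrite cats2.
transitivity (sh p s (fun A B => sh p A (fun A1 A2 => sg (p x && par p B)
    (smul (pexp A1) (smul (th (rcons A2 x)) (th (rcons B y))))))).
  apply: sh_ext => A B; rewrite pexp_rcons.
  rewrite (@sh_morph _ _ _ _ (fun v => smul v (th (rcons B y)))) => [|*]; last exact: smulDl.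
  by rewrite -sh_sg; apply: sh_ext => A1 A2; rewrite smulA.
rewrite sh_assoc; apply: sh_ext => A B.
rewrite (@sh_morph _ _ _ _ (fun v => smul (pexp A) v)) => [|*]; last exact: smulDr.
by apply: sh_ext => B1 B2; rewrite smul_sgr.
Qed.

Hypothesis th_homog : forall s, shomog (degl deg s) (th s).

Lemma pexp_homog s : shomog (degl deg s) (pexp s).
Proof.
apply: shomog_ps => bl <-.
elim: bl => [|b bl IHbl].
  by rewrite /= degl_nil sprod_nil; apply/shomog_sconst/homog_1.
by rewrite sprod_cons /= degl_cat; exact: shomog_smul.
Qed.

(** For the last two letters, graded commutativity exchanges the two-block terms of [pexp2].
    Otherwise the block of the last letter is split off and the induction hypothesis applies. *)
Lemma pexp_swap s1 s2 x y :
  (forall A1 A2, th (A1 ++ x :: y :: A2) = sg (p x && p y) (th (A1 ++ y :: x :: A2))) ->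
  pexp (s1 ++ x :: y :: s2) = sg (p x && p y) (pexp (s1 ++ y :: x :: s2)).
Proof.
move=> swxy.
elim: {s1 s2}_.+1 {-2}s1 {-2}s2 (ltnSn (size s1 + size s2)%N) => // n IHn s1 s2.
case/lastP: s2 => [|s2 w] lt_n.
  rewrite !pexp_cats2 -sh_sg; apply: sh_ext => A B; rewrite -smul_sgr; congr (smul _ _).
  rewrite /pexp2 sgD (swxy B [::]); congr (_ + _).
  rewrite [LHS]sh_comm -sh_sg; apply: sh_ext => B1 B2.
  rewrite (smulC (th_homog _) (th_homog _)) -!/(oddz _) !oddz_degl !par_rcons.
  by move: (p x) (p y) (par p B1) (par p B2) => a b c d; sgb.
rewrite size_rcons addnS ltnS in lt_n.
rewrite -!rcons_cons -!rcons_cat !pexp_rcons.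
have cons_sh t u : sh p (s1 ++ t :: u :: s2) (fun A B => smul (pexp A) (th (rcons B w)))
  = sh p (s1 ++ t :: u :: s2) (fun A B => smul
      (if (size A <= size s1 + size s2 + 2)%N then pexp A else 0) (th (rcons B w))).
  apply: eq_sh => A B szAB _; rewrite ifT // addn2 -!addnS.
  by move: szAB; rewrite size_cat /= => <-; exact: leq_addr.
rewrite !cons_sh; apply: sh_swap => A1 A2 B; rewrite ?size_cat /=.
  case: ifP => [le_A|_]; last by rewrite !smul0l sg0.
  rewrite IHn ?smul_sgl //; apply: leq_trans lt_n.
  by move: le_A; rewrite !addnS addn0 !ltnS.
by rewrite !rcons_cat !rcons_cons swxy smul_sgr.
Qed.

Variable K : nat -> {linear C -> C}.
Hypothesis K_degree : forall r, of_degree 1 (K r).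
Let KD r x y : K r (x + y) = K r x + K r y. Proof. exact: linearD. Qed.
Local Notation KK := (sapp (fun r => K r : C -> C)).
Local Notation br := (kbr (@sdeg k C) (@svec k C) K).

Definition thl s : sletter C := SLetter (th_homog s).

(* pexp being an exponential, K pexp = pexp_br * pexp, and twisting K by pexp
   gives the operator pexp_brl. *)
Definition pexp_br s : series C := ps p s (fun bl => br (map thl bl)).
Definition pexp_brl (l : sletter C) s : series C := ps p s (fun bl => br (l :: map thl bl)).

Lemma oddz_sdeg_thl : (oddz \o @sdeg k C) \o thl = par p.
Proof. by apply/funext => b; rewrite /= oddz_degl. Qed.

Lemma sprod_thl bl : sprod (@svec k C) (map thl bl) = sprod th bl.
Proof. by rewrite sprod_map. Qed.

Lemma ps_smulr s (u : series C) (G : seq (seq T) -> series C) :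
  ps p s (fun bl => smul u (G bl)) = smul u (ps p s G).
Proof. by rewrite (@ps_morph _ _ _ _ (smul u)) // => *; exact: smulDr. Qed.
Lemma ps_smull s (u : series C) (G : seq (seq T) -> series C) :
  ps p s (fun bl => smul (G bl) u) = smul (ps p s G) u.
Proof. by rewrite (@ps_morph _ _ _ _ (fun v => smul v u)) // => *; exact: smulDl. Qed.

(** K of a product of blocks is expanded into brackets of some of the blocks; by [ps_blocks],
    choosing blocks of a partition amounts to splitting s and partitioning both parts. *)
Lemma K_pexp s : KK (pexp s) = sh p s (fun A B => smul (pexp_br A) (pexp B)).
Proof.
rewrite /pexp (ps_morph _ _ _ (sappD KD)).
transitivity (ps p s (fun bl => sh (par p) bl (fun A B =>
    smul (br (map thl A)) (sprod th B)))).
  apply: ps_ext => bl; rewrite -sprod_thl (kbr_sprod (@sletterP k C)) sh_map oddz_sdeg_thl.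
  by apply: sh_ext => A B; rewrite sprod_thl.
rewrite ps_blocks; apply: sh_ext => A B; rewrite -ps_smull; apply: ps_ext => q.
exact: ps_smulr.
Qed.

(** In the expansion of K on l times the blocks, the brackets without l resum to l times K of the
    exponential, with the sign of moving l across an odd operator; those with l give the twisted
    operator. *)
Lemma K_letter_pexp (l : sletter C) s :
  KK (smul (svec l) (pexp s)) =
  sg (oddz (sdeg l)) (smul (svec l) (KK (pexp s)))
  + sh p s (fun A B => smul (pexp_brl l A) (pexp B)).
Proof.
transitivity (ps p s (fun bl => KK (smul (svec l) (sprod th bl)))).
  by rewrite /pexp -ps_smulr (ps_morph _ _ _ (sappD KD)).
transitivity (ps p s (fun bl => sg (oddz (sdeg l)) (smul (svec l) (KK (sprod th bl))) +
    sh (par p) bl (fun A B => smul (br (l :: map thl A)) (sprod th B)))).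
  apply: ps_ext => bl; rewrite -[in LHS]sprod_thl -[smul _ _]sprod_cons.
  rewrite (kbr_sprod (@sletterP k C)) /= addrC; congr (_ + _); last first.
    rewrite sh_map oddz_sdeg_thl.
    by apply: sh_ext => A B; rewrite sprod_thl.
  rewrite -[in RHS]sprod_thl (kbr_sprod (@sletterP k C)).
  rewrite (@sh_morph _ _ _ _ (smul (svec l))) => [|*]; last exact: smulDr.
  rewrite -sh_sg; apply: sh_ext => A B; rewrite sprod_cons !smulA.
  rewrite (smulC (sletterP l) (kbr_homog (@sletterP k C) K_degree A)) -!/(oddz _).
  rewrite oddzD oddz_degl smul_sgl sgsg; congr (sg _ _) => /=.
  by case: (oddz _); case: (par _ _).
rewrite psD; congr (_ + _).
  by rewrite ps_sg ps_smulr -(ps_morph _ _ _ (sappD KD)).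
rewrite ps_blocks; apply: sh_ext => A B; rewrite -ps_smull; apply: ps_ext => q.
exact: ps_smulr.
Qed.

Hypothesis br_hdvd : forall s, hdvd (size s).-1 (br s).
Hypothesis th_hdvd : forall s, hdvd (size s).-1 (th s).

Lemma sum_pred_size (bl : seq (seq T)) : all (fun b => size b != 0)%N bl ->
  (\sum_(b <- bl) (size b).-1 + size bl = size (flatten bl))%N.
Proof.
elim: bl => [|b bl IHbl] /=; first by rewrite big_nil.
case/andP=> b0 /IHbl E; rewrite big_cons size_cat -E addnS addnA -!addSn prednK //.
by rewrite lt0n.
Qed.

(** For a partition into r blocks, the blocks contribute hbar^(size s - r) and the bracket
    hbar^(r-1). *)
Lemma pexp_br_hdvd s : hdvd (size s).-1 (pexp_br s).
Proof.
apply: hdvd_ps => bl <- bl0; apply: hdvdW (@kbr_hdvd_shift _ _ _ br_hdvd _ _ thl bl th_hdvd).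
by rewrite -sum_pred_size //; case: (size bl) => [|n]; rewrite ?addn0 ?leq_pred // addnS.
Qed.

(** With l the bracket has r + 1 entries and contributes hbar^r, so that no power of hbar is
    lost. *)
Lemma pexp_brl_hdvd m (l : sletter C) s : hdvd m (svec l) -> hdvd (m + size s) (pexp_brl l s).
Proof.
move=> m_l; apply: hdvd_ps => bl <- bl0.
(* [None] stands for the additional entry l. *)
pose e (t : option (seq T)) := if t is Some b then (size b).-1 else m.
pose x (t : option (seq T)) := if t is Some b then thl b else l.
have := @kbr_hdvd_shift _ _ _ br_hdvd _ e x (None :: map Some bl).
rewrite /= -map_comp big_cons big_map size_map -sum_pred_size //= addnA; apply.
by case=> [b|] //=; exact: th_hdvd.
Qed.

End Exponential.

(** * Sums over subsets and partitions of ordinals *)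

Lemma sum_subset_setU1 (T : finType) (V : nmodType) (x : T) (S : {set T}) (F : {set T} -> V) :
  x \notin S ->
  \sum_(A : {set T} | A \subset x |: S) F A =
  \sum_(A : {set T} | A \subset S) F (x |: A) + \sum_(A : {set T} | A \subset S) F A.
Proof.
move=> xS; rewrite (bigID (fun A : {set T} => x \in A)) /=; congr (_ + _); last first.
  apply: eq_bigl => A; apply/andP/idP => [[/subsetP sAS xA]|sAS].
    by apply/subsetP=> y yA; have := sAS y yA; rewrite !inE => /orP[/eqP E|//]; rewrite -E yA in xA.
  by rewrite (subset_trans sAS) ?subsetU1 //; split=> //; apply: contra xS; exact: subsetP.
rewrite (reindex_onto (fun A => x |: A) (fun A => A :\ x)) /=; last first.
  by move=> A /andP[_ xA]; rewrite setD1K.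
apply: eq_bigl => A; rewrite setU11 andbT; apply/andP/idP => [[sAS /eqP E]|sAS].
  rewrite -E; apply/subsetP=> y; rewrite !inE => /andP[yx /orP[/eqP|yA]].
    by move/eqP; rewrite (negPf yx).
  have := subsetP sAS y; rewrite !inE yA orbT (negPf yx) => /(_ isT) //.
have xA : x \notin A by apply: contra xS; exact: subsetP.
by rewrite setUS // setU1K.
Qed.

Section OrdinalSets.
Variable n : nat.
Implicit Types (S A B : {set 'I_n}) (P : {set {set 'I_n}}) (x y : 'I_n).

Lemma ltn_ord_trans : transitive (fun x y : 'I_n => (x < y)%N).
Proof. by move=> y x z; exact: ltn_trans. Qed.

Lemma sorted_enum_ord A : sorted (fun x y : 'I_n => (x < y)%N) (enum A).
Proof.
rewrite /enum_mem sorted_filter //; first exact: ltn_ord_trans.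
rewrite -enumT; have := iota_ltn_sorted 0 n.
by rewrite -val_enum_ord sorted_map.
Qed.

Lemma enum_ord_eq A (s : seq 'I_n) :
  sorted (fun x y : 'I_n => (x < y)%N) s -> s =i A -> enum A = s.
Proof.
move=> sorted_s sA; apply: (irr_sorted_eq ltn_ord_trans) => //; first by move=> x; rewrite /= ltnn.
  exact: sorted_enum_ord.
by move=> x; rewrite mem_enum sA.
Qed.

Lemma enum_setU1_max x A : (forall y, y \in A -> (y < x)%N) -> enum (x |: A) = rcons (enum A) x.
Proof.
move=> ltx; apply: enum_ord_eq => [|y]; last by rewrite mem_rcons in_cons mem_enum !inE.
rewrite (sorted_pairwise ltn_ord_trans) pairwise_rcons -(sorted_pairwise ltn_ord_trans).
rewrite sorted_enum_ord andbT; apply/allP=> y; rewrite mem_enum; exact: ltx.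
Qed.

Lemma enum_setU1_min x A : (forall y, y \in A -> (x < y)%N) -> enum (x |: A) = x :: enum A.
Proof.
move=> ltx; apply: enum_ord_eq => [|y]; last by rewrite in_cons mem_enum !inE.
rewrite (sorted_pairwise ltn_ord_trans) pairwise_cons -(sorted_pairwise ltn_ord_trans).
rewrite sorted_enum_ord andbT; apply/allP=> y; rewrite mem_enum; exact: ltx.
Qed.

Variable d : 'I_n -> int.
Local Notation p := (oddz \o d).

Lemma koszul_cons_min x s : (forall y, y \in s -> (x < y)%N) -> koszul d (x :: s) = koszul d s.
Proof.
move=> ltx /=; rewrite big_seq_cond big1 // => y /andP[/ltx lt_xy].
by rewrite ltnNge (ltnW lt_xy).
Qed.

(** Being the smallest, x has an inversion with every element of A and with none of B. *)
Lemma odd_koszul_ins x (A B : seq 'I_n) : (forall y, y \in A -> (x < y)%N) -> (forall y, y \in B -> (x < y)%N) ->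
  odd (koszul d (A ++ x :: B)) = (p x && par p A) (+) odd (koszul d (A ++ B)).
Proof.
move=> ltA ltB; elim: A ltA => [|a A IHA] ltA.
  by rewrite /= andbF; congr (odd _); exact: koszul_cons_min.
have lt_xa : (x < a)%N by apply: ltA; rewrite mem_head.
rewrite /= !oddD IHA => [|y yA]; last by apply: ltA; rewrite in_cons yA orbT.
rewrite !big_cat /= big_cons lt_xa !oddD abszM oddM.
rewrite -/(oddz (d x)) -/(oddz (d a)).
by case: (oddz (d x)); case: (oddz (d a)); case: (par _ _); do 3!case: (odd _).
Qed.

Lemma odd_koszul_rcons x s : (forall y, y \in s -> (y < x)%N) ->
  koszul d (rcons s x) = koszul d s.
Proof.
elim: s => [|y s IHs] ltx; first by rewrite /= big_nil.
rewrite /= IHs => [|z zs]; last by apply: ltx; rewrite in_cons zs orbT.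
congr addn; rewrite -cats1 big_cat /= big_cons big_nil ltnNge ltnW ?addn0 //.
by apply: ltx; rewrite mem_head.
Qed.

(** Matches the recursion of [sh], which removes the first letter; [set_max_ind] matches that of
    [ps], which removes the last one with its block. *)
Lemma set_min_ind (Q : {set 'I_n} -> Prop) : Q set0 ->
  (forall x S, (forall y, y \in S -> (x < y)%N) -> Q S -> Q (x |: S)) -> forall S, Q S.
Proof.
move=> Q0 QS S; elim: {S}_.+1 {-2}S (ltnSn #|S|) => // m IHm S lt_m.
have [->//|[x0 xS0]] := set_0Vmem S.
case: (arg_minnP (fun x : 'I_n => x : nat) xS0) => x xS minx; have {}xS : x \in S := xS.
rewrite -(setD1K xS); apply: QS => [y|].
  by rewrite !inE => /andP[yx /minx]; rewrite leq_eqVlt => /orP[/eqP/val_inj E|//]; rewrite E eqxx in yx.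
by apply: IHm; move: lt_m; rewrite (cardsD1 x) xS.
Qed.

Lemma set_max_ind (Q : {set 'I_n} -> Prop) : Q set0 ->
  (forall x S, (forall y, y \in S -> (y < x)%N) -> (forall A, A \subset S -> Q A) -> Q (x |: S)) ->
  forall S, Q S.
Proof.
move=> Q0 QS S; elim: {S}_.+1 {-2}S (ltnSn #|S|) => // m IHm S lt_m.
have [->//|[x0 xS0]] := set_0Vmem S.
case: (arg_maxnP (fun x : 'I_n => x : nat) xS0) => x xS maxx; have {}xS : x \in S := xS.
rewrite -(setD1K xS); apply: QS => [y|A sA].
  rewrite !inE => /andP[yx yS]; have := maxx y yS; rewrite /= leq_eqVlt => /orP[/eqP/val_inj E|//].
  by rewrite E eqxx in yx.
apply: IHm; apply: leq_ltn_trans (subset_leq_card sA) _.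
by move: lt_m; rewrite (cardsD1 x) xS.
Qed.

Lemma sh_enum (V : zmodType) S (G : seq 'I_n -> seq 'I_n -> V) :
  sh p (enum S) G = \sum_(A : {set 'I_n} | A \subset S)
    sg (odd (koszul d (enum A ++ enum (S :\: A)))) (G (enum A) (enum (S :\: A))).
Proof.
elim/set_min_ind: S G => [|x S ltx IHS] G.
  rewrite enum_set0 (big_pred1 set0) => [|A]; last by rewrite subset0.
  by rewrite /= setD0 enum_set0.
have xS : x \notin S by apply/negP=> /ltx; rewrite ltnn.
rewrite enum_setU1_min // sum_subset_setU1 // [LHS]/= !IHS.
have ltxs A : A \subset S -> forall y, y \in A -> (x < y)%N by move=> /subsetP sAS y /sAS/ltx.
congr (_ + _); apply: eq_bigr => A sAS.
  have -> : (x |: S) :\: (x |: A) = S :\: A.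
    apply/setP=> y; rewrite !inE; case: eqP => [->|//] /=.
    by rewrite (negPf xS) andbF.
  rewrite enum_setU1_min; last exact: ltxs.
  rewrite cat_cons koszul_cons_min // => y; rewrite mem_cat !mem_enum => /orP[]; first exact: ltxs.
  by apply: ltxs; exact: subsetDl.
have -> : (x |: S) :\: A = x |: (S :\: A).
  apply/setP=> y; rewrite !inE; case: eqP => [->|//] /=.
  by rewrite andbT; apply: contra xS; exact: subsetP.
rewrite enum_setU1_min; last exact/ltxs/subsetDl.
rewrite sgsg odd_koszul_ins 1?addbC // => y; rewrite mem_enum; first exact: ltxs.
exact/ltxs/subsetDl.
Qed.

End OrdinalSets.

Section OrdinalPartitions.
Variable n : nat.
Implicit Types (S A B : {set 'I_n}) (P : {set {set 'I_n}}) (x y : 'I_n).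

Let mx A := (\max_(i in A) i)%N.
Let lemx A B := (mx A <= mx B)%N.

Lemma max_in A : A != set0 -> exists2 i, i \in A & mx A = i.
Proof.
rewrite -card_gt0 => A0.
by have [i iA E] := eq_bigmax_cond (fun i : 'I_n => i : nat) A0; exists i.
Qed.

Lemma max_inj P S : partition P S -> {in P &, injective mx}.
Proof.
move=> partP A B PA PB eqAB; apply/eqP; apply: contraT => neqAB.
have disj := trivIsetP (partition_trivIset partP) _ _ PA PB neqAB.
have [i iA Ei] := max_in (partition_neq0 partP PA).
have [j jB Ej] := max_in (partition_neq0 partP PB).
have eij : i = j by apply/val_inj; rewrite /= -Ei -Ej.
by have := disjointFr disj iA; rewrite eij jB.
Qed.

(** B contains the overall maximum, so sorting by maxima puts it last; distinct blocks have distinct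
    maxima, which makes the sorted list unique. *)
Lemma blocks_setU1 P A x B : partition P A -> x \in B -> [disjoint B & A] ->
  (forall y, y \in B -> (y <= x)%N) -> (forall y, y \in A -> (y < x)%N) ->
  blocks (B |: P) = rcons (blocks P) (enum B).
Proof.
move=> partP xB disjBA leB ltA.
have BP : B \notin P.
  apply/negP=> PB; have xA : x \in A by exact: (subsetP (partitionS partP PB)).
  by have := disjointFr disjBA xB; rewrite xA.
have B0 : B != set0 by apply/set0Pn; exists x.
have partBP := partitionU1 partP B0 disjBA.
rewrite /blocks -[enum B]/((fun B : {set 'I_n} => enum (mem B)) B) -map_rcons; congr (map _ _).
have totle : total lemx by move=> X Y; exact: leq_total.
have trle : transitive lemx by move=> Y X Z; exact: leq_trans.
have permBP : perm_eq (rcons (sort lemx (enum P)) B) (enum (B |: P)).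
  apply: uniq_perm; rewrite ?enum_uniq // ?rcons_uniq ?mem_sort ?sort_uniq ?enum_uniq ?mem_enum ?BP //.
  by move=> X; rewrite mem_rcons in_cons mem_sort !mem_enum in_setU1.
have mxB : mx B = x.
  apply/eqP; rewrite eqn_leq; apply/andP; split; first exact/bigmax_leqP.
  exact: (@leq_bigmax_cond _ (mem B) (fun i : 'I_n => i : nat) x).
apply: (@sorted_eq_in _ lemx).
- by move=> X Y Z _ _ _; exact: trle.
- move=> X Y; rewrite !mem_sort !mem_enum => XP YP; rewrite -eqn_leq => /eqP.
  exact: (max_inj partBP).
- exact: sort_sorted.
- rewrite (sorted_pairwise trle) pairwise_rcons -(sorted_pairwise trle) sort_sorted // andbT.
  apply/allP=> X; rewrite mem_sort mem_enum => PX; rewrite /lemx mxB.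
  apply/bigmax_leqP=> i iX; apply/ltnW/ltA; exact: (subsetP (partitionS partP PX)).
- by rewrite perm_sym; apply: perm_trans permBP _; rewrite perm_sym perm_sort.
Qed.

Lemma blocks_set0 : blocks (set0 : {set {set 'I_n}}) = [::].
Proof. by rewrite /blocks enum_set0. Qed.

Lemma size_blocks P : size (blocks P) = #|P|.
Proof. by rewrite size_map size_sort cardE. Qed.

Lemma flatten_blocks_perm P S : partition P S -> perm_eq (flatten (blocks P)) (enum S).
Proof.
move=> partP; have E : enum S =i flatten (blocks P).
  move=> y; rewrite mem_enum -(cover_partition partP); apply/bigcupP/flatten_mapP => [[B PB yB]|[B]].
    by exists B; rewrite ?mem_sort mem_enum.
  by rewrite mem_sort !mem_enum; exists B.
rewrite perm_sym; apply: uniq_perm => //; first exact: enum_uniq.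
rewrite (uniq_size_uniq (enum_uniq _) E) -cardE (card_partition partP) size_flatten /shape.
rewrite /blocks -map_comp sumnE big_map (perm_big (enum P)) ?perm_sort // big_enum /=.
by apply/eqP; apply: eq_bigr => B _; rewrite -cardE.
Qed.

(** A is the complement of the block of x, and P the partition induced on it. *)
Lemma sum_partition_setU1 (V : nmodType) x S (F : {set {set 'I_n}} -> V) : x \notin S ->
  \sum_(P : {set {set 'I_n}} | partition P (x |: S)) F P =
  \sum_(A : {set 'I_n} | A \subset S) \sum_(P : {set {set 'I_n}} | partition P A)
    F ((x |: (S :\: A)) |: P).
Proof.
move=> xS; rewrite (partition_big (fun P => S :\: pblock P x) (fun A => A \subset S)) /=; last first.
  by move=> P _; exact: subsetDl.
apply: eq_bigr => A sAS.
set B := x |: (S :\: A).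
have disjBA : [disjoint B & A].
  rewrite -setI_eq0; apply/eqP/setP=> y; rewrite !inE; case: eqP => [->|_] /=.
    by apply: contraNF xS; exact: subsetP.
  by case: (y \in A); rewrite ?andbF.
have xB : x \in B by rewrite setU11.
have B0 : B != set0 by apply/set0Pn; exists x.
have BA : B :|: A = x |: S.
  apply/setP=> y; rewrite !inE -orbA; congr (_ || _).
  by case yA: (y \in A); rewrite ?orbT ?orbF //= (subsetP sAS _ yA).
rewrite (reindex_onto (fun P => B |: P) (fun P => P :\ B)) /=; last first.
  move=> P /andP[partP /eqP E]; rewrite setD1K //.
  have xP : x \in cover P by rewrite (cover_partition partP) setU11.
  suff -> : B = pblock P x by exact: pblock_mem.
  apply/setP=> y; rewrite !inE -E !inE.
  case: (y =P x) => [->|nyx] /=; first by rewrite mem_pblock xP.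
  have := subsetP (partitionS partP (pblock_mem xP)) y; rewrite in_setU1.
  by case: (y \in pblock P x) => [/(_ isT)/orP[/eqP//|->]|_] //=; case: (y \in S).
apply: eq_bigl => P; apply/idP/idP => [|partP]; last first.
  have BP : B \notin P.
    apply/negP=> PB; have := subsetP (partitionS partP PB) _ xB.
    by move=> xA; have := disjointFr disjBA xB; rewrite xA.
  have partBP := partitionU1 partP B0 disjBA.
  rewrite setU1K // eqxx andbT -BA partBP /=.
  rewrite (@def_pblock _ (B |: P) B x) ?setU11 ?(partition_trivIset partBP) //.
  apply/eqP/setP=> y; rewrite !inE; case yA: (y \in A).
    have yS := subsetP sAS _ yA; rewrite yS.
    by have -> : (y == x) = false by apply: contraNF xS => /eqP <-.
  by case: (y \in S); rewrite ?orbT ?andbF.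
case/andP=> /andP[partBP /eqP Apb] /eqP E.
have -> : A = (x |: S) :\: B.
  apply/setP=> y; rewrite !inE; case: eqP => [->|_] /=.
    by apply: contraNF xS; exact: subsetP.
  by case yA: (y \in A); rewrite ?(subsetP sAS _ yA) //; case: (y \in S).
by rewrite -E; apply: partitionD1; rewrite ?setU11.
Qed.

Variable d : 'I_n -> int.
Local Notation p := (oddz \o d).

Lemma koszul_cat (s t : seq 'I_n) : koszul d (s ++ t) =
  (koszul d s + \sum_(x <- s) \sum_(y <- t | (y < x)%N) absz (d x * d y)%R + koszul d t)%N.
Proof.
elim: s => [|x s IHs] /=; first by rewrite big_nil.
by rewrite IHs big_cat big_cons /=; lia.
Qed.

Lemma koszul_enum A : koszul d (enum A) = 0%N.
Proof.
elim/set_min_ind: A => [|x A ltx IHA]; first by rewrite enum_set0.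
by rewrite enum_setU1_min // koszul_cons_min // => y; rewrite mem_enum; exact: ltx.
Qed.

Lemma ps_enum (V : zmodType) S (G : seq (seq 'I_n) -> V) :
  ps p (enum S) G = \sum_(P : {set {set 'I_n}} | partition P S)
    sg (odd (koszul d (flatten (blocks P)))) (G (blocks P)).
Proof.
elim/set_max_ind: S G => [|x S ltx IHS] G.
  rewrite enum_set0 (big_pred1 set0) => [|P]; last by rewrite partition_set0.
  by rewrite blocks_set0.
have xS : x \notin S by apply/negP=> /ltx; rewrite ltnn.
rewrite enum_setU1_max // ps_rcons sh_enum sum_partition_setU1 //; apply: eq_bigr => A sAS.
rewrite IHS // (big_morph _ (sgD _) (sg0 _ _)); apply: eq_bigr => P partP.
have ltxs B : B \subset S -> forall y, y \in B -> (y < x)%N by move=> /subsetP sBS y /sBS/ltx.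
have ltB := ltxs _ (subsetDl S A).
rewrite (blocks_setU1 partP (setU11 _ _)); first last.
- by move=> y yA; exact: ltxs yA.
- by move=> y; rewrite in_setU1 => /orP[/eqP->//|/ltB/ltnW].
- rewrite -setI_eq0; apply/eqP/setP=> y; rewrite !inE; case: eqP => [->|_] /=.
    by apply: contraNF xS; exact: subsetP.
  by case: (y \in A); rewrite ?andbF.
rewrite enum_setU1_max // sgsg -cats1 flatten_cat /= cats0; congr (sg _ _).
(* The inversions between A and B do not depend on the order in which A is listed, and x, the
   largest element, adds none. *)
rewrite koszul_cat [in RHS]koszul_cat koszul_enum odd_koszul_rcons ?koszul_enum; last first.
  by move=> y; rewrite mem_enum; exact: ltB.
rewrite add0n !addn0 oddD addbC; congr (_ (+) odd _).
rewrite (perm_big _ (flatten_blocks_perm partP)) /= big_seq [RHS]big_seq.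
apply: eq_bigr => a; rewrite mem_enum => aA.
rewrite -cats1 big_cat /= big_cons big_nil ltnNge ltnW ?addn0 //; exact: ltxs aA.
Qed.

End OrdinalPartitions.

(** * Divisibility of the brackets of a binary QFT algebra *)

Section SymHom.
Variables (k : pzRingType) (V W : gradModType k) (n : nat) (j : int) (F : seq V -> W).

Lemma sym_hom_letters (s : seq (letter V)) : sym_hom n j F -> size s = n ->
  homog (degl (@ldeg k V) s + j) (F (map (@lvec k V) s)).
Proof.
move=> symF szs; case: n / szs symF => symF.
rewrite /degl (big_tnth _ _ s); apply: (sym_hom_degree symF (d := fun i => ldeg (tnth (in_tuple s) i))
  (v := [tuple of map (@lvec k V) (in_tuple s)])) => i.
rewrite tnth_map; exact: letterP.
Qed.

End SymHom.

Lemma entries_letters (k : pzRingType) (V : gradModType k) n (v : n.-tuple V)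
    (x : 'I_n -> letter V) (B : seq 'I_n) :
  (forall i, lvec (x i) = tnth v i) -> entries v B = map (@lvec k V) (map x B).
Proof.
move=> xv; rewrite /entries -map_comp; apply: eq_map => i /=.
by rewrite xv (tnth_nth 0).
Qed.

Section Descendants.
Variables (k : fieldType) (C : gradComAlgType k) (K : nat -> {linear C -> C}).
Hypothesis K_unit : forall r, K r 1 = 0.
Variable l : seq C -> series C.
Hypothesis l_sym : forall n, (0 < n)%N -> forall r, sym_hom n 1 (fun x => l x r).
Hypothesis l_eq : forall n, (0 < n)%N -> forall (d : 'I_n -> int) (x : n.-tuple C),
  (forall i, homog (d i) (tnth x i)) -> descendant_eq K l d x.

Local Notation T := (letter C).
Local Notation deg := (@ldeg k C).
Local Notation vec := (@lvec k C).
Local Notation p := (oddz \o deg).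
Local Notation P := (sprod (@svec k C \o @cletter k C)).

Let P_const A : P A = sconst (\prod_(y <- map vec A) y).
Proof.
elim: A => [|x A IHA]; first by rewrite sprod_nil big_nil.
rewrite sprod_cons IHA smul_sconstl /= big_cons; apply/funext => -[|r] //=.
by rewrite /sconst /= mulr0.
Qed.

Let P_homog A : shomog (degl deg A) (P A).
Proof. by apply: sprod_homog => x; exact: (sletterP (cletter x)). Qed.

Let JP_const A : sconst (\prod_(y <- map vec A) Jop y) = sg (par p A) (P A).
Proof.
elim: A => [|x A IHA]; first by rewrite sprod_nil big_nil.
rewrite sprod_cons /= big_cons (Jop_homog (letterP x)) -/(oddz _).
rewrite -sgsg -smul_sgr -IHA /= smul_sconstl.
apply/funext => -[|r]; rewrite /sconst /=; case: (oddz _) => //=; first by rewrite mulNr.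
- by rewrite !fctE /= mulr0 oppr0.
- by rewrite mulr0.
Qed.

(** The summand of [descendant_eq] at block i. Its sign comes from the operators J; the Koszul sign
    of the partition is supplied by [ps]. The arity N is kept apart from bl for the recursion on the
    last block. *)
Let term N (bl : seq (seq T)) (i : nat) : series C :=
  nhbar (N - size bl) (sg (par p (flatten (take i bl)))
    (smul (smul (P (flatten (take i bl))) (l (map vec (nth [::] bl i))))
          (P (flatten (drop i.+1 bl))))).
Let HH N (bl : seq (seq T)) : series C :=
  \sum_(i < size bl | size (nth [::] bl i) == (N - size bl + 1)%N) term N bl i.
Let LL (B : seq T) : series C := if B is [::] then 0 else nhbar (size B).-1 (l (map vec B)).

Let l_homog B : B <> [::] -> shomog (degl deg B + 1) (l (map vec B)).
Proof.
move=> B0 r; apply: (@sym_hom_letters _ _ _ (size B) 1 (fun x => l x r)) => //.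
by apply: l_sym; case: B B0.
Qed.

Let HH_rcons N bl b : HH N.+1 (rcons bl b) = smul (HH N bl) (P b) +
  (if size b == (N - size bl + 1)%N
   then nhbar (N - size bl) (sg (par p (flatten bl)) (smul (P (flatten bl)) (l (map vec b))))
   else 0).
Proof.
rewrite /HH big_mkcond size_rcons big_ord_recr /=; congr (_ + _); last first.
  rewrite nth_rcons ltnn eqxx subSS; case: ifP => // _.
  rewrite /term size_rcons subSS nth_rcons ltnn eqxx -cats1 take_size_cat //.
  by rewrite drop_oversize ?size_cat ?addn1 // sprod_nil smul1r.
rewrite (@big_morph _ _ (fun u => smul u (P b)) 0 +%R); last 2 first.
- by move=> u v; exact: smulDl.
- exact: smul0l.
rewrite [RHS]big_mkcond; apply: eq_bigr => i _; rewrite nth_rcons ltn_ord subSS.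
case: ifP => // _; rewrite /term size_rcons subSS nth_rcons ltn_ord.
have le_i : (i <= size bl)%N by exact: ltnW.
rewrite -cats1 takel_cat // drop_cat; have := ltn_ord i; rewrite leq_eqVlt => /orP[/eqP E|lt_i].
  rewrite E ltnn subnn drop0 drop_oversize ?E //= cats0 sprod_nil smul1r.
  by rewrite smul_nhbarl smul_sgl.
by rewrite lt_i flatten_cat /= cats0 sprod_cat smul_nhbarl smul_sgl !smulA.
Qed.

(** All blocks but the distinguished one are singletons, so a partition with a distinguished block
    is just a splitting of s. *)
Lemma descendant_ps s : ps p s (HH (size s)) = sh p s (fun B A => smul (LL B) (P A)).
Proof.
elim/seq_rcons_ind: s => [|s x IHs]; first by rewrite /HH /= smul0l; exact: big_ord0.
rewrite size_rcons ps_rcons.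
under sh_ext do under ps_ext do rewrite HH_rcons.
under sh_ext do rewrite psD.
rewrite shD sh_rcons; congr (_ + _).
  (* If the last block is not the distinguished one, it is the singleton of x, that is, B is
     empty. *)
  rewrite sh_leftE => [|A B szAB B0].
    transitivity (smul (ps p s (HH (size s))) (P [:: x])).
      by rewrite (@ps_morph _ _ _ _ (fun u => smul u (P [:: x]))) // => *; exact: smulDl.
    rewrite IHs // (@sh_morph _ _ _ _ (fun u => smul u (P [:: x]))); last first.
      by move=> *; exact: smulDl.
    by apply: sh_ext => A B; rewrite -smulA -sprod_cat cats1.
  apply: ps_eq0 => bl szbl _ bl0; rewrite /HH big_pred0 ?smul0l // => i.
  apply/negP=> /eqP E; have := size_nth_flatten (ltn_ord i) bl0.
  by move: (size_flatten_leq bl0); rewrite E szbl -szAB; move: B0; lia.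
(* Here the last block is the distinguished one, and the size condition makes the blocks of A
   singletons. *)
rewrite [RHS]sh_comm; apply: eq_sh => A B szAB _.
transitivity (ps p A (fun bl => if size bl == size A then
   nhbar (size B) (sg (par p (flatten bl))
     (smul (P (flatten bl)) (l (map vec (rcons B x))))) else 0)).
  apply: eq_ps => bl szbl _ bl0; have := size_flatten_leq bl0.
  rewrite szbl size_rcons => le_bl.
  have -> : ((size B).+1 == size s - size bl + 1)%N = (size bl == size A).
    by rewrite -szAB; lia.
  by case: eqP => // ->; rewrite -szAB addKn.
rewrite ps_singletons flatten_seq1.
have -> : LL (rcons B x) = nhbar (size B) (l (map vec (rcons B x))).
  by rewrite /LL -[size B]/(size B).+1.-1 -(size_rcons B x); case: (rcons B x) (size_rcons B x).
rewrite smul_nhbarl nhbar_sg (smulC (P_homog A) (@l_homog (rcons B x) _)); last by case: (B).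
rewrite -!/(oddz _) oddzD !oddz_degl par_rcons !nhbar_sg -[oddz 1]/true /=.
by move: (oddz (ldeg x)) (par p A) (par p B) => a b c; sgb.
Qed.

Lemma descendant_sprod s :
  sapp (fun r => K r : C -> C) (P s) = sh p s (fun B A => smul (LL B) (P A)).
Proof.
case: (posnP (size s)) => [|s_gt0].
  case: s => // _; rewrite P_const big_nil sapp_sconst => [|*]; last exact: linearD.
  by rewrite /= smul0l; apply/funext => r; rewrite K_unit.
rewrite -descendant_ps P_const sapp_sconst => [|*]; last exact: linearD.
pose x i := tnth (in_tuple s) i.
have sE : map x (enum 'I_(size s)) = s by rewrite map_tnth_enum.
have /(_ (fun i => deg (x i)) [tuple of map vec (in_tuple s)]) := l_eq s_gt0.
rewrite /descendant_eq => -> => [|i]; last by rewrite tnth_map; exact: letterP.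
transitivity (ps p (map x (enum 'I_(size s))) (HH (size s))); last by rewrite sE.
rewrite ps_map enumT -enum_setT ps_enum; apply: eq_bigr => Q partQ.
rewrite /HH size_map size_blocks (big_morph _ (sgD _) (sg0 _ _)).
have lt_i (i : 'I_#|Q|) : (i < size (blocks Q))%N by rewrite size_blocks.
apply: eq_big => [i|i _]; first by rewrite (nth_map [::] [::] (map x)) ?lt_i // [in RHS]size_map.
rewrite /term size_map size_blocks !(@entries_letters _ _ _ _ x); try by move=> j; rewrite tnth_map.
rewrite -map_take -map_drop -!map_flatten (nth_map [::] [::] (map x)) ?lt_i //.
rewrite sgZ nhbar_sg; congr (sg _ _).
by rewrite -P_const JP_const smul_sgl smul_sgl nhbar_sg.
Qed.

End Descendants.

(** On constant entries the bracket is (- hbar)^(n-1) l_n, by uniqueness; [kbr_hdvd] extends the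
    divisibility to series. *)
Lemma binary_kbr_hdvd (k : fieldType) (C : gradComAlgType k) (K : nat -> {linear C -> C}) :
  binary_qft K -> forall s, hdvd (size s).-1 (kbr (@sdeg k C) (@svec k C) K s).
Proof.
case=> _ K_unit _ _ [l l_axiom]; apply: kbr_hdvd => // t.
have l_sym n (n_gt0 : (0 < n)%N) := (l_axiom n n_gt0).1.
have l_eq n (n_gt0 : (0 < n)%N) := (l_axiom n n_gt0).2.
rewrite kbr_map (kbr_uniq _ (descendant_sprod K_unit l_sym l_eq)) => [|x].
  by case: t => // x t; exact: hdvd_nhbar.
exact: (sletterP (cletter x)).
Qed.

(** * Multilinear extension *)

Section MultilinearExtension.
Variables (k : pzRingType) (V : gradModType k).

Lemma hsupp0 : hsupp (0 : V) = [::].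
Proof. by case E: (hsupp 0) => [//|i r]; have := mem_hsupp i (0 : V); rewrite E mem_head hcomp0 eqxx. Qed.

Lemma mlext_cons (W : nmodType) (F : seq int -> seq V -> W) v vs :
  mlext F (v :: vs) =
  \sum_(i <- hsupp v) mlext (fun ds us => F (i :: ds) (hcomp i v :: us)) vs.
Proof. by rewrite /mlext /= big_allpairs_dep. Qed.

Lemma mlext_eq0 (W : nmodType) (F : seq int -> seq V -> W) vs : 0 \in vs -> mlext F vs = 0.
Proof.
elim: vs F => //= v vs IHvs F; rewrite mlext_cons in_cons => /orP[/eqP<-|v0].
  by rewrite hsupp0 big_nil.
by rewrite big1 // => i _; exact: IHvs.
Qed.

(** The zero vector has empty support, so [mlext] vanishes there; F has to agree with this for
    [mlext] to return its values on letters. *)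
Definition kills0 (W : nmodType) (F : seq int -> seq V -> W) :=
  forall ds us, 0 \in us -> F ds us = 0.

Lemma mlext_letters (W : nmodType) (F : seq int -> seq V -> W) (t : seq (letter V)) :
  kills0 F -> mlext F (map (@lvec k V) t) = F (map (@ldeg k V) t) (map (@lvec k V) t).
Proof.
elim: t F => [|x t IHt] F F0; first by rewrite /mlext /= big_seq1.
rewrite /= mlext_cons (sum_hcomp_homog (letterP x)) => [|i ->].
  by rewrite IHt ?(eqP (letterP x)) // => ds us u0; rewrite F0 // in_cons u0 orbT.
by rewrite /mlext big1 // => ds _; rewrite F0 ?mem_head.
Qed.

Lemma mlext_split (W : nmodType) (F : seq int -> seq V -> W) s1 v s2 : kills0 F ->
  mlext F (s1 ++ v :: s2) = \sum_(i <- hsupp v) mlext F (s1 ++ hcomp i v :: s2).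
Proof.
elim: s1 F => [|u s1 IHs] F F0 /=.
  rewrite mlext_cons; apply: eq_bigr => i _; rewrite mlext_cons.
  rewrite (sum_hcomp_homog (homog_hcomp i v)) ?hcomp_comp ?eqxx // => j ->.
  by rewrite /mlext big1 // => ds _; rewrite F0 ?mem_head.
rewrite mlext_cons; under [RHS]eq_bigr do rewrite mlext_cons.
rewrite [RHS]exchange_big; apply: eq_bigr => j _; apply: IHs => ds us u0.
by rewrite F0 // in_cons u0 orbT.
Qed.

(** Additivity over homogeneous components only. It is known by construction, before multilinearity,
    and suffices to extend identities from letters to all vectors. *)
Definition splits (W : nmodType) n (G : seq V -> W) :=
  forall s1 v s2, (size s1 + size s2).+1 = n ->
    G (s1 ++ v :: s2) = \sum_(i <- hsupp v) G (s1 ++ hcomp i v :: s2).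

Lemma splits_eq0 (W : nmodType) n (G : seq V -> W) : splits n G ->
  (forall t : seq (letter V), size t = n -> G (map (@lvec k V) t) = 0) ->
  forall vs, size vs = n -> G vs = 0.
Proof.
move=> splG G0 vs.
suff H (t : seq (letter V)) : (size t + size vs)%N = n -> G (map (@lvec k V) t ++ vs) = 0.
  exact: (H [::]).
elim: vs t => [|v vs IHvs] t szt; first by rewrite cats0 G0 // -szt addn0.
rewrite splG ?size_map -?addnS // big1 // => i _.
have := IHvs (rcons t (Letter (homog_hcomp i v))).
by rewrite map_rcons cat_rcons size_rcons addSnnS; apply.
Qed.

End MultilinearExtension.

Section SymHomLetters.
Variables (k : pzRingType) (V W : gradModType k) (n : nat) (j : int) (G : seq V -> W).
Local Notation vec := (map (@lvec k V)).
Hypothesis G_split : splits n G.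

Lemma splits_kill0 s1 s2 : (size s1 + size s2).+1 = n -> G (s1 ++ 0 :: s2) = 0.
Proof. by move=> sz; rewrite G_split // hsupp0 big_nil. Qed.

Hypothesis G_slot : forall (t1 t2 : seq (letter V)) (x y z : letter V) a,
  (size t1 + size t2).+1 = n -> ldeg x = ldeg z -> ldeg y = ldeg z ->
  lvec z = lvec x + a *: lvec y ->
  G (vec (t1 ++ z :: t2)) = G (vec (t1 ++ x :: t2)) + a *: G (vec (t1 ++ y :: t2)).
Hypothesis G_swap : forall (t1 t2 : seq (letter V)) (x y : letter V),
  (size t1 + size t2).+2 = n ->
  G (vec (t1 ++ x :: y :: t2)) =
  sg (oddz (ldeg x) && oddz (ldeg y)) (G (vec (t1 ++ y :: x :: t2))).
Hypothesis G_homog : forall t : seq (letter V), size t = n ->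
  homog (degl (@ldeg k V) t + j) (G (vec t)).

(** E is the defect of an identity that concerns one or two fixed entries, as a function of the
    entries before and after them. *)
Lemma splits_ext2 (X : zmodType) (E : seq V -> seq V -> X) m :
  (forall s1 s2 v s3, (size s1 + size s2 + size s3).+1 = m ->
    E (s1 ++ v :: s2) s3 = \sum_(i <- hsupp v) E (s1 ++ hcomp i v :: s2) s3) ->
  (forall s1 s2 v s3, (size s1 + size s2 + size s3).+1 = m ->
    E s3 (s1 ++ v :: s2) = \sum_(i <- hsupp v) E s3 (s1 ++ hcomp i v :: s2)) ->
  (forall t1 t2, (size t1 + size t2)%N = m -> E (vec t1) (vec t2) = 0) ->
  forall s1 s2, (size s1 + size s2)%N = m -> E s1 s2 = 0.
Proof.
move=> E1 E2 E0 s1 s2 szm.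
apply: (@splits_eq0 _ _ _ (size s1) (E^~ s2)) => // [r1 v r2 sz|t1 sz1].
  by apply: E1; rewrite -addSn sz.
apply: (@splits_eq0 _ _ _ (size s2) (E (vec t1))) => // [r1 v r2 sz|t2 sz2].
  by apply: E2; rewrite size_map sz1 -addSn sz addnC.
by apply: E0; rewrite sz1 sz2.
Qed.

Lemma splits_slot s1 s2 a x y : (size s1 + size s2).+1 = n ->
  G (s1 ++ (a *: x + y) :: s2) = a *: G (s1 ++ x :: s2) + G (s1 ++ y :: s2).
Proof.
move=> szn; apply/eqP; rewrite -subr_eq0; apply/eqP.
pose E s1 s2 := G (s1 ++ (a *: x + y) :: s2) - (a *: G (s1 ++ x :: s2) + G (s1 ++ y :: s2)).
apply: (@splits_ext2 _ E (size s1 + size s2)) => // [r1 r2 v r3 sz|r1 r2 v r3 sz|t1 t2 sz].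
- have H u : G ((r1 ++ v :: r2) ++ u :: r3) = \sum_(i <- hsupp v) G ((r1 ++ hcomp i v :: r2) ++ u :: r3).
    rewrite -catA /= G_split ?size_cat /=; last by rewrite -szn -sz; lia.
    by apply: eq_bigr => i _; rewrite -catA.
  by rewrite /E !H scaler_sumr -big_split -sumrB.
- have H u : G (r3 ++ u :: r1 ++ v :: r2) = \sum_(i <- hsupp v) G (r3 ++ u :: r1 ++ hcomp i v :: r2).
    rewrite -cat_cons catA G_split ?size_cat /=; last by rewrite -szn -sz; lia.
    by apply: eq_bigr => i _; rewrite -catA.
  by rewrite /E !H scaler_sumr -big_split -sumrB.
have szt : (size t1 + size t2).+1 = n by rewrite sz.
have szv : (size (vec t1) + size (vec t2)).+1 = n by rewrite !size_map.
have H (r : seq int) u : uniq r -> {subset hsupp u <= r} ->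
    G (vec t1 ++ u :: vec t2) = \sum_(i <- r) G (vec t1 ++ hcomp i u :: vec t2).
  by move=> ur sr; rewrite G_split //; apply: sum_hcomp => // i ->; exact: splits_kill0.
(* A common list of degrees, since the three vectors may have different supports. *)
pose r := undup (hsupp (a *: x + y) ++ hsupp x ++ hsupp y).
have ur : uniq r by exact: undup_uniq.
rewrite /E !(H r) //; try by move=> i iu; rewrite mem_undup !mem_cat iu ?orbT.
apply/eqP; rewrite subr_eq0 scaler_sumr -big_split; apply/eqP; apply: eq_bigr => i _ /=.
have zE : hcomp i (a *: x + y) = hcomp i y + a *: hcomp i x by rewrite hcompP addrC.
have := G_slot (t1 := t1) (t2 := t2) (x := Letter (homog_hcomp i y)) (y := Letter (homog_hcomp i x))
  (z := Letter (homog_hcomp i (a *: x + y))) (a := a) szt erefl erefl zE.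
by rewrite !map_cat /= => ->; rewrite addrC.
Qed.

Lemma splits_swap s1 s2 i1 i2 x y : (size s1 + size s2).+2 = n ->
  homog i1 x -> homog i2 y ->
  G (s1 ++ x :: y :: s2) = (-1) ^+ absz (i1 * i2) *: G (s1 ++ y :: x :: s2).
Proof.
move=> szn hx hy; apply/eqP; rewrite sgZ abszM oddM -subr_eq0; apply/eqP.
pose E s1 s2 := G (s1 ++ x :: y :: s2) - sg (oddz i1 && oddz i2) (G (s1 ++ y :: x :: s2)).
apply: (@splits_ext2 _ E (size s1 + size s2)) => // [r1 r2 v r3 sz|r1 r2 v r3 sz|t1 t2 sz].
- have H u w : G ((r1 ++ v :: r2) ++ u :: w :: r3) = \sum_(i <- hsupp v) G ((r1 ++ hcomp i v :: r2) ++ u :: w :: r3).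
    rewrite -catA /= G_split ?size_cat /=; last by rewrite -szn -sz; lia.
    by apply: eq_bigr => i _; rewrite -catA.
  by rewrite /E !H (big_morph _ (sgD _) (sg0 _ _)) -sumrB.
- have H u w : G (r3 ++ u :: w :: r1 ++ v :: r2) = \sum_(i <- hsupp v) G (r3 ++ u :: w :: r1 ++ hcomp i v :: r2).
    rewrite -2!cat_cons catA G_split ?size_cat /=; last by rewrite -szn -sz; lia.
    by apply: eq_bigr => i _; rewrite -catA.
  by rewrite /E !H (big_morph _ (sgD _) (sg0 _ _)) -sumrB.
have := G_swap (t1 := t1) (t2 := t2) (Letter hx) (Letter hy).
by rewrite /E !map_cat /= => ->; rewrite ?subrr // sz.
Qed.

Lemma sym_hom_of_letters : sym_hom n j G.
Proof.
split; [exact: splits_slot | exact: splits_swap |] => d v hv.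
pose x i := Letter (hv i); have := @G_homog (map x (enum 'I_n)).
rewrite size_map size_enum_ord -map_comp /degl big_map big_enum /= => /(_ erefl).
congr (homog _ (G _)); rewrite -[RHS]map_tnth_enum; exact: eq_map.
Qed.

End SymHomLetters.

(** * The canonical families *)

Lemma series_decomp (k : pzRingType) (V : lmodType k) (w : series V) :
  w = sconst (w 0%N) + nhbar 1 (div_nhbar w).
Proof.
apply/funext => -[|r]; rewrite fctE /sconst ?nhbar10 ?nhbar1S /= ?addr0 //.
by rewrite add0r /div_nhbar opprK.
Qed.

Lemma sapp_comp0 (k : pzRingType) (U V W : lmodType k)
    (b : nat -> V -> W) (c : nat -> U -> V) :
  (forall i x y, b i (x + y) = b i x + b i y) ->
  (forall i x y, c i (x + y) = c i x + c i y) ->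
  (forall x, sapp b (fun r => c r x) = 0) -> forall w, sapp b (sapp c w) = 0.
Proof.
move=> bD cD bc0 w; apply/funext => r; elim: r w => [|r IHr] w.
  by have := congr1 (fun u => u 0%N) (bc0 (w 0%N)); rewrite /sapp !big_ord1.
rewrite [w]series_decomp !sappD // sapp_sconst // bc0 add0r !sapp_nhbar // nhbar1S IHr.
by rewrite oppr0.
Qed.

Section Canonical.
Variables (k : fieldType) (C : gradComAlgType k) (K : nat -> {linear C -> C}).
Hypothesis K_qft : binary_qft K.
Variables (H : gradModType k) (cl : C -> H).
Variables (f : {linear H -> C}) (h : {linear C -> H}) (s : {linear C -> C}).
Hypotheses (fhs_ret : is_retract K cl f h s) (K_free : anomaly_free K f h s).

Local Notation KK := (sapp (fun r => K r : C -> C)).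
Local Notation fb := (fbar K f h s).
Local Notation FF := (sapp fb).
Local Notation nb := (nabla K f h s).

Let KD r x y : K r (x + y) = K r x + K r y. Proof. exact: linearD. Qed.
Let K_degree := bqft_degree K_qft.

Lemma KK_KK w : KK (KK w) = 0.
Proof. by apply: sapp_comp0 => // x; exact: bqft_square. Qed.

(** The terms of g^(n) with kappa drop out. That each f^(i) sends 0 to 0 is proved directly, as the
    linearity of f^(i) is deduced from this formula. *)
Lemma fbar_gterm n v : fb n.+1 v = - s (\sum_(0 <= j < n.+1) K (n.+1 - j)%N (fb j v)).
Proof.
rewrite fbarS; congr (- s _).
have fb0 i : fb i 0 = 0.
  elim: i {-2}i (leqnn i) => [|N IHN] [|i] le_iN //; rewrite ?fbar0 ?linear0 //.
  rewrite fbarS gtermE big_nat big1 => [|j /andP[_ lt_j]]; last first.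
    by rewrite IHN ?linear0 // -ltnS (leq_trans lt_j).
  rewrite big_nat big1 => [|j /andP[j_gt0 lt_j]]; last first.
    by rewrite K_free // IHN //; lia.
  by rewrite subr0 linear0 oppr0.
rewrite gtermE [X in _ - X]big_nat [X in _ - X]big1 ?subr0 // => j /andP[j_gt0 _].
by rewrite K_free // fb0.
Qed.

Lemma fbar_linear n : linear (fb n).
Proof.
elim: n {-2}n (leqnn n) => [|N IHN] [|n] le_nN a x y //; rewrite ?fbar0 ?linearP //.
rewrite !fbar_gterm -linearN -linearN -linearN -linearP; congr (s _).
rewrite scalerN -opprD; congr (- _); rewrite scaler_sumr -big_split; apply: eq_big_nat.
move=> j /andP[_ lt_j]; rewrite IHN ?linearP //.
by rewrite -ltnS (leq_trans lt_j).
Qed.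

Lemma fbarD n x y : fb n (x + y) = fb n x + fb n y.
Proof. by rewrite -[x in LHS]scale1r fbar_linear scale1r. Qed.

Lemma fbar_degree n : of_degree 0 (fb n).
Proof.
elim: n {-2}n (leqnn n) => [|N IHN] [|n] le_nN i x hx //; try exact: (ret_f_degree fhs_ret).
rewrite fbar_gterm; apply: homogN.
rewrite -(addrK 1 (i + 0)); apply: (ret_s_degree fhs_ret).
rewrite big_nat; apply: homog_sum => j /andP[_ lt_j]; apply: K_degree; apply: IHN => //.
by rewrite -ltnS (leq_trans lt_j).
Qed.

(* Anomaly-freeness says h g = 0; with K K = 0 this makes each K^(0) f^(n) cancel g^(n). *)
Lemma K_fbar v : KK (fun r => fb r v) = 0.
Proof.
apply/funext => n; elim: n {-2}n (leqnn n) => [|N IHN] n le_nN.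
  by move: le_nN; rewrite leqn0 => /eqP->; rewrite /sapp big_ord1 /= fbar0 (ret_Kf fhs_ret).
case: (ltngtP n N.+1) le_nN => // [lt_nN _|-> _]; first exact: IHN.
set F := KK (fun r => fb r v); rewrite -/F in IHN *.
pose g := \sum_(0 <= j < N.+1) K (N.+1 - j)%N (fb j v).
have FE : F N.+1 = K 0%N (fb N.+1 v) + g.
  rewrite /F /sapp big_ord_recl /= subn0; congr (_ + _).
  rewrite /g big_mkord (reindex_inj rev_ord_inj) /=; apply: eq_bigr => i _.
  have le_iN : (i <= N)%N by rewrite -ltnS.
  by rewrite /bump /= add1n !subSS subKn // subSn.
(* This is the coefficient of order N + 1 in K K f = 0, the lower coefficients of K f vanishing by
   induction. *)
have K0F : K 0%N (F N.+1) = 0.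
  have := congr1 (fun w => w N.+1) (KK_KK (fun r => fb r v)); rewrite -/F /= /sapp.
  rewrite big_ord_recl subn0 big1 ?addr0 // => i _.
  by rewrite IHN ?linear0 // lift0 subSS leq_subr.
have hg : h g = 0.
  have := @K_free N.+1 v isT; rewrite kappaS gtermE.
  rewrite [X in _ - X]big_nat [X in _ - X]big1 ?subr0 // => j /andP[j_gt0 lt_j].
  rewrite K_free //; case: (N.+1 - j)%N => [|m]; first by rewrite fbar0 linear0.
  by rewrite -[0 in LHS]addr0; apply: (addIr (fb m.+1 0)); rewrite -fbarD !addr0 add0r.
have K0g : K 0%N g = 0.
  move: K0F; rewrite FE linearD /= => <-; rewrite -[LHS]add0r; congr (_ + _).
  have := congr1 (fun w => w 0%N) (KK_KK (sconst (fb N.+1 v))).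
  rewrite /sapp !big_ord1 /= => ->.
  by [].
rewrite FE fbar_gterm -/g linearN /=.
have := ret_fh fhs_ret g; rewrite hg K0g !linear0 addr0 => gE.
by rewrite addrC -gE.
Qed.

Lemma K_FF w : KK (FF w) = 0.
Proof. by apply: sapp_comp0 => // *; [exact: fbarD | exact: K_fbar]. Qed.

(** * The operator nabla and the homotopy expansion *)

Lemma nbE w : nhbar 1 (nb w) =
  w - FF (sconst (h (w 0%N))) - KK (sconst (s (w 0%N))) - sconst (s (K 0%N (w 0%N))).
Proof.
rewrite (nablaE w fhs_ret) !sapp_sconst // => *; exact: fbarD.
Qed.

Lemma nbP a w1 w2 : nb (a *: w1 + w2) = a *: nb w1 + nb w2.
Proof.
apply/funext => r; rewrite /nabla /div_nhbar !fctE /= !linearP /= fbar_linear.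
rewrite !linearP /= /sconst /= !subr0 [in RHS]scalerN -[RHS]opprD; congr (- _).
by rewrite !scalerDr (addrACA (a *: w1 r.+1)) (addrACA (_ + _)).
Qed.

Lemma nbD w1 w2 : nb (w1 + w2) = nb w1 + nb w2.
Proof. by rewrite -[w1 in LHS]scale1r nbP scale1r. Qed.
Lemma nb0 : nb 0 = 0. Proof. exact: morph_0 nbD. Qed.
Lemma nbZ a w : nb (a *: w) = a *: nb w.
Proof. by rewrite -[a *: w]addr0 nbP nb0 addr0. Qed.

Lemma iter_nbD n w1 w2 : iter n nb (w1 + w2) = iter n nb w1 + iter n nb w2.
Proof. by elim: n => //= n ->; exact: nbD. Qed.
Lemma iter_nb0 n : iter n nb 0 = 0.
Proof. exact: morph_0 (iter_nbD n). Qed.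
Lemma iter_nbZ n a w : iter n nb (a *: w) = a *: iter n nb w.
Proof. by elim: n => //= n ->; exact: nbZ. Qed.
Lemma iter_nb_sg n b w : iter n nb (sg b w) = sg b (iter n nb w).
Proof. exact: morph_sg (iter_nbD n). Qed.

Lemma KKD w1 w2 : KK (w1 + w2) = KK w1 + KK w2. Proof. exact: sappD. Qed.
Lemma KK0 : KK 0 = 0. Proof. exact: morph_0 KKD. Qed.
Lemma KK_sg b w : KK (sg b w) = sg b (KK w). Proof. exact: sapp_sg. Qed.
Lemma KKN w : KK (- w) = - KK w. Proof. exact: KK_sg true w. Qed.
Lemma KK_nhbar m w : KK (nhbar m w) = nhbar m (KK w). Proof. exact: sapp_nhbar. Qed.
Lemma FFD w1 w2 : FF (w1 + w2) = FF w1 + FF w2. Proof. exact: (sappD fbarD). Qed.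
Lemma FF0 : FF 0 = 0. Proof. exact: morph_0 FFD. Qed.
Lemma FF_sg b w : FF (sg b w) = sg b (FF w). Proof. exact: (sapp_sg fbarD). Qed.
Lemma FFN w : FF (- w) = - FF w. Proof. exact: FF_sg true w. Qed.
Lemma FF_nhbar m w : FF (nhbar m w) = nhbar m (FF w). Proof. exact: (sapp_nhbar fbarD). Qed.

Lemma nb_homog i w : shomog i w -> shomog i (nb w).
Proof.
move=> hw r; rewrite /nabla /div_nhbar !fctE /sconst /= subr0; apply: homogN.
have hs x : homog i x -> homog (i - 1) (s x) by exact: (ret_s_degree fhs_ret).
apply: homogD; [apply: homogD => // | ]; apply: homogN.
  rewrite -[i]addr0; apply: fbar_degree; rewrite -[i]addr0; exact: (ret_h_degree fhs_ret).
by rewrite -[i](subrK 1); apply: K_degree; exact: hs.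
Qed.

Lemma iter_nb_homog n i w : shomog i w -> shomog i (iter n nb w).
Proof. by move=> hw; elim: n => //= n; exact: nb_homog. Qed.

Lemma nb_nhbar w : nb (nhbar 1 w) = w.
Proof.
apply: (@nhbar_inj _ _ 1); rewrite nbE nhbar10 !linear0 /= !sconst0.
by rewrite FF0 KK0 !subr0.
Qed.

Lemma iter_nb_nhbar n m w : iter n nb (nhbar (n + m) w) = nhbar m w.
Proof. by elim: n => //= n IHn; rewrite -iterS iterSr -add1n -addnA -nhbarM nb_nhbar. Qed.

(** Divisibility of K w by hbar kills the correction s K w in [nbE], and K kills the other two. *)
Lemma K_nb w y : KK w = nhbar 1 y -> KK (nb w) = y.
Proof.
move=> Kw; have K0 : K 0%N (w 0%N) = 0.
  by have := congr1 (fun u => u 0%N) Kw; rewrite /sapp big_ord1.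
apply: (@nhbar_inj _ _ 1); rewrite -KK_nhbar nbE K0 linear0 sconst0 subr0.
by rewrite !KKD !KKN KK_KK K_FF Kw !oppr0 !addr0.
Qed.

Lemma K_iter_nb n m w y : KK w = nhbar (n + m) y -> KK (iter n nb w) = nhbar m y.
Proof.
elim: n m => //= n IHn m Kw; apply: K_nb; rewrite nhbarM add1n.
by apply: IHn; rewrite addnS.
Qed.

Definition hpart n w : series H := \sum_(0 <= i < n) nhbar i (sconst (h (iter i nb w 0%N))).
Definition spart n w : series C := \sum_(0 <= i < n) nhbar i (sconst (s (iter i nb w 0%N))).

(** Iteration of w = F h w + K s w + (- hbar) nabla w, where h and s act on the constant term; each
    round uses up one factor hbar of K w. *)
Lemma homotopy_expansion n w y : KK w = nhbar n y ->
  w = FF (hpart n w) + KK (spart n w) + nhbar n (iter n nb w).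
Proof.
elim: n y => [|n IHn] y Kw.
  by rewrite /hpart /spart !big_geq // FF0 KK0 !add0r nhbar0.
rewrite {1}(IHn (nhbar 1 y)) ?nhbarM ?addn1 //.
rewrite /hpart /spart !big_nat_recr //= -/(hpart _ _) -/(spart _ _).
set W := iter n nb w; have KW : KK W = nhbar 1 y by apply: K_iter_nb; rewrite addn1.
have K0 : K 0%N (W 0%N) = 0.
  by have := congr1 (fun u => u 0%N) KW; rewrite /sapp big_ord1.
have := nbE W; rewrite K0 linear0 sconst0 subr0 => nW.
rewrite -[in RHS]addn1 -nhbarM nW !nhbarB FFD KKD FF_nhbar KK_nhbar -!addrA; congr (_ + _).
move: (nhbar n (FF _)) (nhbar n (KK _)) (KK _) (nhbar n W) => a b c e.
by rewrite addrCA; congr (_ + _); rewrite addrCA [b + _]addrC -!addrA addNr addr0 addrC addrNK.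
Qed.

(** * The families phi, Omega and pi on lists of letters *)

Local Notation L := (letter H).
Local Notation deg := (@ldeg k H).
Local Notation vec := (map (@lvec k H)).
Local Notation p := (oddz \o deg).
Local Notation phi := (phi K f h s).
Local Notation Omega := (Omega K f h s).

Let partition_summand (ds : seq int) (us : seq H) : series C :=
  let n := size us in
  let d (i : 'I_n) := nth 0 ds i in
  \sum_(P : {set {set 'I_n}} | partition P [set: 'I_n] && (#|P| != 1%N))
    nhbar (n - #|P|) ((-1) ^+ koszul d (flatten (blocks P)) *:
      \big[@smul k C/sconst 1]_(B <- blocks P) phi (entries us B)).

Lemma OmegaE vs : Omega vs = mlext partition_summand vs.
Proof. by []. Qed.

Lemma phi_kill0 vs : 0 \in vs -> phi vs = 0.
Proof.
case: vs => [//|v [|u vs]] v0.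
  move: v0; rewrite inE => /eqP <-; rewrite phi1; apply/funext => r.
  exact: morph_0 (fbarD r).
by rewrite phiE // OmegaE mlext_eq0 // iter_nb0 oppr0.
Qed.

Lemma partition_summand_kill0 : kills0 partition_summand.
Proof.
move=> ds us u0; rewrite /partition_summand big1 // => P /andP[partP _].
have lt_i : (index (0%R : H) us < size us)%N by rewrite index_mem.
have /flatten_mapP[B BP iB] : Ordinal lt_i \in flatten (blocks P).
  by rewrite (perm_mem (flatten_blocks_perm partP)) mem_enum in_setT.
rewrite [X in _ *: X](_ : _ = 0) ?scaler0 ?nhbar_0 //.
have : enum B \in blocks P by apply/mapP; exists B.
case/splitPr => r1 r2; rewrite big_cat big_cons phi_kill0 /= ?smul0l ?smul0r //.
by apply/mapP; exists (Ordinal lt_i) => //=; rewrite nth_index.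
Qed.

Lemma Omega_split n : splits n Omega.
Proof.
by move=> s1 v s2 _; rewrite !OmegaE mlext_split //; exact: partition_summand_kill0.
Qed.

Local Notation Ph := (fun t : seq L => phi (vec t)).

Lemma Omega_letters (t : seq L) : Omega (vec t) =
  ps p t (fun bl => if size bl == 1%N then 0
                    else nhbar (size t - size bl) (sprod Ph bl)).
Proof.
rewrite OmegaE mlext_letters; last exact: partition_summand_kill0.
rewrite /partition_summand.
pose x0 : L := Letter (homog0 H 0); pose n := size (vec t).
pose x (i : 'I_n) := nth x0 t i.
have szn : size t = n by rewrite /n size_map.
have tE : t = map x (enum 'I_n).
  rewrite -[in LHS](mkseq_nth x0 t) /mkseq szn.
  by rewrite -val_enum_ord -map_comp.
rewrite [in RHS]szn.
transitivity (ps p (map x (enum 'I_n)) (fun bl => if size bl == 1%N then 0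
  else nhbar (n - size bl) (sprod Ph bl))); last by rewrite -tE.
rewrite ps_map enumT -enum_setT.
have -> : p \o x = oddz \o (fun i : 'I_n => nth 0 (map deg t) i).
  apply/funext => i /=; rewrite (nth_map x0) //.
  by rewrite szn.
rewrite ps_enum big_mkcondr; apply: eq_bigr => P partP.
rewrite (size_map (map x)) size_blocks; case: eqP => _ /=; first by rewrite sg0.
rewrite sgZ nhbar_sg; congr (sg _ (nhbar _ _)).
rewrite /sprod [RHS]big_map; apply: eq_bigr => B _.
rewrite /entries -!map_comp; congr (phi _); apply: eq_map => i /=.
by rewrite (nth_map x0) // szn.
Qed.

(* With theta = (- hbar)^(n-1) phi_n, the exponential of theta is the sum over
   all partitions, so that it differs from Omega by the one-block term. *)
Definition thb (t : seq L) : series C := nhbar (size t).-1 (phi (vec t)).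
Definition thb_lt n (t : seq L) : series C := if (size t < n)%N then thb t else 0.

Lemma sprod_thb bl : all (fun b : seq L => size b != 0)%N bl ->
  sprod thb bl = nhbar (size (flatten bl) - size bl) (sprod Ph bl).
Proof. by move=> bl0; rewrite sprod_nhbar -sum_pred_size // addnK. Qed.

Lemma sprod_eq (T : Type) (a : pred T) (F G : T -> series C) bl :
  all a bl -> (forall b, a b -> F b = G b) -> sprod F bl = sprod G bl.
Proof.
move=> abl eqFG; elim: bl abl => [|b bl IHbl] /=; first by rewrite !sprod_nil.
by case/andP=> ab /IHbl E; rewrite !sprod_cons E eqFG.
Qed.

(** Only the one-block partition has a block as long as t, so truncating theta removes exactly that
    partition. Omega is thus the exponential of a family that involves phi in lower arities only, as
    inductions on the arity require. *)
Lemma Omega_pexp (t : seq L) : (1 < size t)%N ->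
  Omega (vec t) = pexp deg (thb_lt (size t)) t.
Proof.
move=> t_gt1; rewrite Omega_letters; apply: eq_ps => bl szbl _ bl0.
case: eqP => [|nsz].
  case: bl szbl bl0 => [|b [|//]] //= szb _ _.
  by rewrite sprod_cons /thb_lt -szb cats0 ltnn smul0l.
rewrite -[in LHS]szbl -sprod_thb //.
apply: (@sprod_eq _ (fun b : seq L => size b < size t)%N) => [|b lt_b]; last by rewrite /thb_lt lt_b.
apply/(all_nthP [::]) => i lt_i; have := size_nth_flatten lt_i bl0.
by rewrite szbl; move: lt_i nsz; lia.
Qed.

Lemma ps_single_block (V : zmodType) (t : seq L) (G : seq (seq L) -> V) : t <> [::] ->
  ps p t (fun bl => if size bl == 1%N then G bl else 0) = G [:: t].
Proof.
case/lastP: t => [//|t x] _; rewrite ps_rcons sh_rightE => [|A B szAB A0].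
  by rewrite /ps.
apply: ps_eq0 => bl szbl _ _; rewrite size_rcons eqSS ifN //.
by case: bl szbl => // /esym/eqP; rewrite (negPf A0).
Qed.

Local Notation Z := (pexp deg thb).

Lemma pexp_Omega (t : seq L) : (1 < size t)%N -> Z t = Omega (vec t) + thb t.
Proof.
move=> t_gt1; rewrite -[thb t](smul1r) -[smul _ _]/(smul (thb t) (sconst 1)) -(@sprod_nil k C _ thb) -sprod_cons.
rewrite -(@ps_single_block _ t (sprod thb)); last by case: t t_gt1.
rewrite Omega_letters -psD; apply: eq_ps => bl szbl _ bl0.
by case: eqP => _; rewrite ?add0r ?addr0 // -szbl sprod_thb.
Qed.

Lemma phi_homog (t : seq L) : shomog (degl deg t) (phi (vec t)).
Proof.
elim: {t}_.+1 {-2}t (ltnSn (size t)) => // n IHn t; rewrite ltnS => le_tn.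
case: t le_tn => [_|x [_|y t]] => [r|r|le_tn]; first exact: homog0.
  by rewrite degl_cons degl_nil; apply: fbar_degree; exact: letterP.
rewrite phiE ?size_map //; apply: (shomog_sg true); apply: iter_nb_homog.
rewrite Omega_pexp //; apply: pexp_homog => u; rewrite /thb_lt.
case: ifP => [lt_u|_]; last exact: shomog0.
by apply/shomog_nhbar/IHn; exact: leq_trans lt_u le_tn.
Qed.

Lemma thb_homog t : shomog (degl deg t) (thb t).
Proof. exact/shomog_nhbar/phi_homog. Qed.

Lemma thb_lt_homog n t : shomog (degl deg t) (thb_lt n t).
Proof. by rewrite /thb_lt; case: ifP => _; [exact: thb_homog | exact: shomog0]. Qed.

Lemma thb_hdvd t : hdvd (size t).-1 (thb t).
Proof. exact: hdvd_nhbar. Qed.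

(** Symmetry passes from phi in lower arities to Omega by [pexp_swap], and on to phi because nabla
    is linear and acts on values. *)
Lemma phi_swap (t1 t2 : seq L) x y :
  phi (vec (t1 ++ x :: y :: t2)) = sg (p x && p y) (phi (vec (t1 ++ y :: x :: t2))).
Proof.
elim: {t1 t2}_.+1 {-2}t1 {-2}t2 (ltnSn (size t1 + size t2)%N) => // n IHn t1 t2.
rewrite ltnS => le_n.
rewrite !phiE ?size_map ?size_cat /= ?addnS // sgN -iter_nb_sg; congr (- iter _ nb _).
rewrite !Omega_pexp ?size_cat /= ?addnS //.
rewrite pexp_swap // => [u|A1 A2]; first exact: thb_lt_homog.
rewrite /thb_lt !size_cat /=; case: ifP => [lt_A|_]; last by rewrite sg0.
rewrite /thb !size_cat /= IHn ?nhbar_sg //.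
by apply: leq_trans le_n; move: lt_A; lia.
Qed.

Lemma phi_slot (t1 t2 : seq L) x y z a : deg x = deg z -> deg y = deg z ->
  lvec z = lvec x + a *: lvec y ->
  phi (vec (t1 ++ z :: t2)) = phi (vec (t1 ++ x :: t2)) + a *: phi (vec (t1 ++ y :: t2)).
Proof.
move=> dx dy zE.
elim: {t1 t2}_.+1 {-2}t1 {-2}t2 (ltnSn (size t1 + size t2)%N) => // n IHn t1 t2.
rewrite ltnS => le_n.
have [le1|gt1] := leqP (size t1 + size t2) 0.
  case: t1 t2 le1 {le_n} => // -[] //= _; apply/funext => r.
  rewrite -[LHS]/(fb r (lvec z)) zE addrC fbar_linear.
  by rewrite -[RHS]/(fb r (lvec x) + a *: fb r (lvec y)) addrC.
have szt u : (1 < size (t1 ++ u :: t2))%N by rewrite size_cat /= addnS ltnS.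
rewrite !phiE ?size_map // !size_cat /= scalerN -opprD -iter_nbZ -iter_nbD; congr (- iter _ nb _).
rewrite !Omega_pexp // !size_cat /=.
apply: (@pexp_slot _ _ _ _ _ _ _ _ _ _ (fun u => a *: u)) => //.
- by move=> *; exact: scalerDr.
- by move=> *; rewrite smulZl.
- by move=> *; rewrite smulZr.
move=> A1 A2; rewrite /thb_lt !size_cat /=; case: ifP => [lt_A|_]; last by rewrite scaler0 addr0.
rewrite /thb !size_cat /= IHn ?nhbarD ?nhbarZ //.
by apply: leq_trans le_n; move: lt_A; lia.
Qed.

Lemma Omega_swap (t1 t2 : seq L) x y :
  Omega (vec (t1 ++ x :: y :: t2)) = sg (p x && p y) (Omega (vec (t1 ++ y :: x :: t2))).
Proof.
rewrite !Omega_pexp ?size_cat /= ?addnS // pexp_swap // => [u|A1 A2]; first exact: thb_lt_homog.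
rewrite /thb_lt !size_cat /=; case: ifP => [lt_A|_]; last by rewrite sg0.
by rewrite /thb !size_cat /= phi_swap nhbar_sg.
Qed.

Lemma Omega_slot (t1 t2 : seq L) x y z a : (0 < size t1 + size t2)%N ->
  deg x = deg z -> deg y = deg z -> lvec z = lvec x + a *: lvec y ->
  Omega (vec (t1 ++ z :: t2)) = Omega (vec (t1 ++ x :: t2)) + a *: Omega (vec (t1 ++ y :: t2)).
Proof.
move=> gt0 dx dy zE; rewrite !Omega_pexp ?size_cat /= ?addnS //.
apply: (@pexp_slot _ _ _ _ _ _ _ _ _ _ (fun u => a *: u)) => //.
- by move=> *; exact: scalerDr.
- by move=> *; rewrite smulZl.
- by move=> *; rewrite smulZr.
move=> A1 A2; rewrite /thb_lt !size_cat /=; case: ifP => [lt_A|_]; last by rewrite scaler0 addr0.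
by rewrite /thb !size_cat /= (phi_slot _ _ dx dy zE) nhbarD nhbarZ.
Qed.

Lemma Omega_homog (t : seq L) : (1 < size t)%N -> shomog (degl deg t) (Omega (vec t)).
Proof. by move=> t_gt1; rewrite Omega_pexp //; exact/pexp_homog/thb_lt_homog. Qed.

Lemma sym_hom_Omega (W : gradModType k) n (l : series C -> W) : (1 < n)%N ->
  (forall w1 w2, l (w1 + w2) = l w1 + l w2) -> (forall a w, l (a *: w) = a *: l w) ->
  (forall i w, shomog i w -> homog i (l w)) -> sym_hom n 0 (fun vs => l (Omega vs)).
Proof.
move=> n_gt1 lD lZ lh; apply: sym_hom_of_letters.
- move=> s1 v s2 sz; rewrite (Omega_split v sz).
  by apply: (big_morph l) => //; exact: morph_0.
- move=> t1 t2 x y z a sz dx dy zE; rewrite (Omega_slot _ dx dy zE) ?lD ?lZ //.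
  by move: n_gt1; rewrite -sz; lia.
- by move=> t1 t2 x y sz; rewrite Omega_swap (morph_sg _ _ lD).
- by move=> t szt; rewrite addr0; apply/lh/Omega_homog; rewrite szt.
Qed.

Let br_hdvd := binary_kbr_hdvd K_qft.
Local Notation Zbr := (pexp_br thb_homog K).
Local Notation Zbrl := (pexp_brl thb_homog K).

(** Both claims go together: the second one in lower arities reduces K Z t to [Zbr t], whose
    divisibility by hbar^(n-1) is the one binarity provides. *)
Lemma K_pexp_thb (t : seq L) : KK (Z t) = 0 /\ Zbr t = 0.
Proof.
elim: {t}_.+1 {-2}t (ltnSn (size t)) => // n IHn t; rewrite ltnS => le_tn.
have E : KK (Z t) = Zbr t.
  rewrite (K_pexp thb_homog) sh_leftE ?pexp_nil ?smul1r // => A B szAB B0.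
  by rewrite (IHn A _).2 ?smul0l //; move: B0; lia.
suff K0 : KK (Z t) = 0 by rewrite -E.
have K1 : KK (sconst 1) = 0.
  by rewrite sapp_sconst //; apply/funext => r; exact: bqft_unit.
case: t E le_tn => [|x [|y t]] E le_tn; first by rewrite pexp_nil K1.
  rewrite -[[:: x]]/(rcons [::] x) pexp_rcons /= pexp_nil smul1l /thb nhbar0 phi1.
  exact: K_fbar.
set u := [:: x, y & t] in E le_tn *; have u_gt1 : (1 < size u)%N by [].
have dvd : hdvd (size u).-1 (KK (Omega (vec u))).
  rewrite -(addrK (thb u) (Omega _)) -pexp_Omega // KKD KKN E.
  apply: hdvdB; first exact: (pexp_br_hdvd thb_homog br_hdvd thb_hdvd).
  by apply: hdvd_sapp => //; exact: thb_hdvd.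
have /hdvdP[y' KOm] := dvd.
have := @K_iter_nb (size u).-1 0 _ y'; rewrite addn0 nhbar0 => /(_ _ KOm) Kit.
by rewrite pexp_Omega // KKD KOm /thb KK_nhbar phiE ?size_map // KKN Kit nhbarN subrr.
Qed.

Lemma K_Omega (t : seq L) : exists y, KK (Omega (vec t)) = nhbar (size t).-1 y.
Proof.
case: (ltnP 1 (size t)) => [t_gt1|t_le1]; last first.
  exists (KK (Omega (vec t))); rewrite (_ : (size t).-1 = 0%N) ?nhbar0 //; lia.
apply/hdvdP; rewrite -(addrK (thb t) (Omega _)) -pexp_Omega // KKD KKN (K_pexp_thb t).1 sub0r.
by apply: (hdvd_sg true); apply: hdvd_sapp => //; exact: thb_hdvd.
Qed.

Local Notation cpi := (canonical_pi K f h s).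

Lemma canonical_piE vs : (1 < size vs)%N -> cpi vs = hpart (size vs).-1 (Omega vs).
Proof. by case: vs => [|v [|u vs]]. Qed.

Definition xpart (t : seq L) : series C := spart (size t).-1 (Omega (vec t)).

(** The remainder of the homotopy expansion of Omega is cancelled by the one-block term of Z. On the
    empty list Z is 1 while [canonical_pi] is 0 by convention. *)
Lemma pexp_pi (t : seq L) : t <> [::] -> Z t = FF (cpi (vec t)) + KK (xpart t).
Proof.
move=> t0; case: (ltnP 1 (size t)) => [t_gt1|]; last first.
  case: t t0 => [//|x [|//]] _ _; rewrite /xpart /spart big_nil KK0 addr0.
  rewrite -[in LHS](cat0s [:: x]) cats1 pexp_rcons /= pexp_nil smul1l /thb nhbar0 phi1.
  by rewrite sapp_sconst //; exact: fbarD.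
have [y KOm] := K_Omega t.
rewrite pexp_Omega // {1}(homotopy_expansion KOm) canonical_piE ?size_map // /thb.
by rewrite phiE ?size_map // nhbarN addrK.
Qed.

Lemma sym_hom_ext (V W : gradModType k) n j (F G : seq V -> W) :
  (forall vs, size vs = n -> F vs = G vs) -> sym_hom n j F -> sym_hom n j G.
Proof.
move=> eqFG [lin sw dg]; split=> [s1 s2 a x y sz|s1 s2 i1 i2 x y sz hx hy|d v hv].
- by rewrite -!eqFG ?size_cat /= ?addnS //; exact: lin.
- by rewrite -!eqFG ?size_cat /= ?addnS //; exact: sw.
- by rewrite -eqFG ?size_tuple //; exact: dg.
Qed.

Lemma hpart_D n w1 w2 : hpart n (w1 + w2) = hpart n w1 + hpart n w2.
Proof.
rewrite /hpart -big_split; apply: eq_bigr => i _ /=.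
by rewrite iter_nbD !fctE linearD sconstD nhbarD.
Qed.

Lemma hpartZ n a w : hpart n (a *: w) = a *: hpart n w.
Proof.
rewrite /hpart scaler_sumr; apply: eq_bigr => i _ /=.
rewrite iter_nbZ -nhbarZ; congr (nhbar i _).
by apply/funext => -[|r]; rewrite /sconst !fctE /= ?linearZ ?scaler0.
Qed.

Lemma hpart_homog n i w : shomog i w -> shomog i (hpart n w).
Proof.
move=> hw; rewrite /hpart; elim/big_ind: _ => [|u v|l _]; [exact: shomog0 | exact: shomogD |].
apply/shomog_nhbar/shomog_sconst; rewrite -[i]addr0; apply: (ret_h_degree fhs_ret).
exact: iter_nb_homog.
Qed.

Lemma sym_hom_pi n r : (0 < n)%N -> sym_hom n 0 (fun vs => cpi vs r).
Proof.
case: n => [//|[|n]] _.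
  split=> [s1 s2 a x y|s1 s2 i1 i2 x y|d v hv].
  - case: s1 s2 => [|? ?] [|? ?] //= _; case: r => [|r]; rewrite /sconst //=.
    by rewrite scaler0 addr0.
  - by case: s1.
  - rewrite big_ord1 addr0; case/tupleP: v hv => x v /(_ ord0); rewrite tnth0 tuple0.
    by move=> hx; exact: shomog_sconst.
apply: (@sym_hom_ext _ _ n.+2 0 (fun vs => hpart n.+1 (Omega vs) r)) => [vs sz|].
  by rewrite canonical_piE sz.
apply: (@sym_hom_Omega _ _ (fun w => hpart n.+1 w r)) => // [w1 w2|a w|i w hw].
- by rewrite hpart_D.
- by rewrite hpartZ.
- exact: hpart_homog.
Qed.

(** * The recursive formula *)

(* pi_n has degree n - 2 in hbar, while in the recursive formula for pi_n every
   term but m_n has a lower degree: hence m_n is the top coefficient of pi_n. *)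
Definition mprod (vs : seq H) : H := h (iter (size vs).-2 nb (Omega vs) 0%N).

Lemma sym_hom_mprod n : (1 < n)%N -> sym_hom n 0 mprod.
Proof.
move=> n_gt1; apply: (@sym_hom_ext _ _ n 0 (fun vs => h (iter n.-2 nb (Omega vs) 0%N))).
  by move=> vs <-.
apply: (@sym_hom_Omega _ _ (fun w => h (iter n.-2 nb w 0%N))) => // [w1 w2|a w|i w hw].
- by rewrite iter_nbD !fctE linearD.
- by rewrite iter_nbZ !fctE linearZ.
- by rewrite -[i]addr0; apply: (ret_h_degree fhs_ret); exact: iter_nb_homog.
Qed.

Lemma mprod_homog (t : seq L) : (1 < size t)%N -> homog (degl deg t) (mprod (vec t)).
Proof. by move=> /sym_hom_mprod/sym_hom_letters/(_ erefl); rewrite addr0. Qed.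

Fact mlet_subproof t a b : homog (degl deg (t ++ [:: a; b])) (mprod (vec (t ++ [:: a; b]))).
Proof. by apply: mprod_homog; rewrite size_cat addn2. Qed.

Definition mlet t a b : L := Letter (mlet_subproof t a b).

Local Notation pil := (fun t : seq L => cpi (vec t)).

(* H[[hbar]] is a saturated submodule of C[[hbar]] modulo the image of K. *)
Lemma division n y a b : hdvd n y -> y = FF a + KK b -> exists a' b' y',
  [/\ a = nhbar n a', y = nhbar n y' & y' = FF a' + KK b'].
Proof.
elim: n y a b => [|n IHn] y a b n_y yE.
  by exists a, b, y; rewrite !nhbar0.
have y0 : f (a 0%N) + K 0%N (b 0%N) = 0.
  have := n_y 0%N isT; rewrite yE fctE /sapp !big_ord1 /= fbar0 => E.
  by [].
have a0 : a 0%N = 0.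
  have := congr1 h y0; rewrite linearD /= (ret_hf fhs_ret) (ret_hK fhs_ret) linear0 addr0.
  by [].
have Kb0 : K 0%N (b 0%N) = 0 by rewrite -y0 a0 linear0 add0r.
(* Terms killed by K are subtracted so that the constant term of b becomes s K b, which is 0. *)
pose b1 := b - FF (sconst (h (b 0%N))) - KK (sconst (s (b 0%N))).
have b10 : b1 0%N = 0.
  rewrite /b1 !fctE /sapp !big_ord1 /sconst /= fbar0 (ret_fh fhs_ret) Kb0 linear0 subr0.
  by rewrite opprB addrCA subrr addr0 subrr.
have [a1 aE] : exists a1, a = nhbar 1 a1 by apply/hdvdP => -[].
have [b2 bE] : exists b2, b1 = nhbar 1 b2 by apply/hdvdP => -[].
have [y1 y1E] : exists y1, y = nhbar 1 y1.
  by apply/hdvdP; apply: hdvdW n_y.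
have y1E' : y1 = FF a1 + KK b2.
  apply: (@nhbar_inj _ _ 1); rewrite -y1E nhbarD -FF_nhbar -KK_nhbar -aE -bE yE /b1.
  by rewrite !KKD !KKN K_FF KK_KK !oppr0 !addr0.
have n_y1 : hdvd n y1.
  move=> r lt_r; have := n_y r.+1 lt_r; rewrite y1E nhbar1S => /eqP.
  by rewrite oppr_eq0 => /eqP.
have [a' [b' [y' [a'E y'E E]]]] := IHn y1 a1 b2 n_y1 y1E'.
exists a', b', y'; split=> //; first by rewrite aE a'E nhbarM add1n.
by rewrite y1E y'E nhbarM add1n.
Qed.

(** A primitive can be replaced by its component of the right degree, since K is homogeneous. *)
Lemma KK_hcomp w y i : KK w = y -> shomog (i + 1) y ->
  exists2 w', shomog i w' & KK w' = y.
Proof.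
move=> Kw hy; exists (fun r => hcomp i (w r)); first by move=> r; exact: homog_hcomp.
rewrite -Kw; apply/funext => r; rewrite -[RHS](eqP (_ : homog (i + 1) (KK w r))); last by rewrite Kw.
rewrite [in RHS]/sapp (big_morph _ (hcompD (i + 1)) (hcomp0 _ _)); apply: eq_bigr => l _.
by rewrite (of_degree_hcomp (KD l) (K_degree l)).
Qed.

Lemma hpart_ge n w r : (n <= r)%N -> hpart n w r = 0.
Proof.
move=> le_nr; rewrite /hpart; have evD (u v : series H) : (u + v) r = u r + v r by [].
rewrite (big_morph (fun u : series H => u r) evD (erefl _)) big_nat big1 //.
move=> i /andP[_ lt_in]; rewrite /nhbar /sconst ifT; last by apply: ltnW; exact: leq_trans le_nr.
by rewrite ifF ?scaler0 // subn_eq0 leqNgt (leq_trans lt_in).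
Qed.

Lemma hpartS_ge n w r : (n <= r)%N ->
  hpart n.+1 w r = nhbar n (sconst (h (iter n nb w 0%N))) r.
Proof. by move=> le_nr; rewrite /hpart big_nat_recr //= fctE -/(hpart n w) hpart_ge // add0r. Qed.

Lemma sletter_eq (x y : sletter C) : sdeg x = sdeg y -> svec x = svec y -> x = y.
Proof.
case: x y => [d w wh] [d' w' wh'] /= dE wE; subst d' w'; congr SLetter; exact: Prop_irrelevance.
Qed.

Lemma pexp_brl_nil l : Zbrl l [::] = KK (svec l).
Proof.
have K1 : KK (sconst 1) = 0.
  by rewrite sapp_sconst //; apply/funext => r; exact: bqft_unit.
rewrite -[RHS]addr0 -[X in _ + X](sg0 _ (oddz (sdeg l))) -(smul0r (svec l)) -K1.
have := @K_letter_pexp _ _ _ _ _ thb_homog _ K_degree l [::].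
rewrite pexp_nil K1 smul0r sg0 add0r smul1r /= pexp_nil smul1r => ->.
by rewrite addr0.
Qed.

Section Recursion.
Variables a b : L.
Let e := p a (+) p b.
Let dab := deg a + deg b.

(** [Zm] and [Ym] are the right-hand side of the recursive formula with pi replaced by Z and by
    theta; [gap] is the cofactor of Z in Z(t, a, b) - Zm t, and [pi_gap] the defect of the formula
    itself. *)
Let Zm t := sh p t (fun A B => nhbar (size B) (Z (rcons A (mlet B a b)))).
Let Ym t := sh p t (fun A B => nhbar (size B) (thb (rcons A (mlet B a b)))).
Let gap t := pexp2 deg thb a b t - Ym t.
Let pi_gap t := pil (t ++ [:: a; b])
  - sh p t (fun A B => nhbar (size B) (pil (rcons A (mlet B a b)))).

Lemma pexp_m t : Zm t = sh p t (fun A B => smul (Z A) (Ym B)).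
Proof.
transitivity (sh p t (fun A B => sh p A (fun A1 A2 =>
    nhbar (size B) (smul (Z A1) (thb (rcons A2 (mlet B a b))))))).
  apply: sh_ext => A B; rewrite pexp_rcons (sh_morph _ _ _ (nhbarD _)).
  exact: sh_ext.
rewrite sh_assoc; apply: sh_ext => A B.
rewrite (@sh_morph _ _ _ _ (fun v => smul (Z A) v)) => [|*]; last exact: smulDr.
by apply: sh_ext => B1 B2; rewrite [RHS]smul_nhbarr.
Qed.

Lemma gap_homog t : shomog (degl deg t + dab) (gap t).
Proof.
have th2 A B : degl deg A + degl deg B = degl deg t ->
    degl deg (rcons A a) + degl deg (rcons B b) = degl deg t + dab.
  by move=> <-; rewrite !degl_rcons addrACA.
apply: shomogB; [apply: shomogD|].
- have := thb_homog (t ++ [:: a; b]).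
  by rewrite degl_cat !degl_cons degl_nil addr0.
- apply: shomog_sh => A B dAB; apply: shomog_sg; rewrite -(th2 _ _ dAB).
  by apply: shomog_smul; exact: thb_homog.
apply: shomog_sh => A B dAB; apply: shomog_nhbar.
have := thb_homog (rcons A (mlet B a b)).
by rewrite degl_rcons /= degl_cat !degl_cons degl_nil addr0 addrA dAB.
Qed.

(** With n the size of t, a common block of a and b carries hbar^(n+1); two blocks carry hbar^|A|
    and hbar^|B| with |A| + |B| = n, and so do the terms with m. *)
Lemma gap_hdvd t : hdvd (size t) (gap t).
Proof.
apply: hdvdB; [apply: hdvdD|].
- by apply: hdvdW (@thb_hdvd _); rewrite size_cat addn2 /=.
- apply: hdvd_sh => A B <-; apply: hdvd_sg.
  by apply: hdvdW (hdvd_smul (@thb_hdvd _) (@thb_hdvd _)); rewrite !size_rcons.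
apply: hdvd_sh => A B <-; rewrite /thb nhbarM.
by apply: hdvdW (@hdvd_nhbar _ _ _ _); rewrite size_rcons addnC.
Qed.

(** The gap is moved to the left of Z, where [K_letter_pexp] puts Lam; the sign of this move is
    distributed between the whole of t and the part A. *)
Lemma pexp_gap t : sg (par p t && e) (Z (t ++ [:: a; b]) - Zm t) =
  sh p t (fun A B => smul (sg (par p A && e) (gap A)) (Z B)).
Proof.
have -> : Z (t ++ [:: a; b]) - Zm t = sh p t (fun A B => smul (Z A) (gap B)).
  rewrite pexp_cats2 pexp_m -shB; apply: sh_ext => A B.
  by rewrite [RHS]smulDr (smul_sgr true).
rewrite sh_comm -sh_sg; apply: eq_sh => A B _ <-.
rewrite (smulC (pexp_homog thb_homog B) (gap_homog A)) -!/(oddz _) oddzD !oddz_degl oddzD.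
rewrite -/(p a) -/(p b) -/e smul_sgl.
by move: e (par p A) (par p B) => u c d; sgb.
Qed.

(* Lam is to satisfy [sg _ (Z (t ++ [:: a; b]) - Zm t) = KK (Lam * Z) t]; its
   failure to do so is [lam_err * Z]. *)
Section Step.
Variable Lam : seq L -> series C.
Hypothesis Lam_homog : forall t, shomog (degl deg t + dab - 1) (Lam t).
Definition lam_br t := sh p t (fun A B => Zbrl (SLetter (Lam_homog A)) B).
Definition lam_err t := sg (par p t && e) (gap t) - lam_br t.

(** As K Z = 0, only the brackets that contain Lam survive in [K_letter_pexp]. *)
Lemma K_Lam t : KK (sh p t (fun A B => smul (Lam A) (Z B))) = sh p t (fun A B => smul (lam_br A) (Z B)).
Proof.
rewrite (sh_morph _ _ _ KKD).
transitivity (sh p t (fun A B => sh p B (fun B1 B2 =>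
    smul (Zbrl (SLetter (Lam_homog A)) B1) (Z B2)))).
  apply: sh_ext => A B.
  rewrite (@K_letter_pexp _ _ _ _ _ thb_homog _ K_degree (SLetter (Lam_homog A)) B).
  by rewrite (K_pexp_thb B).1 smul0r sg0 add0r.
rewrite -sh_assoc; apply: sh_ext => A B.
by rewrite (@sh_morph _ _ _ _ (fun v => smul v (Z B))) => [|*] //; exact: smulDl.
Qed.

Lemma lam_err_sum t : sg (par p t && e) (Z (t ++ [:: a; b]) - Zm t)
  - KK (sh p t (fun A B => smul (Lam A) (Z B))) = sh p t (fun A B => smul (lam_err A) (Z B)).
Proof.
rewrite pexp_gap K_Lam -shB; apply: sh_ext => A B.
by rewrite [RHS]smulDl (smul_sgl true).
Qed.

Hypothesis Lam_hdvd : forall t, hdvd (size t) (Lam t).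

Lemma lam_err_hdvd t : hdvd (size t) (lam_err t).
Proof.
apply: hdvdB; first by apply: hdvd_sg; exact: gap_hdvd.
apply: hdvd_sh => A B <-; exact: (pexp_brl_hdvd thb_homog br_hdvd thb_hdvd).
Qed.

Lemma lam_err_homog t : shomog (degl deg t + dab) (lam_err t).
Proof.
apply: shomogB; first exact/shomog_sg/gap_homog.
apply: shomog_sh => A B dAB; apply: shomog_ps => bl dbl.
have := kbr_homog (@sletterP k C) K_degree (SLetter (Lam_homog A) :: map (thl thb_homog) bl).
have -> : degl (@sdeg k C) (SLetter (Lam_homog A) :: map (thl thb_homog) bl)
    = degl deg A + dab - 1 + degl deg (flatten bl).
  by rewrite degl_cons -degl_flatten {2}/degl big_map.
by congr (shomog _ _); rewrite -dAB -dbl; lia.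
Qed.

(** With n the size of t, pi(t, a, b) has order at most n in hbar, with top term (- hbar)^n m(t, a,
    b). This is the term with A empty on the right; the others have order below |B| + |A| = n. *)
Lemma pi_gap_ge t r : (size t <= r)%N -> pi_gap t r = 0.
Proof.
move=> le_tr; rewrite /pi_gap fctE.
have evD (u v : series H) : (u + v) r = u r + v r by [].
rewrite canonical_piE ?size_map ?size_cat ?addn2 //= hpartS_ge //.
have evN (u : series H) : (- u) r = - u r by [].
rewrite evN (sh_morph _ _ _ evD) sh_rightE => [|A B szAB A0].
  by rewrite /nhbar le_tr /= /mprod size_map size_cat addn2 subrr.
rewrite /nhbar; case: leqP => // le_Br; rewrite canonical_piE ?size_map ?size_rcons ?ltnS ?lt0n //.
by rewrite hpart_ge ?scaler0 //=; move: le_tr; rewrite -szAB; lia.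
Qed.

(* In size n, the first nonzero error is divisible by hbar^n and cohomologous to
   pi_gap, which has degree < n in hbar; so pi_gap = 0, and the error is exact
   and can be absorbed in Lam. *)
Lemma recursion_step t : (forall A, (size A < size t)%N -> lam_err A = 0) ->
  pi_gap t = 0 /\ exists w, [/\ shomog (degl deg t + dab - 1) w, hdvd (size t) w & KK w = lam_err t].
Proof.
move=> E0.
have EE : lam_err t = FF (sg (par p t && e) (pi_gap t)) + KK
   (sg (par p t && e) (xpart (t ++ [:: a; b])
      - sh p t (fun A B => nhbar (size B) (xpart (rcons A (mlet B a b)))))
    - sh p t (fun A B => smul (Lam A) (Z B))).
  transitivity (sh p t (fun A B => smul (lam_err A) (Z B))).
    rewrite sh_leftE ?pexp_nil ?smul1r // => A B szAB B0.
    by rewrite E0 ?smul0l // -szAB -[ltnLHS]addn0 ltn_add2l lt0n.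
  rewrite -lam_err_sum KKD KKN KK_sg FF_sg addrA; congr (_ - _); rewrite -sgD; congr (sg _ _).
  rewrite pexp_pi; last by case: (t).
  rewrite /Zm /pi_gap FFD FFN KKD KKN (sh_morph _ _ _ FFD) (sh_morph _ _ _ KKD).
  rewrite addrACA -opprD -shD; congr (_ - _); apply: sh_ext => A B.
  by rewrite pexp_pi ?nhbarD ?FF_nhbar ?KK_nhbar //; case: (A).
have [a' [b' [y' [aE yE y'E]]]] := division (lam_err_hdvd (t := t)) EE.
(* The defect is divisible by hbar^n, yet has no coefficient of order n or more. *)
have gap0 : sg (par p t && e) (pi_gap t) = 0.
  apply/funext => r; case: (ltnP r (size t)) => [lt_r|le_r].
    by rewrite aE /nhbar leqNgt lt_r.
  have evD (u v : series H) : (u + v) r = u r + v r by [].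
  by rewrite (morph_sg _ _ evD) pi_gap_ge // sg0.
split.
  by have := congr1 (sg (par p t && e)) gap0; rewrite sgsg addbb sg0.
have a'0 : a' = 0 by apply: (@nhbar_inj _ _ (size t)); rewrite -aE gap0 nhbar_0.
have y'h : shomog (degl deg t + dab - 1 + 1) y'.
  rewrite subrK => r; have := @lam_err_homog t (size t + r)%N.
  rewrite yE /nhbar leq_addr addKn sgZ; case: (odd _) => //= /homogN.
  by rewrite opprK.
move: y'E; rewrite a'0 FF0 add0r => /esym Kb'.
have [w wh Kw] := KK_hcomp Kb' y'h.
exists (nhbar (size t) w); split; [exact: shomog_nhbar | exact: hdvd_nhbar |].
by rewrite KK_nhbar Kw.
Qed.

End Step.

(** Each step corrects Lam in arity n only, so the errors already removed stay zero. Homogeneity is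
    part of the data because the twisted operator takes a homogeneous letter. *)
Lemma recursion_induction n : exists Lam : seq L -> series C,
  exists Lam_homog : forall t, shomog (degl deg t + dab - 1) (Lam t),
  (forall t, hdvd (size t) (Lam t)) /\
  (forall t, (size t < n)%N -> lam_err Lam_homog t = 0).
Proof.
elim: n => [|n [Lam [Lam_homog [Lam_hdvd Lam_err]]]].
  by exists (fun=> 0), (fun=> shomog0 _ _); split=> // t; exact: hdvd_0.
have step t : exists w, [/\ shomog (degl deg t + dab - 1) w, hdvd (size t) w &
    size t = n -> KK w = lam_err Lam_homog t].
  case: (size t =P n) => [szt|]; last by exists 0; split=> //; exact: shomog0.
  have [|_ [w [wh wd wE]]] := @recursion_step Lam Lam_homog Lam_hdvd t.
    by move=> A; rewrite szt; exact: Lam_err.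
  by exists w; split.
have [w wP] := choice step.
pose Lam' t := if size t == n then Lam t + w t else Lam t.
have Lam'_homog t : shomog (degl deg t + dab - 1) (Lam' t).
  by rewrite /Lam'; case: ifP => _ //; apply: shomogD => //; case: (wP t).
exists Lam', Lam'_homog; split=> t.
  by rewrite /Lam'; case: ifP => _ //; apply: hdvdD => //; case: (wP t).
rewrite ltnS leq_eqVlt => /orP[/eqP szt|lt_tn]; last first.
  rewrite -[RHS](Lam_err t lt_tn) /lam_err; congr (_ - _); apply: eq_sh => A B szAB _.
  congr (Zbrl _ B); apply: sletter_eq => //=; rewrite /Lam' ifF //.
  by apply/eqP => szA; move: lt_tn; rewrite -szAB szA -[ltnRHS]addn0 ltn_add2l.
(* In arity n the correction is felt only in the term with B empty, where the twisted operator is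
   K. *)
suff -> : lam_err Lam'_homog t = lam_err Lam_homog t - KK (w t).
  by case: (wP t) => _ _ ->; rewrite ?subrr.
rewrite /lam_err -addrA -opprD; congr (_ - _).
have -> : KK (w t) = sh p t (fun A B => if size B == 0%N then KK (w A) else 0).
  by rewrite sh_leftE // => A B _ /negPf->.
rewrite -shD; apply: eq_sh => A B szAB _.
case: B szAB => [|y B] szAB.
  rewrite !pexp_brl_nil /= -KKD; congr KK.
  by rewrite /Lam' ifT //; move: szAB; rewrite addn0 szt => ->.
rewrite addr0; congr (Zbrl _ _); apply: sletter_eq => //=; rewrite /Lam' ifF //.
by apply/eqP => szA; move: szAB; rewrite szt szA /=; lia.
Qed.

Lemma pi_recursion t : pil (t ++ [:: a; b]) =
  sh p t (fun A B => nhbar (size B) (pil (rcons A (mlet B a b)))).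
Proof.
have [Lam [Lam_homog [Lam_hdvd Lam_err]]] := recursion_induction (size t).
by have [/eqP] := @recursion_step Lam Lam_homog Lam_hdvd t Lam_err; rewrite subr_eq0 => /eqP.
Qed.

End Recursion.

(** * Associativity and unity *)

Lemma pi_addl us x y : cpi (us ++ [:: x + y]) = cpi (us ++ [:: x]) + cpi (us ++ [:: y]).
Proof.
apply/funext => r; have := @sym_hom_pi (size us).+1 r isT.
move=> /sym_hom_linear/(_ us [::] 1 x y); rewrite !scale1r /= => ->; rewrite ?addn0 //.
Qed.

Lemma pi_last0 us : cpi (us ++ [:: 0]) = 0.
Proof. by apply: (@morph_0 _ _ (fun x => cpi (us ++ [:: x]))); exact: pi_addl. Qed.

Lemma letters_swap (W : gradModType k) n j (F : seq H -> W) (t1 t2 : seq L) x y :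
  sym_hom n j F -> (size t1 + size t2).+2 = n ->
  F (vec (t1 ++ x :: y :: t2)) = sg (p x && p y) (F (vec (t1 ++ y :: x :: t2))).
Proof.
move=> symF szn; rewrite !map_cat /= (sym_hom_sym symF _ (letterP x) (letterP y)) ?size_map //.
by rewrite sgZ abszM oddM.
Qed.

Lemma pi_swap (t1 t2 : seq L) x y :
  pil (t1 ++ x :: y :: t2) = sg (p x && p y) (pil (t1 ++ y :: x :: t2)).
Proof.
apply/funext => r; have evD (u v : series H) : (u + v) r = u r + v r by [].
rewrite (morph_sg _ _ evD).
exact: (letters_swap _ _ (@sym_hom_pi (size t1 + size t2).+2 r isT)).
Qed.

Lemma mprod_swap (t1 t2 : seq L) x y :
  mprod (vec (t1 ++ x :: y :: t2)) = sg (p x && p y) (mprod (vec (t1 ++ y :: x :: t2))).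
Proof. exact: (letters_swap _ _ (@sym_hom_mprod (size t1 + size t2).+2 isT)). Qed.

Section Associativity.

Definition assoc_right w1 w2 w3 t : H := sh p t (fun A B =>
  sg (par p B && p w1) (mprod (vec (A ++ [:: w1; mlet B w2 w3])))).
Definition assoc_left w1 w2 w3 t : H := sh p t (fun A B =>
  mprod (vec (A ++ [:: mlet B w1 w2; w3]))).

(** In the first application w1 either joins the m that contains w2 and w3, giving the second sum,
    or stays next to it, and the formula applies again to w1 and that m. *)
Lemma pi_recursion2 w1 w2 w3 t : pil (t ++ [:: w1; w2; w3]) =
  sh p t (fun A B => nhbar (size B) (cpi (vec A ++ [:: assoc_right w1 w2 w3 B])))
  + sh p t (fun A B => nhbar (size B).+1 (cpi (vec A ++ [:: mprod (vec (B ++ [:: w1; w2; w3]))]))).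
Proof.
have vec_rcons A x : vec (rcons A x) = vec A ++ [:: lvec x] by rewrite map_rcons cats1.
rewrite -cat_rcons pi_recursion sh_rcons addrC; congr (_ + _); last first.
  by apply: sh_ext => A B; rewrite vec_rcons size_rcons /= cat_rcons.
transitivity (sh p t (fun A B => sh p A (fun A1 A2 => sg (p w1 && par p B)
    (nhbar (size B + size A2) (cpi (vec A1 ++
      [:: mprod (vec (A2 ++ [:: w1; mlet B w2 w3]))])))))).
  apply: sh_ext => A B; rewrite -cats2 pi_recursion (sh_morph _ _ _ (nhbarD _)) -sh_sg.
  by apply: sh_ext => A1 A2; rewrite nhbarM vec_rcons.
rewrite sh_assoc; apply: sh_ext => A B.
rewrite (@sh_morph _ _ _ _ (fun x => nhbar (size B) (cpi (vec A ++ [:: x])))) => [|x y].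
  apply: eq_sh => B1 B2 szB _.
  rewrite (@morph_sg _ _ (fun x => nhbar (size B) (cpi (vec A ++ [:: x])))) => [|x y].
    by rewrite -szB addnC andbC.
  by rewrite pi_addl nhbarD.
by rewrite pi_addl nhbarD.
Qed.

Lemma assoc_right_rot w1 w2 w3 t :
  sg (p w3 && (p w1 (+) p w2)) (assoc_right w3 w1 w2 t) = assoc_left w1 w2 w3 t.
Proof.
rewrite -sh_sg; apply: sh_ext => A B; rewrite mprod_swap !sgsg.
rewrite [X in sg X _](_ : _ = false) //= degl_cat !degl_cons degl_nil addr0 !oddzD oddz_degl.
by case: (oddz (deg w1)); case: (oddz (deg w2)); case: (oddz (deg w3)); case: (par _ _).
Qed.

Lemma mprod_assoc w1 w2 w3 t : assoc_left w1 w2 w3 t = assoc_right w1 w2 w3 t.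
Proof.
apply/eqP; rewrite -subr_eq0; apply/eqP.
pose X t := assoc_left w1 w2 w3 t - assoc_right w1 w2 w3 t.
have sumX u : sh p u (fun A B => nhbar (size B) (cpi (vec A ++ [:: X B]))) = 0.
  have cB A x y : cpi (vec A ++ [:: x - y]) = cpi (vec A ++ [:: x]) - cpi (vec A ++ [:: y]).
    rewrite pi_addl; congr (_ + _).
    exact: (@morph_sg _ _ (fun x => cpi (vec A ++ [:: x])) true y (pi_addl _)).
  under sh_ext do rewrite cB nhbarB.
  rewrite shB; apply/eqP; rewrite subr_eq0; apply/eqP.
  have E1 := pi_recursion2 w1 w2 w3 u; have := pi_recursion2 w3 w1 w2 u.
  have -> : pil (u ++ [:: w3; w1; w2]) = sg (p w3 && (p w1 (+) p w2)) (pil (u ++ [:: w1; w2; w3])).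
    rewrite pi_swap -cat_rcons pi_swap cat_rcons sgsg; congr (sg _ _).
    by case: (p w3).
  move=> /(congr1 (sg (p w3 && (p w1 (+) p w2)))); rewrite sgsg addbb sgD /= E1 -!sh_sg.
  (* The terms in which w1, w2, w3 enter the same m agree by the symmetry of m, and cancel. *)
  have -> : sh p u (fun A B => sg (p w3 && (p w1 (+) p w2)) (nhbar (size B).+1
      (cpi (vec A ++ [:: mprod (vec (B ++ [:: w3; w1; w2]))])))) =
    sh p u (fun A B => nhbar (size B).+1 (cpi (vec A ++ [:: mprod (vec (B ++ [:: w1; w2; w3]))]))).
    apply: sh_ext => A B; rewrite -nhbar_sg; congr nhbar.
    rewrite -(@morph_sg _ _ (fun x => cpi (vec A ++ [:: x]))) => [|x y]; last exact: pi_addl.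
    rewrite mprod_swap -cat_rcons mprod_swap cat_rcons !sgsg.
    by rewrite [X in sg X _](_ : _ = false) //; case: (p w1); case: (p w2); case: (p w3).
  move=> /addIr ->; apply: sh_ext => A B; rewrite -nhbar_sg; congr nhbar.
  rewrite -(@morph_sg _ _ (fun x => cpi (vec A ++ [:: x]))) => [|x y]; last exact: pi_addl.
  by rewrite assoc_right_rot.
rewrite -/(X t); elim: {t}_.+1 {-2}t (ltnSn (size t)) => // n IHn t; rewrite ltnS => le_tn.
(* By induction only the term with A empty is left; as pi_1 is the identity, it is (- hbar)^n X t,
   with n the size of t. *)
have := sumX t; rewrite sh_rightE => [|A B szAB A0].
  move=> E; have := @nhbar_inj _ _ (size t) _ 0 (etrans E (esym (nhbar_0 _ _))).
  by move/(congr1 (fun w => w 0%N)).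
rewrite IHn ?pi_last0 ?nhbar_0 //; apply: leq_trans le_tn.
by rewrite -szAB -[ltnLHS]add0n ltn_add2r lt0n.
Qed.

End Associativity.

Section Unity.

Let one_homog : homog 0 (cl 1).
Proof. rewrite -(ret_h1 fhs_ret); exact: (ret_h_degree fhs_ret (homog_1)). Qed.
Let one : L := Letter one_homog.

(** K kills 1 in every order, so all corrections to f vanish on the unit. *)
Lemma fbar_one : (fun r => fb r (cl 1)) = sconst 1.
Proof.
apply/funext => n; elim: n {-2}n (leqnn n) => [|N IHN] [|n] le_nN //; try exact: (ret_f1 fhs_ret).
rewrite fbar_gterm big_nat big1 ?linear0 ?oppr0 // => j /andP[_ lt_j].
rewrite IHN; last by rewrite -ltnS (leq_trans lt_j).
by case: j {lt_j} => [|j]; rewrite /sconst /= ?linear0 // (bqft_unit K_qft).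
Qed.

(** Since nabla inverts multiplication by - hbar, the one-block term yields phi, which is minus the
    contribution of Omega. *)
Lemma iter_nb_pexp t : (1 < size t)%N -> iter (size t).-1 nb (Z t) = 0.
Proof.
move=> t_gt1; rewrite pexp_Omega // iter_nbD /thb -[X in nhbar X _]addn0 iter_nb_nhbar nhbar0.
by rewrite phiE ?size_map // addrN.
Qed.

Lemma nb_fbar x : nb (fun r => fb r x) = 0.
Proof.
apply: (@nhbar_inj _ _ 1); rewrite nbE nhbar_0 fbar0 (ret_hf fhs_ret) (ret_sf fhs_ret).
rewrite (ret_Kf fhs_ret) linear0 !sconst0 KK0 !subr0 sapp_sconst ?subrr //; exact: fbarD.
Qed.

Lemma pexp1 x : Z [:: x] = fun r => fb r (lvec x).
Proof. by rewrite -[[:: x]]/(rcons [::] x) pexp_rcons /= pexp_nil smul1l /thb nhbar0. Qed.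

(** By induction the unit contributes only as a singleton block, whose value is 1, or in the
    one-block term. Hence Omega(1, t) = Z t, and enough applications of nabla kill Z t, so that
    phi(1, t) = 0. *)
Lemma pexp_one t : Z (one :: t) = Z t /\ (t <> [::] -> phi (vec (one :: t)) = 0).
Proof.
elim: {t}_.+1 {-2}t (ltnSn (size t)) => // n IHn t; rewrite ltnS => le_tn.
case/lastP: t le_tn => [_|t y]; first by rewrite pexp1 fbar_one pexp_nil.
rewrite size_rcons => lt_tn.
have E : Z (one :: rcons t y) = Z (rcons t y) + thb (one :: rcons t y).
  rewrite -rcons_cons pexp_rcons /= pexp_rcons; congr (_ + _).
    apply: eq_sh => A B szAB _; rewrite (IHn A _).1 //.
    by apply: leq_ltn_trans lt_tn; rewrite -szAB leq_addr.
  rewrite sh_rightE => [|A B szAB A0]; first by rewrite /= pexp_nil smul1l.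
  have -> : thb (one :: rcons B y) = 0.
    rewrite /thb (IHn (rcons B y) _).2 ?nhbar_0 //; last by case: (B).
    rewrite size_rcons; apply: leq_trans lt_tn; rewrite ltnS -szAB.
    by rewrite -[ltnLHS]add0n ltn_add2r lt0n.
  by rewrite smul0r.
have szt : (1 < size (one :: rcons t y))%N by rewrite /= size_rcons.
have Om : Omega (vec (one :: rcons t y)) = Z (rcons t y).
  by apply: (addIr (thb (one :: rcons t y))); rewrite -E pexp_Omega.
suff ph0 : phi (vec (one :: rcons t y)) = 0.
  by split=> [|//]; rewrite E /thb ph0 nhbar_0 addr0.
rewrite phiE ?size_map // Om -[(size (one :: _)).-1]/(size (rcons t y)).
case: (posnP (size t)) => [|t_gt0].
  by case: t {E szt Om lt_tn} => // _; rewrite /= pexp1 nb_fbar oppr0.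
have rt_gt1 : (1 < size (rcons t y))%N by rewrite size_rcons.
by rewrite -(ltn_predK rt_gt1) /= iter_nb_pexp // nb0 oppr0.
Qed.

Lemma Omega_one t : t <> [::] -> Omega (vec (one :: t)) = Z t.
Proof.
move=> t0; have [E ph0] := pexp_one t; rewrite -E pexp_Omega; last by case: (t) t0.
by rewrite /thb ph0 // nhbar_0 addr0.
Qed.

Lemma mprod_split n : splits n mprod.
Proof.
move=> s1 v s2 sz; rewrite /mprod (Omega_split v sz) size_cat /=.
rewrite (big_morph (fun w => h (iter (size s1 + (size s2).+1).-2 nb w 0%N)) (id1 := 0) (op1 := +%R)).
- by apply: eq_bigr => i _; rewrite size_cat.
- by move=> w1 w2; rewrite iter_nbD !fctE linearD.
- by rewrite iter_nb0 linear0.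
Qed.

(** On a letter v, Omega(1, v) = Z(v) has constant term f v, and h f is the identity. The sum over a
    one-entry list makes the right-hand side a function of lists, as [splits_eq0] requires. *)
Lemma mprod_one2 v : mprod [:: cl 1; v] = v.
Proof.
apply/eqP; rewrite -subr_eq0; apply/eqP.
pose G u := mprod (cl 1 :: u) - \sum_(x <- u) x.
suff : G [:: v] = 0 by rewrite /G big_seq1.
apply: (@splits_eq0 _ _ _ 1 G) => //; rewrite /G.
- case=> [|? ?] x [|? ?] //= _; under [RHS]eq_bigr do rewrite big_seq1.
  rewrite big_seq1 (@mprod_split 2 [:: cl 1] x [::]) //= sumrB; congr (_ - _).
  exact: hcomp_sum.
case=> [//|x [|//]] _; rewrite big_seq1 /mprod /= -/(vec [:: one; x]) Omega_one //.
by rewrite pexp1 (ret_hf fhs_ret) subrr.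
Qed.

(** For n letters v, m(1, v) is h of the constant term of nabla^(n-1) applied to Omega(1, v) = Z(v),
    which vanishes by [iter_nb_pexp]. *)
Lemma mprod_one v : (1 < size v)%N -> mprod (cl 1 :: v) = 0.
Proof.
move=> v_gt1; apply: (@splits_eq0 _ _ _ (size v) (fun u => mprod (cl 1 :: u))) => //.
  by move=> s1 x s2 sz; exact: (@mprod_split (size v).+1 (cl 1 :: s1) x s2 (congr1 succn sz)).
move=> t szt; have t_gt1 : (1 < size t)%N by rewrite szt.
rewrite /mprod -/(vec (one :: t)) Omega_one; last by case: (t) t_gt1.
by rewrite /= size_map iter_nb_pexp // linear0.
Qed.

End Unity.

End Canonical.

(** * Translation into sums over subsets and set partitions *)

Lemma sh_enumT n (d : 'I_n -> int) (V : zmodType) (G : seq 'I_n -> seq 'I_n -> V) :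
  sh (oddz \o d) (enum 'I_n) G = \sum_(A : {set 'I_n})
    sg (odd (koszul d (enum A ++ enum (~: A)))) (G (enum A) (enum (~: A))).
Proof.
rewrite enumT -enum_setT sh_enum; apply: eq_big => [A|A _]; first by rewrite subsetT.
by rewrite setTD.
Qed.

(** The last block is that of the largest position, so the condition on the last two positions says
    that both lie in the last block. *)
Lemma blocks_last n (P : {set {set 'I_n.+1}}) : partition P [set: 'I_n.+1] ->
  blocks P = rcons (blocks (P :\ pblock P ord_max)) (enum (pblock P ord_max)).
Proof.
move=> partP; set B := pblock P ord_max.
have maxP : ord_max \in cover P by rewrite (cover_partition partP) in_setT.
have PB : B \in P by exact: pblock_mem.
have maxB : ord_max \in B by rewrite mem_pblock.
have partPB := partitionD1 partP PB.
rewrite -{1}(setD1K PB) (blocks_setU1 partPB maxB) //.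
- by rewrite -setI_eq0 setIDA setIT setDv.
- by move=> y _; exact: leq_ord.
move=> y; rewrite !inE andbT => yB; rewrite ltn_neqAle leq_ord andbT.
by apply: contraNneq yB => /val_inj ->.
Qed.

Lemma enum_ordSS n :
  enum [set: 'I_n.+2] = rcons (rcons (enum [set i : 'I_n.+2 | (i < n)%N]) (inord n)) ord_max.
Proof.
have n_val : (inord n : 'I_n.+2) = n :> nat by rewrite inordK.
rewrite -enum_setU1_max => [|y]; last by rewrite inE n_val.
rewrite -enum_setU1_max => [|y]; last first.
  by rewrite !inE -val_eqE /= n_val => /orP[/eqP->//|/ltnW].
suff <- : [set: 'I_n.+2] = ord_max |: (inord n |: [set i : 'I_n.+2 | (i < n)%N]) by [].
apply/setP=> y; rewrite !inE -!val_eqE /= n_val.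
by have := ltn_ord y; rewrite ltnS leq_eqVlt ltnS leq_eqVlt.
Qed.

Theorem theorem1p2 (k : fieldType) (char_k : [pchar k] =i pred0)
    (C : gradComAlgType k) (K : nat -> {linear C -> C}) (K_qft : binary_qft K)
    (H : gradModType k) (cl : C -> H) (H_coh : is_cohomology K cl)
    (f : {linear H -> C}) (h : {linear C -> H}) (s : {linear C -> C})
    (fhs_ret : is_retract K cl f h s) (K_free : anomaly_free K f h s) :
  let pi := canonical_pi K f h s in
  exists m : seq H -> H,
    [/\ (* recursive formula, in arity n.+2 *)
        forall (n : nat) (d : 'I_n.+2 -> int) (v : n.+2.-tuple H),
          (forall i, homog (d i) (tnth v i)) ->
          pi v =
          \sum_(P : {set {set 'I_n.+2}} |
                  [&& partition P [set: 'I_n.+2],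
                      size (last [::] (blocks P)) == (n.+2 - #|P| + 1)%N
                    & pblock P (inord n) == pblock P ord_max])
            nhbar (n.+2 - #|P| - 1) ((-1) ^+ koszul d (flatten (blocks P)) *:
              pi (entries v (flatten (take #|P|.-1 (blocks P)))
                  ++ [:: m (entries v (last [::] (blocks P)))])),
        (* symmetry *)
        forall n, (2 <= n)%N -> sym_hom n 0 m,
        (* unity *)
        (forall v, m [:: cl 1; v] = v) /\
        (forall v : seq H, (2 <= size v)%N -> m (cl 1 :: v) = 0)
      & (* generalized associativity *)
        forall (n : nat) (d : 'I_n -> int) (v : n.-tuple H)
               (e1 e2 e3 : int) (w1 w2 w3 : H),
          (forall i, homog (d i) (tnth v i)) ->
          homog e1 w1 -> homog e2 w2 -> homog e3 w3 ->
          \sum_(A : {set 'I_n})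
            (-1) ^+ koszul d (enum A ++ enum (~: A)) *:
              m (entries v (enum A)
                 ++ [:: m (entries v (enum (~: A)) ++ [:: w1; w2]); w3])
          = \sum_(A : {set 'I_n})
            ((-1) ^+ koszul d (enum A ++ enum (~: A))
             * (-1) ^+ absz ((\sum_(j in ~: A) d j) * e1)) *:
              m (entries v (enum A)
                 ++ [:: w1; m (entries v (enum (~: A)) ++ [:: w2; w3])])].
Proof.
move=> pi; pose m := mprod K f h s; exists m; split.
- move=> n d v hv; pose x i := Letter (hv i).
  pose vec := map (@lvec k H).
  have vE B : entries v B = vec (map x B) by apply: entries_letters.
  (* As [ps] runs over all partitions, the summand is set to 0 outside the range of summation. *)
  pose F (bl : seq (seq 'I_n.+2)) : series H :=
    if (size (last [::] bl) == n.+2 - size bl + 1)%N && (inord n \in last [::] bl)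
    then nhbar (n.+2 - size bl - 1) (pi (entries v (flatten (take (size bl).-1 bl))
                  ++ [:: m (entries v (last [::] bl))])) else 0.
  transitivity (ps (oddz \o d) (enum [set: 'I_n.+2]) F); last first.
    rewrite ps_enum [RHS](eq_bigl (fun P : {set {set 'I_n.+2}} =>
      partition P [set: 'I_n.+2] && ((size (last [::] (blocks P)) == n.+2 - size (blocks P) + 1)%N
        && (inord n \in last [::] (blocks P))))) => [|P].
      rewrite [RHS]big_mkcondr; apply: eq_bigr => P partP; rewrite /F size_blocks.
      by case: ifP => _; rewrite ?sg0 // sgZ nhbar_sg.
    rewrite size_blocks; case partP: (partition P _) => //=; congr (_ && _).
    rewrite [in RHS](blocks_last partP) last_rcons mem_enum eq_sym eq_pblock //.
      exact: partition_trivIset partP.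
    by rewrite (cover_partition partP) in_setT.
  rewrite enum_ordSS; set e0 := enum [set i : 'I_n.+2 | _]; set i1 := inord n; set i2 := ord_max.
  have sz0 : size e0 = n.
    have := congr1 size (enum_ordSS n); rewrite !size_rcons -cardE cardsT card_ord.
    by move=> /eqP; rewrite !eqSS => /eqP.
  have n_val : i1 = n :> nat by rewrite /i1 inordK.
  have i1e0 : i1 \notin e0 by rewrite mem_enum inE n_val ltnn.
  have i12 : i1 != i2 by rewrite -val_eqE /= n_val neq_ltn ltnSn.
  have -> : pi v = pi (vec (map x e0 ++ [:: x i1; x i2])).
    congr pi; rewrite -[LHS](map_tnth_enum v) enumT -enum_setT enum_ordSS -/e0 -/i1 -/i2.
    by rewrite cats2 /vec -!map_rcons -map_comp; exact: eq_map.
  apply: (etrans (pi_recursion K_qft fhs_ret K_free (x i1) (x i2) _)); rewrite sh_map.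
  (* In the second sum [i1] is outside the last block [rcons B i2], so F vanishes. That B avoids
     [i1] is seen by counting: the number of occurrences is additive over splittings and is 0 on
     [e0]. *)
  rewrite ps_rcons sh_rcons [X in _ = _ + X](_ : _ = 0) ?addr0; last first.
    rewrite -[RHS](sh0 (oddz \o d) (series H) e0).
    apply: (eq_sh_sum (f := fun y => (y == i1 : nat))) => A B.
    rewrite [in RHS]big_seq [in RHS]big1 => [|y ye0]; last first.
      by case: eqP => // E; move: i1e0; rewrite -E ye0.
    move=> cnt; rewrite ps_eq0 ?sg0 // => bl _ _ _; rewrite /F last_rcons mem_rcons in_cons.
    rewrite (negPf i12) /= [i1 \in B](_ : _ = false) ?andbF //.
    apply/negP=> iB; have : (\sum_(y <- B) (y == i1 : nat))%N = 0%N.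
      by apply/eqP; have /eqP := cnt; rewrite [_ == 0]addn_eq0 => /andP[].
    by rewrite (big_rem i1) //= eqxx.
  apply: eq_sh => A B szAB _.
  (* The size condition on the last block leaves only the partition of A into singletons. *)
  transitivity (ps (oddz \o d) A (fun bl => if size bl == size A then
    nhbar (size B) (pi (entries v (flatten bl) ++ [:: m (entries v (B ++ [:: i1; i2]))])) else 0)).
    rewrite ps_singletons flatten_seq1 size_map !vE /vec map_cat map_rcons cats1.
    by rewrite /= !map_cat.
  apply: eq_ps => bl szbl _ bl0; have := size_flatten_leq bl0; rewrite szbl => le_bl.
  rewrite /F last_rcons !size_rcons !(mem_rcons, in_cons) eqxx orbT andbT.
  have -> : ((size B).+2 == n.+2 - (size bl).+1 + 1)%N = (size bl == size A).
    by move: szAB; rewrite sz0; lia.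
  case: eqP => // szE; rewrite /= -cats1 take_size_cat // cats2.
  by congr (nhbar _ _); move: szAB; rewrite sz0 szE; lia.
- by move=> n n_gt1; exact: (sym_hom_mprod K_qft fhs_ret K_free).
- split=> [v|v v_gt1]; first exact: (mprod_one2 K_qft fhs_ret K_free).
  exact: (mprod_one K_qft fhs_ret K_free).
move=> n d v e1 e2 e3 w1 w2 w3 hv hw1 hw2 hw3; pose x i := Letter (hv i).
pose l1 := Letter hw1; pose l2 := Letter hw2; pose l3 := Letter hw3.
have vE B : entries v B = map (@lvec k H) (map x B) by apply: entries_letters.
have := mprod_assoc K_qft fhs_ret K_free l1 l2 l3 (map x (enum 'I_n)).
rewrite /assoc_left /assoc_right !(sh_map _ x) !sh_enumT => E.
transitivity (\sum_(A : {set 'I_n}) sg (odd (koszul d (enum A ++ enum (~: A))))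
   (m (entries v (enum A) ++ [:: m (entries v (enum (~: A)) ++ [:: w1; w2]); w3]))).
  by apply: eq_bigr => A _; rewrite sgZ.
transitivity (\sum_(A : {set 'I_n}) sg (odd (koszul d (enum A ++ enum (~: A))))
   (sg (par (oddz \o d) (enum (~: A)) && oddz e1)
   (m (entries v (enum A) ++ [:: w1; m (entries v (enum (~: A)) ++ [:: w2; w3])])))).
  move: E; congr (_ = _); apply: eq_bigr => A _; congr (sg _ _).
    by rewrite !vE !map_cat /= map_cat.
  by rewrite par_map !vE !map_cat /= map_cat.
apply: eq_bigr => A _; rewrite -scalerA !sgZ abszM oddM -!/(oddz _).
rewrite -(oddz_degl d) /degl; congr (sg _ (sg (oddz _ && _) _)).
by rewrite big_enum.
Qed.
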